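(* Let $\Bbbk$ be an uncountable algebraically closed field of characteristic zero, and let $(R,\mathfrak{m},\Bbbk)$ be a one-dimensional standard graded Cohen-Macaulay ring with $R_0=\Bbbk$. If $R$ is of graded countable Cohen-Macaulay type, then $R$ is either of minimal multiplicity with $h$-vector $(1,2)$, or is isomorphic to one of the following hypersurfaces: (1) $\Bbbk[x]$; (2) $\Bbbk[x,y]/(xy)$; (3) $\Bbbk[x,y]/(xy(x+y))$; (4) $\Bbbk[x,y]/(xy^2)$; (5) $\Bbbk[x,y]/(y^2)$.
   Context: A ring $R$ is standard graded if it is Noetherian and, as an abelian group, $R=\bigoplus_{i\geqslant 0}R_i$ with $R_iR_j\subseteq R_{i+j}$ for all $i,j\geqslant 0$, $R_0$ is a field, and $R=R_0[R_1]$. Write $\mathfrak{m}=\bigoplus_{i\geqslant 1}R_i$ for the irrelevant maximal ideal and $\Bbbk=R_0=R/\mathfrak{m}$. All variables have degree one. A standard graded Cohen-Macaulay ring has graded countable Cohen-Macaulay type if it has at most countably many indecomposable graded maximal Cohen-Macaulay modules (finitely generated), up to graded isomorphism and shift in degree. A Cohen-Macaulay standard graded ring $R$ has minimal multiplicity if $e(R)=\dim_\Bbbk(\mathfrak{m}/\mathfrak{m}^2)-\dim R+1$, where $e(R)$ is the multiplicity of $\mathfrak{m}$. The $h$-vector of a $d$-dimensional standard graded Cohen-Macaulay ring $R$ is the sequence $\left(\dim_\Bbbk (R/(x_1,\dots,x_d))_i\right)_{i\geqslant 0}$, where $x_1,\dots,x_d$ is a homogeneous regular sequence of elements of degree one;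 trailing zeros are omitted. *)

(* Defs.v *)
From HB Require Import structures.
From mathcomp Require Import all_boot all_order all_algebra.
From mathcomp Require Import boolp classical_sets cardinality.
From mathcomp Require Import mpoly.

Set Implicit Arguments.
Unset Strict Implicit.
Unset Printing Implicit Defensive.

Import GRing.Theory.

Local Open Scope classical_set_scope.
Local Open Scope ring_scope.

(* V is the internal direct sum of the subgroups G i *)
Definition is_grading (I : eqType) (V : zmodType) (G : I -> set V) : Prop :=
  [/\ forall i, G i 0 /\ (forall x y, G i x -> G i y -> G i (x - y)),
      forall x, exists (s : seq I) (f : I -> V),
        [/\ uniq s, forall i, G i (f i) & x = \sum_(i <- s) f i]
    & forall (s : seq I) (f : I -> V), uniq s -> (forall i, G i (f i)) ->
        \sum_(i <- s) f i = 0 -> forall i, i \in s -> f i = 0].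

(* dim_k (U / W) = n, for subspaces W of U *)
Definition quot_dim (k : fieldType) (V : lmodType k) (U W : set V) (n : nat)
    : Prop :=
  exists v : 'I_n -> V,
    [/\ forall i, U (v i),
        forall x, U x -> exists c : 'I_n -> k, W (x - \sum_i c i *: v i)
      & forall c : 'I_n -> k, W (\sum_i c i *: v i) -> forall i, c i = 0].

Section CommutativeRings.
Variable R : comNzRingType.

Definition is_ideal (I : set R) : Prop :=
  [/\ I 0, forall x y, I x -> I y -> I (x + y)
    & forall a x, I x -> I (a * x)].

Definition prime_ideal (P : set R) : Prop :=
  [/\ is_ideal P, ~ P 1 & forall x y, P (x * y) -> P x \/ P y].

Definition prime_chain (n : nat) : Prop :=
  exists P : nat -> set R,
    (forall i, (i <= n)%N -> prime_ideal (P i)) /\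
    (forall i, (i < n)%N -> P i `<` P i.+1).

Definition krull_dim (d : nat) : Prop := prime_chain d /\ ~ prime_chain d.+1.

Definition ideal_mul (I J : set R) : set R :=
  [set x | exists s : seq (R * R),
    (forall p, p \in s -> I p.1 /\ J p.2) /\ x = \sum_(p <- s) p.1 * p.2].

Definition ideal_exp (I : set R) (n : nat) : set R :=
  iter n (ideal_mul I) [set: R].

Definition is_subring (S : set R) : Prop :=
  [/\ S 1, forall x y, S x -> S y -> S (x - y)
    & forall x y, S x -> S y -> S (x * y)].

Definition finitely_generated (M : lmodType R) : Prop :=
  exists s : seq M, forall v, exists c : 'I_(size s) -> R,
    v = \sum_(i < size s) c i *: s`_i.

(* the submodule (x_1, ..., x_n) M *)
Definition seq_span (M : lmodType R) (xs : seq R) : set M :=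
  [set v | exists w : 'I_(size xs) -> M, v = \sum_(i < size xs) xs`_i *: w i].

Definition noetherian : Prop :=
  forall I : set R, is_ideal I -> exists s : seq R, I = @seq_span R^o s.

Definition regular_seq (M : lmodType R) (xs : seq R) : Prop :=
  (forall i, (i < size xs)%N -> forall v : M,
     seq_span (take i xs) (xs`_i *: v) -> seq_span (take i xs) v) /\
  @seq_span M xs <> [set: M].

(* the depth of M with respect to the ideal I *)
Definition depth (I : set R) (M : lmodType R) (n : nat) : Prop :=
  (exists xs : seq R,
     [/\ size xs = n, (forall x, x \in xs -> I x) & regular_seq M xs]) /\
  (forall xs : seq R,
     (forall x, x \in xs -> I x) -> regular_seq M xs -> (size xs <= n)%N).

End CommutativeRings.

Section GradedAlgebras.
Variables (k : fieldType) (R : comAlgType k) (G : nat -> set R).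

Definition standard_graded : Prop :=
  [/\ noetherian R,
      is_grading G,
      forall i j x y, G i x -> G j y -> G (i + j)%N (x * y),
      G 0%N = [set c%:A | c in [set: k]]
    & forall S : set R, is_subring S -> G 0%N `<=` S -> G 1%N `<=` S ->
        S = [set: R]].

Definition irrelevant_ideal : set R :=
  [set x | exists (n : nat) (f : nat -> R),
    (forall i, G i.+1 (f i)) /\ x = \sum_(i < n) f i].

Local Notation m := irrelevant_ideal.

(* As usual in the graded setting, depth is taken with respect to the         *)
(* irrelevant maximal ideal, for R as for its graded modules.                 *)
Definition cohen_macaulay : Prop :=
  exists d, krull_dim R d /\ depth m R^o d.

(* e / d! is the leading coefficient of the Hilbert-Samuel polynomial of m *)
Definition multiplicity (e : nat) : Prop :=
  exists (d : nat) (P : {poly rat}),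
    [/\ krull_dim R d,
        size P = d.+1,
        lead_coef P * (d`!)%:R = e%:R
      & exists n0 : nat, forall n, (n0 <= n)%N ->
          exists2 l : nat, quot_dim [set: R] (ideal_exp m n.+1) l
                         & P.[n%:R] = l%:R].

(* e = mu - d + 1, rearranged so as to avoid truncated subtraction *)
Definition minimal_multiplicity : Prop :=
  cohen_macaulay /\
  exists e mu d : nat,
    [/\ multiplicity e, quot_dim m (ideal_exp m 2) mu, krull_dim R d
      & (e + d = mu + 1)%N].

(* (R/(xs))_i is the image of R_i, i.e. R_i modulo its intersection with (xs) *)
Definition h_vector (h : seq nat) : Prop :=
  exists (d : nat) (xs : seq R),
    [/\ krull_dim R d, size xs = d,
        (forall x, x \in xs -> G 1%N x) & regular_seq R^o xs] /\
    [/\ forall i, quot_dim (G i) (G i `&` @seq_span R R^o xs) (nth 0%N h i)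
      & last 1%N h != 0%N].

Record gradedModule := GradedModule {
  gm_sort :> lmodType R;
  gm_piece : int -> set gm_sort;
  gm_grading : is_grading gm_piece;
  gm_scale : forall (i : nat) (j : int) (a : R) (v : gm_sort),
    G i a -> gm_piece j v -> gm_piece (i%:Z + j) (a *: v)
}.

Definition maximal_cohen_macaulay (M : gradedModule) : Prop :=
  finitely_generated M /\ exists d, krull_dim R d /\ depth m M d.

Definition graded_submodule (M : gradedModule) (N : set M) : Prop :=
  [/\ N 0, forall x y, N x -> N y -> N (x + y),
      forall (a : R) x, N x -> N (a *: x)
    & forall x, N x -> exists (s : seq int) (f : int -> M),
        [/\ uniq s, forall i, gm_piece i (f i) /\ N (f i)
          & x = \sum_(i <- s) f i]].

Definition indecomposable (M : gradedModule) : Prop :=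
  (exists v : M, v != 0) /\
  forall N L : set M, graded_submodule N -> graded_submodule L ->
    (forall v : M, exists x y, [/\ N x, L y & v = x + y]) ->
    N `&` L = [set 0] -> N = [set 0] \/ L = [set 0].

Definition isomorphic_up_to_shift (M N : gradedModule) : Prop :=
  exists (s : int) (phi : {linear M -> N}),
    bijective phi /\
    forall i v, gm_piece i v <-> gm_piece (i + s) (phi v).

Definition graded_countable_CM_type : Prop :=
  [/\ standard_graded, cohen_macaulay
    & exists F : nat -> gradedModule, forall M : gradedModule,
        maximal_cohen_macaulay M -> indecomposable M ->
        exists n, isomorphic_up_to_shift M (F n)].

End GradedAlgebras.

Definition graded_isomorphic (k : fieldType) (R S : comAlgType k)
    (G : nat -> set R) (H : nat -> set S) : Prop :=
  exists phi : {lrmorphism R -> S},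
    bijective phi /\ forall i x, G i x <-> H i (phi x).

(* The quotient A/(f) as a k-algebra. The ring structure of {ideal_quot _}    *)
(* requires a proper ideal, hence the hypothesis on f.                        *)
Definition principal_ideal (A : comNzRingType) (f : A) : set A :=
  [set q * f | q in [set: A]].

Definition principal_pred (A : comNzRingType) (f : A)
    (hf : ~ principal_ideal f 1) : {pred A} :=
  fun p => `[< principal_ideal f p >].

Section PrincipalQuotient.
Variables (A : comNzRingType) (f : A) (hf : ~ principal_ideal f 1).

Lemma principal_pred_closed : idealr_closed (principal_pred hf).
Proof.
split.
- by apply/asboolP; exists 0; rewrite // mul0r.
- by apply/negP => /asboolP.
- move=> a x y /asboolP[p _ <-] /asboolP[q _ <-]; apply/asboolP.
  by exists (a * p + q); rewrite // mulrDl mulrA.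
Qed.

HB.instance Definition _ :=
  isIdealr.Build A (principal_pred hf) principal_pred_closed.

End PrincipalQuotient.

Definition principal_quot (A : comNzRingType) (f : A)
    (hf : ~ principal_ideal f 1) : Type := {ideal_quot (principal_pred hf)}.

Section PrincipalQuotientAlgebra.
Variables (k : fieldType) (A : comAlgType k) (f : A).
Variable hf : ~ principal_ideal f 1.
Local Notation Q := (principal_quot hf).

HB.instance Definition _ := GRing.ComNzRing.on Q.

Definition principal_proj (p : A) : Q :=
  (\pi_{ideal_quot (principal_pred hf)} p)%qT.

Lemma principal_projD : {morph principal_proj : p q / p + q}.
Proof. by move=> p q; rewrite /principal_proj rmorphD. Qed.

Lemma principal_projM : {morph principal_proj : p q / p * q}.
Proof. by move=> p q; rewrite /principal_proj rmorphM. Qed.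

Lemma principal_proj1 : principal_proj 1 = 1.
Proof. by rewrite /principal_proj rmorph1. Qed.

Definition principal_scale (c : k) (x : Q) : Q := principal_proj c%:A * x.

Fact principal_scaleA a b x :
  principal_scale a (principal_scale b x) = principal_scale (a * b) x.
Proof.
by rewrite /principal_scale mulrA -principal_projM -scalerAl mul1r scalerA.
Qed.

Fact principal_scale1 : left_id 1 principal_scale.
Proof. by move=> x; rewrite /principal_scale scale1r principal_proj1 mul1r. Qed.

Fact principal_scaleDr : right_distributive principal_scale +%R.
Proof. by move=> a x y; rewrite /principal_scale mulrDr. Qed.

Fact principal_scaleDl x : {morph principal_scale^~ x : a b / a + b}.
Proof.
by move=> a b; rewrite /principal_scale scalerDl principal_projD mulrDl.
Qed.

HB.instance Definition _ := GRing.Zmodule_isLmodule.Build k Q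
  principal_scaleA principal_scale1 principal_scaleDr principal_scaleDl.

Fact principal_scaleAl (a : k) (x y : Q) : a *: (x * y) = a *: x * y.
Proof. exact: mulrA. Qed.

HB.instance Definition _ := GRing.Lmodule_isLalgebra.Build k Q principal_scaleAl.

Fact principal_scaleAr (a : k) (x y : Q) : a *: (x * y) = x * (a *: y).
Proof. exact: mulrCA. Qed.

HB.instance Definition _ := GRing.Lalgebra_isAlgebra.Build k Q principal_scaleAr.

Definition quot_grading (G : nat -> set A) (i : nat) : set Q :=
  [set principal_proj p | p in G i].

End PrincipalQuotientAlgebra.

Definition mpoly_grading (k : fieldType) (n i : nat) : set {mpoly k[n]} :=
  [set p | p \is i.-homog].

(* R is isomorphic to k[x_1, ..., x_n]/(f) as a graded k-algebra *)
Definition isomorphic_to_hypersurface (k : fieldType) (R : comAlgType k)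
    (G : nat -> set R) (n : nat) (f : {mpoly k[n]}) : Prop :=
  exists hf : ~ principal_ideal f 1,
    graded_isomorphic G
      (quot_grading (A := {mpoly k[n]}) (hf := hf) (@mpoly_grading k n)).

Definition var_x (k : fieldType) : {mpoly k[2]} := 'X_ord0.
Definition var_y (k : fieldType) : {mpoly k[2]} := 'X_ord_max.

(* Main.v *)
Require Import Defs.
From HB Require Import structures.
From mathcomp Require Import all_boot all_order all_algebra.
From mathcomp Require Import boolp classical_sets cardinality.
From mathcomp Require Import mpoly.
From mathcomp Require Import ring.

Set Implicit Arguments.
Unset Strict Implicit.
Unset Printing Implicit Defensive.

Import GRing.Theory.

Local Open Scope classical_set_scope.
Local Open Scope ring_scope.

(** A one-dimensional Cohen-Macaulay [R] has a nonzerodivisor [x] of degree one.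
    It is determined by the finite-dimensional algebra [A = R/(x - 1)] together with
    the filtration of [A] by the images of the graded pieces of [R], which
    embed in [A] and eventually fill it ([dehomogenization]). In the same way
    an exhaustive filtration of [A^n] by subspaces, compatible with that of
    [A], defines a graded maximal Cohen-Macaulay module ([filtered_mcm]), and
    the homogeneous maps between two such modules are the [n x n] matrices over
    [A] that respect the filtrations ([filtered_indecomposable],
    [filtered_iso_matrix]). Uncountable families of modules thus come from
    moduli of subspaces.

    For [n = 1], take the filtrations of [A] whose lowest step is a plane
    [U_a], the span of [1] and [a]. Units of [A] move [U_a] to [U_b] exactly
    when [a] and [b] are related by a Moebius transformation over [k]. That
    group has dimension three, so if [dim A >= 4] some line of elements [a]
    meets each class in a countable set, with planes whose endomorphism rings
    are local ([moduli_of_dim_gt3]). Countable type therefore forces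
    [dim A <= 3] ([no_uncountable_moduli]).

    Now look at the image [V] of [R_1] in [A], which contains [1]. If [V] is
    the line of scalars, then [R = k[x]]. If [V] is three-dimensional, then
    [V = A], all pieces of positive degree have dimension three, and [R] has
    minimal multiplicity with h-vector [(1, 2)]
    ([minimal_multiplicity_of_span]). Otherwise [V] is spanned by [1] and an
    element [a] that generates [A], whose minimal polynomial has degree two or
    three; homogenizing it gives the equation of [R] in two variables
    ([hypersurface_of_relation]), and its factorization gives the list of
    hypersurfaces, up to the one case of a triple root.

    The triple root is excluded by rank three modules
    ([triple_root_uncountable]). If [1, a, a^2] is a basis of [A] and
    [a^3 = 0], a filtration of [A^3] may be prescribed separately on the three
    summands [k^3], [a k^3] and [a^2 k^3], by flags in [k^3] that start with
    increasing delays so that multiplication by [a] respects them. Two opposite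
    flags and the line of a third one in general position are preserved by
    scalars only, while the plane of the third flag moves in a one-parameter
    family. *)

(** * Noetherian rings *)

Section NoetherianRings.
Variable R : comNzRingType.
Implicit Types (I J P : set R).

Lemma ideal_sum I (T : eqType) (s : seq T) (f : T -> R) : is_ideal I ->
  (forall i, i \in s -> I (f i)) -> I (\sum_(i <- s) f i).
Proof.
case=> I0 ID _ If; rewrite big_seq; exact: (big_ind I).
Qed.

Lemma seq_span_sub I (s : seq R) : is_ideal I ->
  (forall x, x \in s -> I x) -> @seq_span R R^o s `<=` I.
Proof.
move=> Iid sI _ [w ->]; apply: ideal_sum => // i _.
case: Iid => _ _ IM; rewrite /GRing.scale /= mulrC; apply: IM.
exact/sI/mem_nth.
Qed.

Lemma mem_seq_span (s : seq R) x : x \in s -> @seq_span R R^o s x.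
Proof.
move=> xs; have lt_i : (index x s < size s)%N by rewrite index_mem.
exists (fun i => if i == Ordinal lt_i then 1 else 0).
rewrite (bigD1 (Ordinal lt_i)) //= eqxx big1 ?addr0 => [|i /negPf->].
  by rewrite nth_index // /GRing.scale /= mulr1.
by rewrite scaler0.
Qed.

Definition principal_sum I a : set R := [set x | exists u c, I u /\ x = u + c * a].

Lemma principal_sum_ideal I a : is_ideal I -> is_ideal (principal_sum I a).
Proof.
case=> I0 ID IM; split.
- by exists 0, 0; rewrite mul0r addr0.
- move=> _ _ [u [c [Iu ->]]] [v [d [Iv ->]]].
  by exists (u + v), (c + d); split; [exact: ID|rewrite mulrDl addrACA].
- move=> b _ [u [c [Iu ->]]].
  by exists (b * u), (b * c); split; [exact: IM|rewrite mulrDr mulrA].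
Qed.

Lemma sub_principal_sum I a : I `<=` principal_sum I a.
Proof. by move=> x Ix; exists x, 0; rewrite mul0r addr0. Qed.

Lemma mem_principal_sum I a : is_ideal I -> principal_sum I a a.
Proof. by case=> I0 _ _; exists 0, 1; rewrite mul1r add0r. Qed.

Hypothesis noethR : noetherian R.

(** A strictly increasing sequence of ideals would have a finitely generated
    union, whose generators already lie in some term of the sequence. *)
Lemma noetherian_max (F : set (set R)) I0 : F I0 -> (forall I, F I -> is_ideal I) ->
  exists I, [/\ F I, I0 `<=` I & forall J, F J -> I `<=` J -> J = I].
Proof.
move=> FI0 Fid; apply: contrapT => nomax.
have next (I : {I | F I /\ I0 `<=` I}) :
    exists J : {I | F I /\ I0 `<=` I}, sval I `<` sval J.
  case: I => I [FI I0I] /=; apply: contrapT => noJ; apply: nomax.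
  exists I; split=> // J FJ IJ; apply: contrapT => neqJI; apply: noJ.
  exists (exist _ J (conj FJ (subset_trans I0I IJ))) => /=.
  by rewrite properEneq; split=> //; apply/eqP => eIJ; exact: neqJI.
have [g gP] := choice next.
pose u n := iter n g (exist _ I0 (conj FI0 (@subset_refl _ I0))).
have u_mono m n : (m <= n)%N -> sval (u m) `<=` sval (u n).
  move=> /subnK <-; elim: (n - m)%N => [|d IHd] //=.
  by apply: subset_trans IHd _; case: (gP (u (d + m)%N)).
have uid n : is_ideal (sval (u n)) by apply: Fid; case: (svalP (u n)).
pose U := [set x | exists n, sval (u n) x].
have Uid : is_ideal U.
  split.
  - by exists 0%N; case: (uid 0%N).
  - move=> x y [m um] [n un]; exists (maxn m n).
    case: (uid (maxn m n)) => _ D _; apply: D.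
      exact: u_mono (leq_maxl _ _) _ um.
    exact: u_mono (leq_maxr _ _) _ un.
  - by move=> a x [n un]; exists n; case: (uid n) => _ _; apply.
have [s Us] := noethR Uid.
have [n sn] : exists n, forall x, x \in s -> sval (u n) x.
  have : forall x, x \in s -> U x by move=> x xs; rewrite Us; exact: mem_seq_span.
  elim: s {Us} => [|x s IHs] Us; first by exists 0%N.
  have [n un] := IHs (fun y ys => Us y (@mem_behead _ (x :: s) y ys)).
  have [m um] := Us x (mem_head _ _).
  exists (maxn m n) => y; rewrite inE => /orP[/eqP->|ys].
    exact: u_mono (leq_maxl _ _) _ um.
  exact: u_mono (leq_maxr _ _) _ (un y ys).
have [_] := gP (u n); apply=> x ux.
have : U x by exists n.+1.
by rewrite Us => /(seq_span_sub (uid n) sn).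
Qed.

(** Maximal elements of suitable families of ideals are prime: it suffices that
    leaving the family by adjoining [a] and by adjoining [b] forces [a * b]
    out of the ideal. *)
Lemma prime_of_maximal (F : set (set R)) I0 : F I0 ->
  (forall I, F I -> is_ideal I) -> (forall I, F I -> ~ I 1) ->
  (forall I a b, F I -> I (a * b) ->
     F (principal_sum I a) \/ F (principal_sum I b)) ->
  exists P, [/\ prime_ideal P, I0 `<=` P & F P].
Proof.
move=> FI0 Fid F1 Fab; have [P [FP I0P maxP]] := noetherian_max FI0 Fid.
exists P; split=> //; split; [exact: Fid|exact: F1|].
move=> a b Pab; have Pid := Fid _ FP.
by case: (Fab P a b FP Pab) => /maxP e; [left|right];
  rewrite -e; [exact: mem_principal_sum|exact: sub_principal_sum
             |exact: mem_principal_sum|exact: sub_principal_sum].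
Qed.

(** Krull's theorem: an ideal maximal among those disjoint from [S] is prime. *)
Lemma prime_avoiding I0 (S : set R) : is_ideal I0 -> S 1 ->
  (forall x y, S x -> S y -> S (x * y)) -> (forall x, I0 x -> ~ S x) ->
  exists P, [/\ prime_ideal P, I0 `<=` P & forall x, P x -> ~ S x].
Proof.
move=> I0id S1 SM I0S.
pose F := [set I | is_ideal I /\ forall x, I x -> ~ S x].
have [||||P [Pp I0P [_ PS]]] := @prime_of_maximal F I0 => //.
- by move=> I [].
- by move=> I [_ IS] /IS.
- move=> I a b [Iid IS] Iab; apply: contrapT => /not_orP[nFa nFb].
  have meets c : ~ F (principal_sum I c) ->
      exists u d, I u /\ S (u + d * c).
    move=> nF; apply: contrapT => no; apply: nF.
    split; first exact: principal_sum_ideal.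
    by move=> _ [u [d [Iu ->]]] Sx; apply: no; exists u, d.
  have [u [c [Iu Sa]]] := meets a nFa; have [v [d [Iv Sb]]] := meets b nFb.
  apply: IS (SM _ _ Sa Sb); case: Iid => _ ID IM.
  have -> : (u + c * a) * (v + d * b) =
            (v + d * b) * u + (c * a * v + c * d * (a * b)) by ring.
  by apply: (ID); [exact: IM|apply: ID; exact: IM].
- by exists P.
Qed.

Definition annihilator (z : R) : set R := [set r | r * z = 0].

Lemma annihilator_ideal z : is_ideal (annihilator z).
Proof.
split; rewrite /annihilator /=; first by rewrite mul0r.
- by move=> x y xz yz; rewrite mulrDl xz yz addr0.
- by move=> a x xz; rewrite -mulrA xz mulr0.
Qed.

(** The maximal annihilators are prime, and there are finitely many of them:
    if [z_1, ..., z_n] generate the ideal spanned by all the [z] with maximal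
    annihilator, then every such annihilator contains, and so equals, one of
    those of the [z_i]. *)
Lemma finite_zero_divisors : exists zs : seq R,
  (forall z, z \in zs -> z != 0) /\
  (forall r v, v != 0 -> r * v = 0 -> exists2 z, z \in zs & r * z = 0).
Proof.
pose F := [set annihilator z | z in [set z | z != 0]].
have Fid I : F I -> is_ideal I by case=> z _ <-; exact: annihilator_ideal.
pose mx z := z != 0 /\ forall w, w != 0 -> annihilator z `<=` annihilator w ->
  annihilator w = annihilator z.
have exmx v : v != 0 -> exists2 z, mx z & annihilator v `<=` annihilator z.
  move=> v0; have Fv : F (annihilator v) by exists v.
  have [_ [[z z0 <-] vz zmax]] := noetherian_max Fv Fid.
  by exists z => //; split=> // w w0 zw; apply: zmax => //; exists w.
have mxp z a b : mx z -> annihilator z (a * b) ->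
    annihilator z a \/ annihilator z b.
  move=> [z0 zmax] abz; have [|bz0] := eqVneq (b * z) 0; first by right.
  left; rewrite -(zmax _ bz0).
    by rewrite /annihilator /= mulrA.
  by move=> r /= rz; rewrite /annihilator /= mulrCA rz mulr0.
pose Z := [set v : R | exists s : seq (R * R),
  (forall p, p \in s -> mx p.2) /\ v = \sum_(p <- s) p.1 * p.2].
have Zid : is_ideal Z.
  split.
  - by exists [::]; rewrite big_nil.
  - move=> _ _ [s [sm ->]] [t [tm ->]]; exists (s ++ t); rewrite big_cat.
    by split=> // p; rewrite mem_cat => /orP[/sm|/tm].
  - move=> a _ [s [sm ->]]; exists [seq (a * p.1, p.2) | p <- s].
    split; first by move=> _ /mapP[p /sm ? ->].
    by rewrite big_map mulr_sumr; apply: eq_bigr => p _; rewrite mulrA.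
have [gs Zgs] := noethR Zid.
have [zs [zsm zsP]] : exists zs : seq R, (forall z, z \in zs -> mx z) /\
    forall r, (forall z, z \in zs -> r * z = 0) ->
      forall g, g \in gs -> r * g = 0.
  have : forall g, g \in gs -> Z g.
    by move=> g ggs; rewrite Zgs; exact: mem_seq_span.
  elim: gs {Zgs} => [|g gs IHgs] gsZ; first by exists [::].
  have [zs [zsm zsP]] := IHgs (fun y ys => gsZ y (@mem_behead _ (g :: gs) y ys)).
  have [s [sm gE]] := gsZ g (mem_head _ _).
  exists ([seq p.2 | p <- s] ++ zs); split.
    by move=> z; rewrite mem_cat => /orP[/mapP[p /sm ? ->]|/zsm].
  move=> r rz h; rewrite inE => /orP[/eqP->|hgs].
    rewrite gE mulr_sumr big_seq big1 // => p ps.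
    by rewrite mulrCA rz ?mulr0 // mem_cat map_f.
  by apply: zsP hgs => z zzs; rewrite rz // mem_cat zzs orbT.
exists zs; split=> [z /zsm[]//|r v v0 rv].
have [z mz vz] := exmx v v0; have rz : r * z = 0 by exact: vz.
suff [z' z'zs zz'] : exists2 z', z' \in zs & annihilator z' `<=` annihilator z.
  exists z' => //; have [z0 _] := mz; have [_ maxz'] := zsm _ z'zs.
  by have /seteqP[] := maxz' z z0 zz' => /(_ r rz).
apply: contrapT => none.
(* A product of elements killing the generators but not [z]. *)
have [a [az akills]] : exists a, a * z != 0 /\ forall w, w \in zs -> a * w = 0.
  elim: zs {zsP} zsm none => [|w zs IHzs] zsm none.
    by exists 1; rewrite mul1r; case: mz.
  have [||a [az akills]] := IHzs.
  - by move=> y yzs; apply: zsm; rewrite inE yzs orbT.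
  - by case=> y yzs yz; apply: none; exists y; rewrite // inE yzs orbT.
  have : ~ annihilator w `<=` annihilator z.
    by move=> wz; apply: none; exists w; rewrite // mem_head.
  move=> /existsNP[b /not_implyP[bw bz]].
  exists (a * b); split.
    by apply/eqP => /(mxp _ _ _ mz)[/eqP|//]; rewrite (negPf az).
  move=> y; rewrite inE => /orP[/eqP->|yzs]; first by rewrite -mulrA bw mulr0.
  by rewrite mulrAC akills // mul0r.
have : Z z by exists [:: (1, z)]; rewrite big_seq1 mul1r; split=> // p;
  rewrite inE => /eqP->.
rewrite Zgs => -[w zE]; move/eqP: az; apply.
rewrite zE mulr_sumr big1 // => i _.
by rewrite /GRing.scale /= mulrA (zsP a akills) ?mul0r // mem_nth.
Qed.

End NoetherianRings.

(** * Graded algebras and their components *)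

(** Take [w] in [W] outside the first subspaces and [v] in [W] outside the next
    one: on the line of the [v + t w] every subspace excludes at most one [t]. *)
Lemma subspaces_avoid (k : fieldType)
    (k_inf : forall s : seq k, exists t, t \notin s)
    (V : lmodType k) (T : eqType) (W : set V) (U : T -> set V) (zs : seq T) :
  (forall c x y, W x -> W y -> W (x + c *: y)) -> W 0 ->
  (forall z c x y, U z x -> U z y -> U z (x + c *: y)) ->
  (forall z, z \in zs -> ~ W `<=` U z) ->
  exists2 w, W w & forall z, z \in zs -> ~ U z w.
Proof.
move=> WL W0 UL; elim: zs => [|z zs IHzs] nWU; first by exists 0.
have [|w Ww wU] := IHzs; first by move=> y ys; apply: nWU; rewrite inE ys orbT.
have /existsNP[v /not_implyP[Wv vU]] := nWU z (mem_head _ _).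
have bad y : y \in z :: zs -> exists t0, forall t, U y (v + t *: w) -> t = t0.
  move=> yzs; have wvU : ~ U y w \/ ~ U y v.
    by move: yzs; rewrite inE => /orP[/eqP->|/wU]; [right|left].
  have [[t0 t0U]|none] := pselect (exists t0, U y (v + t0 *: w)); last first.
    by exists 0 => t tU; case: none; exists t.
  exists t0 => t tU; apply/eqP/negPn/negP => neq_t.
  have tt0 : t - t0 != 0 by rewrite subr_eq0.
  have U0 : U y 0 by rewrite -(subrr (v + t *: w)) -scaleN1r; exact: UL.
  have Uw : U y w.
    have := UL y (t - t0)^-1 _ _ U0 (UL y (-1) _ _ tU t0U).
    rewrite scaleN1r opprD addrACA subrr !add0r -scalerBl scalerA.
    by rewrite mulVf // scale1r.
  case: wvU => //; apply.
  have := UL y (- t0) _ _ t0U Uw.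
  by rewrite scaleNr addrK.
have [t0 t0P] : exists t0 : T -> k, forall y, y \in z :: zs ->
    forall t, U y (v + t *: w) -> t = t0 y.
  have /choice[g gP] : forall y, exists t0, y \in z :: zs ->
      forall t, U y (v + t *: w) -> t = t0.
    move=> y; have [/bad[t1 t1P]|nin] := boolP (y \in z :: zs).
      by exists t1.
    by exists 0.
  by exists g.
have [t tn] := k_inf [seq t0 y | y <- z :: zs].
exists (v + t *: w); first exact: WL.
move=> y yzs /(t0P y yzs) te; move: tn; rewrite te.
by rewrite map_f.
Qed.

Section StandardGradedAlgebras.
Variables (k : fieldType) (R : comAlgType k) (G : nat -> set R).
Hypothesis SG : standard_graded G.

Lemma graded0 i : G i 0.
Proof. by case: SG => _ [/(_ i)[]]. Qed.

Lemma gradedB i x y : G i x -> G i y -> G i (x - y).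
Proof. by case: SG => _ [/(_ i)[_ h] _ _] _ _ _; exact: h. Qed.

Lemma gradedN i x : G i x -> G i (- x).
Proof. by move=> Gx; rewrite -sub0r; apply: gradedB => //; exact: graded0. Qed.

Lemma gradedD i x y : G i x -> G i y -> G i (x + y).
Proof. by move=> Gx Gy; rewrite -[y]opprK; apply/gradedB/gradedN. Qed.

Lemma graded_sum i (T : Type) (s : seq T) (P : pred T) (f : T -> R) :
  (forall j, P j -> G i (f j)) -> G i (\sum_(j <- s | P j) f j).
Proof. by move=> Gf; apply: big_ind => //; [exact: graded0|exact: gradedD]. Qed.

Lemma gradedM i j x y : G i x -> G j y -> G (i + j) (x * y).
Proof. by case: SG => _ _ + _ _; apply. Qed.

Lemma graded0P x : G 0 x <-> exists c : k, x = c%:A.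
Proof.
by case: SG => _ _ _ -> _; split=> [[c _ <-]|[c ->]]; exists c.
Qed.

Lemma graded1 : G 0 1.
Proof. by apply/graded0P; exists 1; rewrite scale1r. Qed.

Lemma gradedZ i c x : G i x -> G i (c *: x).
Proof.
move=> Gx; rewrite -mulr_algl -[i]add0n; apply: gradedM => //.
by apply/graded0P; exists c.
Qed.

Lemma gradedX i n x : G i x -> G (i * n) (x ^+ n).
Proof.
move=> Gx; elim: n => [|n IHn]; first by rewrite muln0; exact: graded1.
by rewrite exprS mulnS; exact: gradedM.
Qed.

Lemma component_poly_unique (p q : {poly R}) : (forall i, G i p`_i) ->
  (forall i, G i q`_i) -> p.[1] = q.[1] -> p = q.
Proof.
move=> Gp Gq pq; apply/eqP; rewrite -subr_eq0; apply/eqP.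
have Gpq i : G i (p - q)`_i by rewrite coefB; exact: gradedB.
have : (p - q).[1] = 0 by rewrite !hornerE pq subrr.
move: (p - q) Gpq => r Gr r1; apply/polyP => i; rewrite coef0.
have [le_ri|lt_ir] := leqP (size r) i; first by rewrite nth_default.
case: SG => _ [_ _ /(_ (iota 0 (size r)) (fun i => r`_i))] h _ _ _.
apply: h => //; [exact: iota_uniq| |by rewrite mem_iota].
rewrite -[RHS]r1 horner_coef -(big_mkord xpredT (fun i => r`_i * 1 ^+ i)).
rewrite /index_iota subn0.
by apply: eq_bigr => j _; rewrite expr1n mulr1.
Qed.

Lemma component_poly_exists r :
  exists p : {poly R}, (forall i, G i p`_i) /\ p.[1] = r.
Proof.
case: (SG) => _ [_ /(_ r)[s [f [us Gf ->]]] _] _ _ _.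
exists (\sum_(i <- s) f i *: 'X^i); split=> [j|].
  rewrite coef_sum; apply: graded_sum => i _; rewrite coefZ coefXn.
  by have [->|_] := eqVneq; rewrite ?mulr1 ?mulr0 //; exact: graded0.
rewrite horner_sum; apply: eq_bigr => i _.
by rewrite hornerZ hornerXn expr1n mulr1.
Qed.

(** Homogeneous components, collected in a polynomial: multiplicativity of the
    grading becomes the product rule for coefficients. *)
Definition component_poly r : {poly R} := sval (cid (component_poly_exists r)).

Lemma component_polyG r i : G i (component_poly r)`_i.
Proof. by rewrite /component_poly; case: cid => p []. Qed.

Lemma component_poly_at1 r : (component_poly r).[1] = r.
Proof. by rewrite /component_poly; case: cid => p []. Qed.

Lemma component_polyP r (p : {poly R}) : (forall i, G i p`_i) -> p.[1] = r ->
  component_poly r = p.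
Proof.
move=> Gp p1; apply: component_poly_unique => //.
  exact: component_polyG.
by rewrite component_poly_at1.
Qed.

Lemma component_poly_zmod_morphism : zmod_morphism component_poly.
Proof.
move=> r s; apply: component_polyP => [i|].
  by rewrite coefB; apply: gradedB; exact: component_polyG.
by rewrite !hornerE !component_poly_at1.
Qed.

Lemma component_poly_monoid_morphism : monoid_morphism component_poly.
Proof.
split=> [|r s].
  apply: component_polyP => [i|]; last by rewrite hornerE.
  by rewrite coef1; case: i => [|i]; [exact: graded1|exact: graded0].
apply: component_polyP => [i|]; last by rewrite hornerM !component_poly_at1.
rewrite coefM; apply: graded_sum => j _.
by rewrite -{1}(subnKC (leq_ord j)); apply: gradedM; exact: component_polyG.
Qed.

HB.instance Definition _ :=
  GRing.isZmodMorphism.Build R {poly R} component_poly component_poly_zmod_morphism.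
HB.instance Definition _ :=
  GRing.isMonoidMorphism.Build R {poly R} component_poly
    component_poly_monoid_morphism.

Definition component i r := (component_poly r)`_i.

Lemma componentG i r : G i (component i r).
Proof. exact: component_polyG. Qed.

Lemma componentB i : {morph component i : r s / r - s}.
Proof. by move=> r s; rewrite /component rmorphB coefB. Qed.

Lemma componentD i : {morph component i : r s / r + s}.
Proof. by move=> r s; rewrite /component rmorphD coefD. Qed.

Lemma component0 i : component i 0 = 0.
Proof. by rewrite /component rmorph0 coef0. Qed.

Lemma component_sum i (T : Type) (s : seq T) (P : pred T) (f : T -> R) :
  component i (\sum_(j <- s | P j) f j) = \sum_(j <- s | P j) component i (f j).
Proof. by apply: big_morph; [exact: componentD|exact: component0]. Qed.

Lemma component_poly_homog i r : G i r -> component_poly r = r *: 'X^i.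
Proof.
move=> Gr; apply: component_polyP => [j|].
  rewrite coefZ coefXn; have [->|_] := eqVneq; rewrite ?mulr1 ?mulr0 //.
  exact: graded0.
by rewrite hornerZ hornerXn expr1n mulr1.
Qed.

Lemma component_homog i j r : G i r -> component j r = if j == i then r else 0.
Proof.
move=> Gr; rewrite /component (component_poly_homog Gr) coefZ coefXn.
by case: eqP; rewrite ?mulr1 ?mulr0.
Qed.

Lemma component_mull i j a r : G i a ->
  component j (a * r) = if (i <= j)%N then a * component (j - i) r else 0.
Proof.
move=> Ga; rewrite /component rmorphM /= (component_poly_homog Ga).
by rewrite -scalerAl coefZ coefXnM; case: leqP; rewrite ?mulr0.
Qed.

Lemma componentZ i c r : component i (c *: r) = c *: component i r.
Proof.
rewrite -mulr_algl (@component_mull 0); last by apply/graded0P; exists c.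
by rewrite subn0 mulr_algl.
Qed.

Lemma sum_components r : exists n, forall m, (n <= m)%N ->
  r = \sum_(i < m) component i r.
Proof.
exists (size (component_poly r)) => m le_nm.
rewrite -{1}(component_poly_at1 r) (horner_coef_wide _ le_nm).
by apply: eq_bigr => i _; rewrite expr1n mulr1.
Qed.

Lemma component_large r : exists n, forall m, (n <= m)%N -> component m r = 0.
Proof.
by exists (size (component_poly r)) => m le_nm; rewrite /component nth_default.
Qed.

(** The subring generated by [R_1] over [R_0] is graded with pieces spanned by
    products of linear forms, so these exhaust the pieces of [R]. *)
Lemma graded_succ i : G i.+1 = ideal_mul (G 1) (G i).
Proof.
pose T n := iter n (ideal_mul (G 1)) (G 0).
have T0 n : T n 0.
  by case: n => [|n]; [exact: graded0|exists [::]; rewrite big_nil].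
have TD n x y : T n x -> T n y -> T n (x + y).
  case: n => [|n]; first exact: gradedD.
  move=> [s [sT ->]] [t [tT ->]]; exists (s ++ t); rewrite big_cat; split=> // p.
  by rewrite mem_cat => /orP[/sT|/tT].
have TZ n c x : T n x -> T n (c *: x).
  case: n => [|n]; first exact: gradedZ.
  move=> [s [sT ->]]; exists [seq (c *: p.1, p.2) | p <- s]; split; last first.
    by rewrite big_map scaler_sumr; apply: eq_bigr => p _; rewrite scalerAl.
  by move=> _ /mapP[p /sT[Gp Tp] ->]; split=> //; exact: gradedZ.
have TM m n x y : T m x -> T n y -> T (m + n)%N (x * y).
  elim: m x => [|m IHm] x.
    by move=> /graded0P[c ->] Ty; rewrite mulr_algl; exact: TZ.
  move=> [s [sT ->]] Ty; exists [seq (p.1, p.2 * y) | p <- s]; split; last first.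
    by rewrite big_map mulr_suml; apply: eq_bigr => p _; rewrite mulrA.
  by move=> _ /mapP[p /sT[Gp Tp] ->] /=; split=> //; exact: IHm.
have TN n x : T n x -> T n (- x).
  move=> Tx; rewrite -mulN1r; apply: (TM 0%N) => //.
  by apply/gradedN/graded1.
have TG n x : T n x -> G n x.
  elim: n x => [|n IHn] x //= [s [sT ->]].
  rewrite big_seq; apply: graded_sum => p /sT[Gp /IHn].
  exact: (gradedM Gp).
pose S := [set r | forall n, T n (component n r)].
have ST : S = [set: R].
  case: SG => _ _ _ _; apply.
  - split.
    + move=> n; rewrite (component_homog _ graded1).
      by case: n => [|n]; [exact: graded1|exact: T0].
    + by move=> x y xS yS n; rewrite componentB; apply: TD => //; exact: TN.
    + move=> x y xS yS n; rewrite /component rmorphM /= coefM.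
      elim/big_ind: _ => [||j _]; [exact: T0|exact: TD|].
      by rewrite -{1}(subnKC (leq_ord j)); apply: TM; [exact: xS|exact: yS].
  - move=> x Gx n; rewrite (component_homog _ Gx).
    by case: n => [|n]; [|exact: T0].
  - move=> x Gx n; rewrite (component_homog _ Gx).
    case: n => [|[|n]]; [exact: T0| |exact: T0].
    exists [:: (x, 1)]; rewrite big_seq1 mulr1; split=> // p.
    by rewrite inE => /eqP->; split=> //; exact: graded1.
have GT n x : G n x -> T n x.
  move=> Gx; have : S x by rewrite ST.
  by move=> /(_ n); rewrite (component_homog _ Gx) eqxx.
apply/seteqP; split=> x.
  move=> /GT[s [sT xE]]; exists s; split=> // p /sT[Gp /TG Gp2].
  by split.
move=> [s [sT ->]]; rewrite big_seq; apply: graded_sum => p /sT[Gp1 Gp2].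
exact: (gradedM Gp1 Gp2).
Qed.

Lemma graded_add i j : G (i + j)%N `<=` ideal_mul (G i) (G j).
Proof.
elim: i => [|i IHi] x.
  move=> Gx; exists [:: (1, x)]; rewrite big_seq1 mul1r; split=> // p.
  by rewrite inE => /eqP->; split=> //; exact: graded1.
rewrite addSn graded_succ => -[s [+ ->]].
elim: s => [|p s IHs] sG; first by exists [::]; rewrite !big_nil.
have [t [tG tE]] := IHs (fun q qs => sG q (@mem_behead _ (p :: s) q qs)).
have [Gp1 /IHi[u [uG uE]]] := sG p (mem_head _ _).
exists ([seq (p.1 * q.1, q.2) | q <- u] ++ t); split.
  move=> q; rewrite mem_cat => /orP[/mapP[q' /uG[Gq1 Gq2] ->]|/tG//].
  by split=> //=; rewrite -add1n; exact: gradedM.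
rewrite big_cons big_cat big_map tE uE mulr_sumr; congr (_ + _).
by apply: eq_bigr => q _; rewrite mulrA.
Qed.

Local Notation m := (irrelevant_ideal G).

Lemma irrelevantP r : m r <-> component 0 r = 0.
Proof.
split=> [[n [f [Gf ->]]]|r0].
  rewrite component_sum big1 // => i _.
  by rewrite (component_homog _ (Gf i)).
have [n nr] := sum_components r.
exists n, (fun i => component i.+1 r); split=> [i|]; first exact: componentG.
by rewrite {1}(nr n.+1 (leqnSn n)) big_ord_recl r0 add0r.
Qed.

Lemma irrelevant_homog i r : G i.+1 r -> m r.
Proof. by move=> Gr; apply/irrelevantP; rewrite (component_homog _ Gr). Qed.

Lemma irrelevant_prime : prime_ideal m.
Proof.
have c0M x y : component 0 (x * y) = component 0 x * component 0 y.
  by rewrite /component rmorphM /= coef0M.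
split.
- split; first by apply/irrelevantP; rewrite component0.
    move=> x y /irrelevantP x0 /irrelevantP y0; apply/irrelevantP.
    by rewrite componentD x0 y0 addr0.
  by move=> a x /irrelevantP x0; apply/irrelevantP; rewrite c0M x0 mulr0.
- move=> /irrelevantP; rewrite (component_homog _ graded1) eqxx => /eqP.
  by rewrite oner_eq0.
- move=> x y /irrelevantP; rewrite c0M.
  have /graded0P[c cE] := componentG 0 x; have /graded0P[d dE] := componentG 0 y.
  rewrite cE dE mulr_algl => /eqP; rewrite !scaler_eq0 oner_eq0 orbF.
  by move=> /orP[]/eqP e; [left|right]; apply/irrelevantP;
    rewrite ?cE ?dE e scale0r.
Qed.

End StandardGradedAlgebras.

(** * A linear parameter and dehomogenization *)

Section PrincipalQuotientProjection.
Variables (k : fieldType) (A : comAlgType k) (f : A).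
Variable hf : ~ principal_ideal f 1.

Lemma principal_proj_eq0 p : principal_proj hf p = 0 <-> principal_ideal f p.
Proof.
rewrite /principal_proj -[0]/(0 : {ideal_quot (principal_pred hf)}).
rewrite -(rmorph0 (\pi_{ideal_quot (principal_pred hf)}%qT)).
split=> [/eqP|fp].
  rewrite -[_ == _]/(_ == _ %[mod {ideal_quot (principal_pred hf)}])%qT.
  by rewrite -Quotient.idealrBE subr0 => /asboolP.
apply/eqP; rewrite -[_ == _]/(_ == _ %[mod {ideal_quot (principal_pred hf)}])%qT.
by rewrite -Quotient.idealrBE subr0; apply/asboolP.
Qed.

Lemma principal_proj_surj (a : principal_quot hf) :
  exists p, principal_proj hf p = a.
Proof. by exists (repr a); rewrite /principal_proj; exact: reprK. Qed.

Lemma principal_proj_zmod_morphism : zmod_morphism (principal_proj hf).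
Proof.
move=> p q; apply: (addIr (principal_proj hf q)).
by rewrite -principal_projD !subrK.
Qed.

Lemma principal_proj_monoid_morphism : monoid_morphism (principal_proj hf).
Proof. by split; [exact: principal_proj1|exact: principal_projM]. Qed.

Lemma principal_proj_scalable : scalable (principal_proj hf).
Proof. by move=> c p; rewrite -mulr_algl principal_projM. Qed.

HB.instance Definition _ := GRing.isZmodMorphism.Build A (principal_quot hf)
  (principal_proj hf) principal_proj_zmod_morphism.
HB.instance Definition _ := GRing.isMonoidMorphism.Build A (principal_quot hf)
  (principal_proj hf) principal_proj_monoid_morphism.
HB.instance Definition _ := GRing.isScalable.Build k A (principal_quot hf) *:%R
  (principal_proj hf) principal_proj_scalable.

End PrincipalQuotientProjection.

Lemma krull_dim_unique (R : comNzRingType) d e :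
  krull_dim R d -> krull_dim R e -> d = e.
Proof.
have chain_le m n : (m <= n)%N -> prime_chain R n -> prime_chain R m.
  move=> le_mn [P [Pp Pm]]; exists P; split=> i le_im.
    by apply: Pp; exact: leq_trans le_im le_mn.
  by apply: Pm; exact: leq_trans le_im le_mn.
move=> [cd ncd] [ce nce]; apply/eqP; rewrite eqn_leq; apply/andP; split.
  by rewrite leqNgt; apply/negP => /chain_le/(_ cd).
by rewrite leqNgt; apply/negP => /chain_le/(_ ce).
Qed.

Section LinearParameter.
Variables (k : fieldType) (R : comAlgType k) (G : nat -> set R).
Hypothesis SG : standard_graded G.
Local Notation m := (irrelevant_ideal G).

Lemma irrelevant_killed z : (forall r, G 1 r -> r * z = 0) ->
  forall r, m r -> r * z = 0.
Proof.
move=> G1z r /(irrelevantP SG) r0; have [n nr] := sum_components SG r.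
rewrite (nr n.+1 (leqnSn n)) big_ord_recl r0 add0r mulr_suml big1 // => i _.
have := componentG SG (bump 0 i) r; rewrite (graded_succ SG) => -[s [sG ->]].
rewrite mulr_suml big_seq big1 // => p /sG[Gp _].
by rewrite mulrAC G1z // mul0r.
Qed.

(** If every linear form were a zero divisor, the space [R_1] would be covered
    by finitely many annihilators, so one nonzero [z] would be killed by [R_1],
    hence by the whole irrelevant ideal, which contains a nonzerodivisor. *)
Lemma linear_nonzerodivisor (k_inf : forall s : seq k, exists t, t \notin s) :
  depth m R^o 1 -> exists2 x, G 1 x & forall v, x * v = 0 -> v = 0.
Proof.
move=> [[[|x0 [|x1 xs]] [//= _ xm [xreg _]]] _].
have x0reg v : x0 * v = 0 -> v = 0.
  move=> xv; have [//|w ->] := xreg 0%N isT v; last by rewrite big_ord0.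
  by exists (fun=> 0); rewrite big_ord0.
have mx0 : m x0 by apply: xm; rewrite mem_head.
have [zs [zs0 zsP]] : exists zs : seq R, (forall z, z \in zs -> z != 0) /\
  (forall r v, v != 0 -> r * v = 0 -> exists2 z, z \in zs & r * z = 0).
  by apply: finite_zero_divisors; case: SG.
have [||||x Gx xz] := @subspaces_avoid k k_inf R R (G 1) (@annihilator R) zs.
- by move=> c x y Gx Gy; apply: (gradedD SG) => //; exact: gradedZ.
- exact: graded0.
- move=> z c x y; rewrite /annihilator /= => xz yz.
  by rewrite mulrDl xz -scalerAl yz scaler0 addr0.
- move=> z zzs G1z; have /eqP[] := zs0 z zzs; apply: x0reg.
  exact: (irrelevant_killed G1z).
- exists x => // v xv; apply/eqP/negPn/negP => v0.
  by have [z zzs] := zsP _ _ v0 xv; exact: xz.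
Qed.

Variable x : R.
Hypotheses (Gx : G 1 x) (x_reg : forall v, x * v = 0 -> v = 0).

Lemma linear_regX n v : x ^+ n * v = 0 -> v = 0.
Proof.
by elim: n => [|n IHn]; rewrite ?mul1r // exprS -mulrA => /x_reg/IHn.
Qed.

(** If no power of the irrelevant ideal [m] lay in [(x)], an ideal maximal
    among those between [(x)] and [m] with this property (localized at [m])
    would be a prime [P] strictly inside [m]; as [x] is a nonzerodivisor, [P]
    strictly contains a prime avoiding [x], and the dimension would exceed
    one. *)
Lemma graded_piece_sub_parameter : krull_dim R 1 ->
  exists N, forall r, G N r -> exists s, r = x * s.
Proof.
move=> [_ nochain]; apply: contrapT => /forallNP noN; apply: nochain.
have noeth : noetherian R by case: SG.
have [mid m1 mprime] := irrelevant_prime SG.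
have nmM s t : ~ m s -> ~ m t -> ~ m (s * t) by move=> ms mt /mprime[].
pose F := [set I : set R | is_ideal I /\
  forall n, exists2 r, G n r & forall s, ~ m s -> ~ I (s * r)].
pose I0 := [set x * s | s in [set: R]].
have FI0 : F I0.
  split.
    split; first by exists 0; rewrite ?mulr0.
      by move=> _ _ [s _ <-] [t _ <-]; exists (s + t); rewrite ?mulrDr.
    by move=> a _ [s _ <-]; exists (a * s); rewrite // mulrCA.
  move=> n; have /existsNP[r /not_implyP[Gr rx]] := noN n.
  exists r => // s ms [t _ e]; apply: rx.
  have /(graded0P SG)[c cE] := componentG SG 0 s.
  have c0 : c != 0.
    apply/eqP => c0; apply: ms; apply/(irrelevantP SG).
    by rewrite cE c0 scale0r.
  have := congr1 (component SG n) e.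
  rewrite [s * r]mulrC (component_mull _ _ _ Gr) leqnn subnn cE.
  rewrite (component_mull _ _ _ Gx); set t' := (X in X = _) => t'E.
  have [t'' t''E] : exists t'', t' = x * t''.
    by rewrite /t'; case: ifP; [eexists; reflexivity|exists 0; rewrite mulr0].
  exists (c^-1 *: t''); rewrite -scalerAr -t''E t'E mulrC mulr_algl scalerA.
  by rewrite mulVf // scale1r.
have [||||P [Pprime xP [Pid PF]]] := @prime_of_maximal R noeth F I0 => //.
- by move=> I [].
- move=> I [Iid IF] I1; have [r _ rI] := IF 0%N; apply: (rI 1) => //.
  by case: Iid => _ _ IM; rewrite mul1r -[r]mulr1; exact: IM.
- move=> I a b [Iid IF] Iab; apply: contrapT => /not_orP[nFa nFb].
  have drops c : ~ F (principal_sum I c) -> exists n, forall r, G n r ->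
      exists2 s, ~ m s & principal_sum I c (s * r).
    move=> nF; apply: contrapT => /forallNP no; apply: nF.
    split; first exact: principal_sum_ideal.
    move=> n; have /existsNP[r /not_implyP[Gr rI]] := no n.
    by exists r => // s ms sr; apply: rI; exists s.
  have [i iP] := drops a nFa; have [j jP] := drops b nFb.
  have [r Gr rI] := IF (i + j)%N.
  suff [s ms sr] : exists2 s, ~ m s & I (s * r) by exact: rI sr.
  have [t [+ ->]] := graded_add SG Gr.
  case: (Iid) => I0' ID IM.
  elim: t => [|p t IHt] tG; first by exists 1; rewrite // big_nil mulr0.
  have [s ms st] := IHt (fun q qt => tG q (@mem_behead _ (p :: t) q qt)).
  have [/iP[s1 ms1 [u1 [c1 [Iu1 e1]]]] /jP[s2 ms2 [u2 [c2 [Iu2 e2]]]]] :=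
    tG p (mem_head _ _).
  exists (s * (s1 * s2)); first by apply: (nmM) => //; exact: nmM.
  rewrite big_cons mulrDr; apply: (ID); last by rewrite mulrAC mulrC; exact: IM.
  have -> : s * (s1 * s2) * (p.1 * p.2) = s * ((s1 * p.1) * (s2 * p.2)) by ring.
  apply: (IM); rewrite e1 e2.
  have -> : (u1 + c1 * a) * (u2 + c2 * b) =
            (u2 + c2 * b) * u1 + (c1 * a * u2 + c1 * c2 * (a * b)) by ring.
  by apply: (ID); [exact: IM|apply: (ID); exact: IM].
have Pm : P `<=` m.
  move=> u Pu; apply: contrapT => mu; have [r _ /(_ u mu)[]] := PF 0%N.
  by case: Pid => _ _ PM; rewrite mulrC; exact: PM.
have [y Gy yP] : exists2 y, G 1 y & ~ P y.
  by have [r Gr /(_ 1 m1)] := PF 1%N; rewrite mul1r; exists r.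
pose S := [set y : R | exists n s, ~ P s /\ y = x ^+ n * s].
have [_ P1 Pp] := Pprime; have P0 : P 0 by case: Pid.
have [||||Q [Qprime _ QS]] := @prime_avoiding R noeth [set 0] S.
- split=> //; first by move=> ? ? -> ->; rewrite addr0.
  by move=> a ? ->; rewrite mulr0.
- by exists 0%N, 1; rewrite mulr1.
- move=> _ _ [n [s [Ps ->]]] [n' [t [Pt ->]]]; exists (n + n')%N, (s * t).
  by split; [move=> /Pp[]|rewrite exprD mulrACA].
- by move=> _ -> [n [s [Ps /esym/linear_regX s0]]]; apply: Ps; rewrite s0.
exists (fun i => if i is i'.+1 then if i' is _.+1 then m else P else Q).
split=> [[|[|[|i]]]|[|[|i]]] // _.
- split.
    move=> u Qu; apply: contrapT => Pu; apply: QS Qu _.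
    by exists 0%N, u; rewrite mul1r.
  move=> /(_ x) QP; have Qx : Q x by apply: QP; apply: xP; exists 1; rewrite ?mulr1.
  by apply: QS Qx _; exists 1%N, 1; rewrite mulr1.
- split=> // /(_ y) mP; apply: yP; apply: mP.
  exact: irrelevant_homog SG 0%N _ Gy.
Qed.

Lemma graded_stabilizes : krull_dim R 1 ->
  exists N, forall n r, (N <= n)%N -> G n.+1 r -> exists2 s, G n s & r = x * s.
Proof.
move=> /graded_piece_sub_parameter[N NP]; exists N => n r le_Nn Gr.
have [t rt] : exists t, r = x * t.
  have := Gr; rewrite -(subnKC (leqW le_Nn)) => /(graded_add SG)[s [+ ->]].
  elim: s => [|p s IHs] sG; first by exists 0; rewrite big_nil mulr0.
  have [t tE] := IHs (fun q qs => sG q (@mem_behead _ (p :: s) q qs)).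
  have [/NP[u uE] _] := sG p (mem_head _ _).
  by exists (u * p.2 + t); rewrite big_cons tE uE mulrDr mulrA.
exists (component SG n t); first exact: componentG.
have := congr1 (component SG n.+1) rt.
by rewrite (component_homog _ _ Gr) eqxx (component_mull _ _ _ Gx) subn1.
Qed.

(** A nonzero multiple of [x - 1] has components in at least two degrees, since
    [x] is a nonzerodivisor. *)
Lemma principal_dehomogenization i r : principal_ideal (x - 1) r -> G i r -> r = 0.
Proof.
move=> [q _ rE] Gr; have rj j : (if j == i then r else 0) =
    (if (0 < j)%N then x * component SG j.-1 q else 0) - component SG j q.
  rewrite -(component_homog SG _ Gr) -rE mulrBr mulr1 componentB mulrC.
  by rewrite (component_mull _ _ _ Gx) subn1.
have q_lt j : (j < i)%N -> component SG j q = 0.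
  elim: j => [|j IHj] lt_ji; have := rj (_ : nat); last first.
    move=> /(_ j.+1); rewrite (ltn_eqF lt_ji) /= IHj ?(ltnW lt_ji) // mulr0.
    by move/esym/eqP; rewrite sub0r oppr_eq0 => /eqP.
  move=> /(_ 0%N); rewrite (ltn_eqF lt_ji) /=.
  by move/esym/eqP; rewrite sub0r oppr_eq0 => /eqP.
have q_ge d : component SG (i + d) q = x ^+ d * component SG i q.
  elim: d => [|d IHd]; first by rewrite addn0 mul1r.
  have := rj (i + d.+1)%N.
  rewrite gtn_eqF ?addnS ?ltnS ?leq_addr //= IHd mulrA -exprS.
  by move/esym/subr0_eq.
have [n nq] := component_large SG q.
have qi : component SG i q = 0.
  apply: (@linear_regX n); rewrite -q_ge; apply: nq; exact: leq_addl.
have := rj i; rewrite eqxx qi subr0 => ->; case: ifP => // i_gt0.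
by rewrite q_lt ?mulr0 // prednK.
Qed.

(** Setting [x = 1] embeds each graded piece in [A = R/(x - 1)], from some degree
    on with image [A], so [R] is recovered from the filtration of [A] by the
    images of the pieces. *)
Lemma dehomogenization : krull_dim R 1 ->
  exists (A : comAlgType k) (pi : {lrmorphism R -> A}) (N : nat),
  [/\ pi x = 1, forall i r, G i r -> pi r = 0 -> r = 0
    & forall n a, (N <= n)%N -> exists2 r, G n r & pi r = a].
Proof.
move=> /graded_stabilizes[N NP].
have hf : ~ principal_ideal (x - 1) 1.
  move=> h; have /eqP := principal_dehomogenization h (graded1 SG).
  by rewrite oner_eq0.
exists (principal_quot hf), (principal_proj hf), N.
have pix : principal_proj hf x = 1.
  apply/eqP; rewrite -subr_eq0 -(rmorph1 (principal_proj hf)) -rmorphB.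
  by apply/eqP/principal_proj_eq0; exists 1; rewrite ?mul1r.
split=> // [i r Gr /principal_proj_eq0 h|n a le_Nn].
  exact: principal_dehomogenization h Gr.
have [r <-] := principal_proj_surj a.
have [M MN MP] : exists2 M, (n <= M)%N &
    exists2 s, G M s & principal_proj hf s = principal_proj hf r.
  have [m0 m0r] := sum_components SG r; pose M := maxn n m0.
  exists M; first exact: leq_maxl.
  exists (\sum_(i < M) x ^+ (M - i) * component SG i r).
    apply: (graded_sum SG) => i _; rewrite -{1}(subnK (ltnW (ltn_ord i))).
    apply: (gradedM SG); last exact: componentG.
    by rewrite -[X in G X]mul1n; exact: gradedX.
  rewrite [in RHS](m0r M (leq_maxr _ _)) !rmorph_sum; apply: eq_bigr => i _.
  by rewrite rmorphM rmorphXn /= pix expr1n mul1r.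
rewrite -(subnK MN) in MP; elim: (M - n)%N MP => [//|d IHd] [s Gs sr].
have [t Gt st] := NP _ s (leq_trans le_Nn (leq_addl d n)) Gs.
by apply: IHd; exists t => //; rewrite -sr st rmorphM /= pix mul1r.
Qed.

End LinearParameter.

(** * Finiteness, depth and isomorphisms of modules *)

Section FinitelyGenerated.
Variables (R : comNzRingType) (M : lmodType R).

Fixpoint in_span (s : seq M) (v : M) : Prop :=
  if s is g :: s' then exists c, in_span s' (v - c *: g) else v = 0.

Lemma in_spanP s v : in_span s v ->
  exists c : 'I_(size s) -> R, v = \sum_(i < size s) c i *: s`_i.
Proof.
elim: s v => [v ->|g s IHs v [c /IHs[d dE]]] /=.
  by exists (fun=> 0); rewrite big_ord0.
exists (fun i => if unlift ord0 i is Some j then d j else c).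
rewrite big_ord_recl unlift_none /=.
under eq_bigr do rewrite liftK /=.
by rewrite -[X in _ + X]dE addrC subrK.
Qed.

(** Induction on the number [m] of coordinates that may be nonzero: the last of
    them takes its values in a finitely generated ideal, and lifts of the
    generators reduce to [m - 1]. *)
Lemma sub_row_vectors_fg n (phi : {linear M -> 'rV[R]_n}) :
  noetherian R -> injective phi -> finitely_generated M.
Proof.
move=> noeth phi_inj.
suff H : forall m (S : set M), S 0 ->
    (forall u v, S u -> S v -> S (u + v)) -> (forall a u, S u -> S (a *: u)) ->
    (forall v c, S v -> (m <= nat_of_ord c)%N -> phi v 0 c = 0) ->
    exists s, forall v, S v -> in_span s v.
  have [||||s sP] := H n [set: M] => //.
    by move=> v c _; rewrite leqNgt ltn_ord.
  by exists s => v; apply: in_spanP; exact: sP.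
elim=> [|m IHm] S S0 SD SZ Sm.
  exists [::] => v Sv /=; apply: phi_inj; rewrite linear0.
  by apply/rowP => c; rewrite mxE Sm.
have [le_nm|lt_mn] := leqP n m.
  by apply: IHm => // v c _; rewrite leqNgt (leq_trans (ltn_ord c) le_nm).
pose c0 := Ordinal lt_mn.
pose I := [set phi v 0 c0 | v in S].
have Iid : is_ideal I.
  split; first by exists 0 => //; rewrite linear0 mxE.
    by move=> _ _ [u Su <-] [v Sv <-]; exists (u + v); [exact: SD|];
      rewrite linearD mxE.
  by move=> a _ [u Su <-]; exists (a *: u); [exact: SZ|]; rewrite linearZ mxE.
have [t It] := noeth I Iid.
have [||||s' s'P] := IHm [set v | S v /\ phi v 0 c0 = 0].
- by split=> //; rewrite linear0 mxE.
- move=> u v [Su u0] [Sv v0]; split; first exact: SD.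
  by rewrite linearD mxE u0 v0 addr0.
- move=> a u [Su u0]; split; first exact: SZ.
  by rewrite linearZ mxE u0 mulr0.
- move=> v c [Sv v0]; rewrite leq_eqVlt => /orP[/eqP mc|]; last exact: Sm.
  by have <- : c0 = c by exact/val_inj.
have lifts a : a \in t -> I a by move=> ta; rewrite It; exact: mem_seq_span.
have [s sP] : exists s, forall v, S v ->
    @seq_span R R^o t (phi v 0 c0) -> in_span s v.
  elim: t lifts {It} => [|a t IHt] lifts.
    exists s' => v Sv [w vw]; apply: s'P; split=> //.
    by rewrite vw big_ord0.
  have [s sP] := IHt (fun b tb => lifts b (@mem_behead _ (a :: t) b tb)).
  have [g Sg ga] := lifts a (mem_head _ _).
  exists (g :: s) => v Sv [w]; rewrite big_ord_recl /= => vw.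
  exists (w ord0); apply: sP; first by rewrite -scaleNr; apply: SD => //; exact: SZ.
  exists (fun i => w (lift ord0 i)).
  rewrite linearB linearZ /= !mxE ga vw [w _ * a]mulrC /GRing.scale /=.
  by rewrite addrAC subrr add0r.
by exists s => v Sv; apply: sP => //; rewrite -It; exists v.
Qed.

End FinitelyGenerated.

Section DepthOne.
Variables (R : comNzRingType) (M : lmodType R) (m : set R) (x : R).

Lemma seq_span0 v : seq_span (M := M) [::] v <-> v = 0.
Proof.
split=> [[w ->]|->]; first by rewrite big_ord0.
by exists (fun=> 0); rewrite big_ord0.
Qed.

Lemma seq_span1 a v : seq_span (M := M) [:: a] v <-> exists w, v = a *: w.
Proof.
split=> [[w ->]|[w ->]]; first by exists (w ord0); rewrite big_ord1.
by exists (fun=> w); rewrite big_ord1.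
Qed.

(** A socle element [z] of [M / x M] yields one of [M / y M] for every other
    [M]-regular [y] in [m]: it is the [w] with [y z = x w]. So no regular
    sequence in [m] has length two. *)
Lemma depth_one (z : M) : m x -> (forall v : M, x *: v = 0 -> v = 0) ->
  ~ (exists w, z = x *: w) -> (forall r, m r -> exists w, r *: z = x *: w) ->
  depth m M 1.
Proof.
move=> mx xreg zx mz.
have x_inj (u v : M) : x *: u = x *: v -> u = v.
  move=> /eqP; rewrite -subr_eq0 -scalerBr => /eqP/xreg/eqP.
  by rewrite subr_eq0 => /eqP.
split.
  exists [:: x]; split=> //; first by move=> y; rewrite inE => /eqP->.
  split.
    by case=> // _ v /seq_span0/xreg ->; apply/seq_span0.
  by move=> e; have : [set: M] z by []; rewrite -e => /seq_span1/zx.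
case=> [|y [|y2 ys]] // ym [yreg _]; exfalso.
have y_reg (v : M) : y *: v = 0 -> v = 0.
  by move=> /seq_span0 /(yreg 0%N isT v) /seq_span0.
have y2_reg (v w : M) : y2 *: v = y *: w -> exists w', v = y *: w'.
  move=> e; apply/seq_span1; apply: (yreg 1%N isT v).
  by apply/seq_span1; exists w.
have [w yz] := mz y (ym _ (mem_head _ _)).
have [|u2 y2z] := mz y2; first by apply: ym; rewrite !inE eqxx orbT.
have [|w' ww'] := y2_reg w u2.
  have swap a b (v : M) : a *: (b *: v) = b *: (a *: v).
    by rewrite !scalerA mulrC.
  by apply: x_inj; rewrite swap -yz swap y2z swap.
apply: zx; exists w'; apply/eqP; rewrite -subr_eq0; apply/eqP/y_reg.
by rewrite scalerBr yz ww' !scalerA [y * x]mulrC subrr.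
Qed.

End DepthOne.

Section GradedModuleIsomorphisms.
Variables (k : fieldType) (R : comAlgType k) (G : nat -> set R).
Implicit Types M N P : gradedModule G.

Lemma iso_shift_sym M N : isomorphic_up_to_shift M N -> isomorphic_up_to_shift N M.
Proof.
move=> [s [phi [[psi phiK psiK] phiP]]].
have psi_lin : linear psi.
  by move=> a u v; apply: (can_inj phiK); rewrite psiK linearP !psiK.
pose psiL : {linear N -> M} :=
  HB.pack psi (GRing.isLinear.Build R N M *:%R psi psi_lin).
exists (- s), psiL; split; first by exists phi.
move=> i v; split=> [Nv|/phiP].
  by apply/phiP; rewrite subrK /= psiK.
by rewrite subrK /= psiK.
Qed.

Lemma iso_shift_trans M N P : isomorphic_up_to_shift M N ->
  isomorphic_up_to_shift N P -> isomorphic_up_to_shift M P.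
Proof.
move=> [s [phi [phib phiP]]] [t [psi [psib psiP]]].
exists (s + t), (psi \o phi)%FUN; split; first exact: bij_comp.
by move=> i v; rewrite addrA; split=> [/phiP/psiP|/psiP/phiP].
Qed.

End GradedModuleIsomorphisms.

(** * Moduli of planes in an algebra *)

Section CountableSets.
Variable T : Type.
Implicit Types S : set T.

Lemma sub_countable_set S S' : S `<=` S' -> countable S' -> countable S.
Proof. by move=> /subset_card_le; exact: sub_countable. Qed.

Lemma countable_setU S S' : countable S -> countable S' -> countable (S `|` S').
Proof.
move=> cS cS'; rewrite -bigcup2E; apply: bigcup_countable => //.
by move=> [|[|i]] _ //=; exact: finite_set_countable.
Qed.

Lemma countable_le2 S :
  (forall a b c, S a -> S b -> S c -> [\/ a = b, a = c | b = c]) -> countable S.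
Proof.
move=> S3; have [[a Sa]|noa] := pselect (exists a, S a); last first.
  apply: (@sub_countable_set _ set0) => [a Sa|]; last exact: countable0.
  by case: noa; exists a.
have [[b [Sb ab]]|nob] := pselect (exists b, S b /\ a <> b).
  apply: (@sub_countable_set _ ([set a] `|` [set b])).
    by move=> c Sc; case: (S3 a b c Sa Sb Sc) => // <-; [left|right].
  by apply: countable_setU; exact: countable1.
apply: (@sub_countable_set _ [set a]) => [b Sb|]; last exact: countable1.
by apply: contrapT => ba; apply: nob; exists b; split=> // /esym.
Qed.

End CountableSets.

Section LinesInAnAlgebra.
Variables (k : fieldType) (A : comAlgType k).
Local Notation i := (in_alg A).
Implicit Types a b c d p q u v : A.

Definition span1 a : set A := [set u | exists s t : k, u = i s + i t * a].

Definition span2 c d : set A :=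
  [set u | exists s t r : k, u = i s + i t * c + i r * d].

Definition free1 c d := forall s t r : k,
  i s + i t * c + i r * d = 0 -> [/\ s = 0, t = 0 & r = 0].

Lemma span2D c d u v : span2 c d u -> span2 c d v -> span2 c d (u + v).
Proof.
move=> [s [t [r ->]]] [s' [t' [r' ->]]].
by exists (s + s'), (t + t'), (r + r'); ring.
Qed.

Lemma span2Z c d s u : span2 c d u -> span2 c d (i s * u).
Proof. by move=> [s' [t [r ->]]]; exists (s * s'), (s * t), (s * r); ring. Qed.

Lemma span2B c d u v : span2 c d u -> span2 c d v -> span2 c d (u - v).
Proof.
move=> Su Sv; apply: span2D => //.
have -> : - v = i (-1) * v by rewrite rmorphN rmorph1 mulN1r.
exact: span2Z.
Qed.

Lemma span2_cancel c d s u : s != 0 -> span2 c d (i s * u) -> span2 c d u.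
Proof.
move=> s0 /(span2Z s^-1); have -> // : i s^-1 * (i s * u) = u.
by rewrite mulrA -rmorphM mulVf // rmorph1 mul1r.
Qed.

Lemma in_alg_inj : injective i.
Proof. exact: fmorph_inj. Qed.

(** Some unit [p] of [A] maps the plane [U_a] spanned by [1] and [a] into [U_b];
    as [p] and [p a] lie in [U_b], this makes [a] a Moebius transform of [b]. *)
Definition line_equiv a b := exists p q, p * q = 1 /\
  forall u, span1 a u -> span1 b (u * p).

Definition line_indecomposable a := forall p, p * p = p ->
  (forall u, span1 a u -> span1 a (u * p)) -> p = 0 \/ p = 1.

Definition uncountable_moduli := exists (a : k -> A) (T : set k),
  [/\ countable (~` T), forall t, T t -> line_indecomposable (a t)
    & forall s, T s -> countable [set t | T t /\ line_equiv (a t) (a s)]].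

Lemma span1_1 a : span1 a 1.
Proof. by exists 1, 0; ring. Qed.

Lemma span1_gen a : span1 a a.
Proof. by exists 0, 1; ring. Qed.

Lemma idem_scalar (p : A) (s : k) : p = i s -> p * p = p -> p = 0 \/ p = 1.
Proof.
move=> -> /eqP; rewrite -rmorphM -subr_eq0 -rmorphB fmorph_eq0.
rewrite -{3}[s]mulr1 -mulrBr mulf_eq0 subr_eq0.
by move=> /orP[]/eqP->; [left|right]; rewrite ?rmorph0 ?rmorph1.
Qed.

Variables (c d : A).
Hypotheses (two_neq0 : 2%:R != 0 :> k) (free_cd : free1 c d).
Let a t := c + i t * d.

Lemma line_span2 t u : span1 (a t) u -> span2 c d u.
Proof. by move=> [s [r ->]]; exists s, r, (r * t); rewrite /a; ring. Qed.

(** If [p U_{a_t} = U_{a_s}] then [a_s a_t] lies in the span of [1, c, d]. When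
    this span is not a subring, that condition on [t] is affine and, for all but
    one [s], nontrivial. *)
Lemma moduli_of_nonclosed :
  ~ [/\ span2 c d (c * c), span2 c d (c * d) & span2 c d (d * d)] ->
  uncountable_moduli.
Proof.
move=> nclosed; have closedP s : span2 c d (d * d) ->
    span2 c d (c * d + i s * (d * d)) -> ~ span2 c d (c * c + i s * (c * d)).
  move=> dd cd cc.
  have cd' : span2 c d (c * d).
    have -> : c * d = (c * d + i s * (d * d)) - i s * (d * d) by ring.
    by apply: span2B => //; exact: span2Z.
  apply: nclosed; split=> //.
  have -> : c * c = (c * c + i s * (c * d)) - i s * (c * d) by ring.
  by apply: span2B => //; exact: span2Z.
(* For a bad [s] every [a_s a_t] lies in the span of [1, c, d]. *)
pose bad s := span2 c d (c * d + i s * (d * d)) /\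
              span2 c d (c * c + i s * (c * d)).
pose sq t := span2 c d (a t * a t).
exists a, [set t | ~ sq t /\ ~ bad t]; split.
- apply: (@sub_countable_set _ _ ([set t | sq t] `|` [set t | bad t])).
    move=> t /not_andP[/contrapT|/contrapT]; by [left|right].
  apply: countable_setU; apply: countable_le2 => t1 t2 t3 S1 S2 S3.
    have [|n12] := eqVneq t1 t2; first by constructor 1.
    have [|n13] := eqVneq t1 t3; first by constructor 2.
    have [|n23] := eqVneq t2 t3; first by constructor 3.
    exfalso.
    have slope s t : sq s -> sq t -> s != t ->
        span2 c d (i 2%:R * (c * d) + i (s + t) * (d * d)).
      move=> Ss St st.
      apply: (@span2_cancel _ _ (s - t)); first by rewrite subr_eq0.
      have -> : i (s - t) * (i 2%:R * (c * d) + i (s + t) * (d * d)) =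
                a s * a s - a t * a t by rewrite /a; ring.
      exact: span2B.
    have dd : span2 c d (d * d).
      apply: (@span2_cancel _ _ (t2 - t3)); first by rewrite subr_eq0.
      have -> : i (t2 - t3) * (d * d) =
                (i 2%:R * (c * d) + i (t1 + t2) * (d * d)) -
                (i 2%:R * (c * d) + i (t1 + t3) * (d * d)) by ring.
      by apply: span2B; exact: slope.
    have cd : span2 c d (c * d).
      apply: (@span2_cancel _ _ 2%:R) => //.
      have -> : i 2%:R * (c * d) = (i 2%:R * (c * d) + i (t1 + t2) * (d * d)) -
                i (t1 + t2) * (d * d) by ring.
      by apply: span2B; [exact: slope|exact: span2Z].
    apply: nclosed; split=> //.
    have -> : c * c = a t1 * a t1 - (i 2%:R * i t1) * (c * d) -
                      i (t1 * t1) * (d * d) by rewrite /a; ring.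
    by apply: span2B; [apply: span2B => //; rewrite -rmorphM|]; exact: span2Z.
  have [|n12] := eqVneq t1 t2; first by constructor 1.
  exfalso; have dd : span2 c d (d * d).
    apply: (@span2_cancel _ _ (t1 - t2)); first by rewrite subr_eq0.
    have -> : i (t1 - t2) * (d * d) = (c * d + i t1 * (d * d)) -
              (c * d + i t2 * (d * d)) by ring.
    by apply: span2B; [case: S1|case: S2].
  by case: S1 => cd cc; exact: closedP dd cd cc.
- move=> t [nsq _] p pp pU.
  have [s [r pE]] := pU 1 (span1_1 _); rewrite mul1r in pE.
  suff r0 : r = 0.
    by apply: (@idem_scalar _ s) => //; rewrite pE r0; ring.
  apply/eqP/negPn/negP => r0; apply: nsq.
  apply: (span2_cancel r0).
  have -> : i r * (a t * a t) = a t * p - i s * a t by rewrite pE; ring.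
  apply: span2B; first exact/line_span2/pU/span1_gen.
  by apply: span2Z; exact/line_span2/span1_gen.
- move=> s [_ nbad].
  have prod t : line_equiv (a t) (a s) -> t != s -> span2 c d (a s * a t).
    move=> [p [q [pq pU]]] ts.
    have [s1 [s2 pE]] := pU 1 (span1_1 _); rewrite mul1r in pE.
    have [r1 [r2 pE']] := pU _ (span1_gen _).
    have [s20|s20] := eqVneq s2 0.
      have [] := @free_cd (- r1) (s1 - r2) (s1 * t - r2 * s).
        have : a t * p - (i r1 + i r2 * a s) = 0 by rewrite pE' subrr.
        by rewrite pE s20 /a => <-; ring.
      move=> _ /subr0_eq <- /eqP; rewrite -mulrBr mulf_eq0 subr_eq0 (negPf ts).
      rewrite orbF => /eqP s10; move: pq; rewrite pE s20 s10.
      have -> : (i 0 + i 0 * a s) * q = 0 by ring.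
      by move=> /esym/eqP; rewrite oner_eq0.
    apply: (span2_cancel s20).
    have -> : i s2 * (a s * a t) = (i r1 + i r2 * a s) - i s1 * a t.
      by rewrite -pE' pE; ring.
    apply: span2B; last exact/span2Z/line_span2/span1_gen.
    by apply: (@line_span2 s); exists r1, r2.
  have two t1 t2 : t1 != s -> t2 != s -> line_equiv (a t1) (a s) ->
      line_equiv (a t2) (a s) -> t1 = t2.
    move=> t1s t2s e1 e2; apply/eqP/negPn/negP => t12; apply: nbad.
    have sd : span2 c d (c * d + i s * (d * d)).
      apply: (@span2_cancel _ _ (t1 - t2)); first by rewrite subr_eq0.
      have -> : i (t1 - t2) * (c * d + i s * (d * d)) = a s * a t1 - a s * a t2.
        by rewrite /a; ring.
      by apply: span2B; exact: prod.
    split=> //.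
    have -> : c * c + i s * (c * d) =
              a s * a t1 - i t1 * (c * d + i s * (d * d)) by rewrite /a; ring.
    by apply: span2B; [exact: prod|exact: span2Z].
  apply: countable_le2 => t1 t2 t3 [_ e1] [_ e2] [_ e3].
  have [t1s|t1s] := eqVneq t1 s.
    have [t2s|t2s] := eqVneq t2 s; first by constructor 1; rewrite t1s.
    have [t3s|t3s] := eqVneq t3 s; first by constructor 2; rewrite t1s.
    by constructor 3; exact: two.
  have [t2s|t2s] := eqVneq t2 s.
    have [t3s|t3s] := eqVneq t3 s; first by constructor 3; rewrite t2s.
    by constructor 2; exact: two.
  by constructor 1; exact: two.
Qed.

(** When [c] and [d] span a square-zero ideal the [U_{a_t}] are subrings, local
    with residue field [k], and pairwise inequivalent. *)
Lemma moduli_of_square_zero : c * c = 0 -> c * d = 0 -> d * d = 0 ->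
  uncountable_moduli.
Proof.
move=> cc cd dd; exists a, [set: k].
have aa s t : a s * a t = 0.
  have -> : a s * a t = c * c + i (s + t) * (c * d) + i (s * t) * (d * d).
    by rewrite /a; ring.
  by rewrite cc cd dd; ring.
split.
- by rewrite setCT; exact: countable0.
- move=> t _ p pp pU.
  have [s [r pE]] := pU 1 (span1_1 _); rewrite mul1r in pE.
  have [] := @free_cd (s * s - s) (2%:R * s * r - r) ((2%:R * s * r - r) * t).
    have : p * p - p - i (r * r) * (a t * a t) = 0 by rewrite aa pp; ring.
    by move=> <-; rewrite pE /a; ring.
  move=> /eqP; rewrite -{3}[s]mulr1 -mulrBr mulf_eq0 subr_eq0.
  move=> s01 sr _; suff r0 : r = 0.
    by apply: (@idem_scalar _ s) => //; rewrite pE r0; ring.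
  case/orP: s01 => /eqP s0; move: sr; rewrite s0.
    by move=> /eqP; rewrite mulr0 mul0r sub0r oppr_eq0 => /eqP.
  by rewrite mulr1 => <-; ring.
- move=> s _; apply: (@sub_countable_set _ _ [set s]); last exact: countable1.
  move=> t [_ [p [q [pq pU]]]] /=; apply/eqP/negPn/negP => ts.
  have [s1 [s2 pE]] := pU 1 (span1_1 _); rewrite mul1r in pE.
  have [r1 [r2 pE']] := pU _ (span1_gen _).
  have [] := @free_cd (- r1) (s1 - r2) (s1 * t - r2 * s).
    have : a t * p - (i r1 + i r2 * a s) - i s2 * (a t * a s) = 0.
      by rewrite pE' aa; ring.
    by rewrite pE /a => <-; ring.
  move=> _ /subr0_eq <- /eqP; rewrite -mulrBr mulf_eq0 subr_eq0 (negPf ts).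
  rewrite orbF => /eqP s10.
  have /eqP : p * q * (p * q) = 0.
    have -> : p * q * (p * q) = i s2 * i s2 * (a s * a s) * (q * q).
      by rewrite pE s10; ring.
    by rewrite aa; ring.
  by rewrite pq mulr1 oner_eq0.
Qed.

End LinesInAnAlgebra.

Lemma free1_change (k : fieldType) (A : comAlgType k) (c d : A)
    (s t r s' t' r' : k) :
  t * r' - t' * r != 0 -> free1 c d ->
  free1 (in_alg A s + in_alg A t * c + in_alg A r * d)
        (in_alg A s' + in_alg A t' * c + in_alg A r' * d).
Proof.
move=> det fcd x y z e.
have [|x0 y0 z0] := @fcd (x + y * s + z * s') (y * t + z * t') (y * r + z * r').
  by rewrite -e; ring.
have y00 : y = 0.
  apply/eqP; rewrite -[_ == _]/(y == 0) -(mulIr_eq0 _ (mulIf det)); apply/eqP.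
  have -> : y * (t * r' - t' * r) = (y * t + z * t') * r' - (y * r + z * r') * t'.
    by ring.
  by rewrite y0 z0; ring.
have z00 : z = 0.
  apply/eqP; rewrite -(mulIr_eq0 _ (mulIf det)); apply/eqP.
  have -> : z * (t * r' - t' * r) = (y * r + z * r') * t - (y * t + z * t') * r.
    by ring.
  by rewrite y0 z0; ring.
by split=> //; move: x0; rewrite y00 z00 !mul0r !addr0.
Qed.

Section ModuliInDimensionFour.
Variables (k : fieldType) (A : comAlgType k).
Hypothesis two_neq0 : 2%:R != 0 :> k.
Local Notation i := (in_alg A).
Implicit Types c d e u v : A.

(** If the span of [1, c, d] is always a subring then, in dimension at least
    four, every element is quadratic over [k]; completing squares and
    polarizing gives a square-zero plane. *)
Lemma moduli_of_dim_gt3 c d e : free1 c d -> ~ span2 c d e -> uncountable_moduli A.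
Proof.
move=> fcd ecd.
have [[c' [d' [f' nclosed]]]|all_closed] := pselect (exists c d : A, free1 c d /\
    ~ [/\ span2 c d (c * c), span2 c d (c * d) & span2 c d (d * d)]).
  exact: moduli_of_nonclosed two_neq0 f' nclosed.
have closed u v : free1 u v ->
    [/\ span2 u v (u * u), span2 u v (u * v) & span2 u v (v * v)].
  by move=> fuv; apply: contrapT => nuv; apply: all_closed; exists u, v.
(* [u * u] lies in the spans of [1, u, v] and of [1, u, e], which meet in the
   span of [1, u]. *)
have quadratic u v : free1 u v -> ~ span2 u v e -> span1 u (u * u).
  move=> fuv euv.
  have solve r s t w : r != 0 -> i s + i t * u + i w * v + i r * e = 0 ->
      span2 u v e.
    move=> r0 h; apply: (@span2_cancel _ _ u v r) => //.
    exists (- s), (- t), (- w); apply/eqP; rewrite -subr_eq0 -h; apply/eqP; ring.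
  have fue : free1 u e.
    move=> s t r h; have [r0|r0] := eqVneq r 0; last first.
      by case: euv; apply: (solve r s t 0) => //; rewrite -h; ring.
    by have [|-> -> _] := fuv s t 0; rewrite -?h ?r0; first ring.
  have [[s [t [r uu]]] _ _] := closed _ _ fuv.
  have [[s' [t' [r' uu']]] _ _] := closed _ _ fue.
  exists s', t'; have [r0|r0] := eqVneq r' 0.
    by rewrite uu' r0; ring.
  case: euv; apply: (solve r' (s' - s) (t' - t) (- r)) => //.
  have <- : u * u - u * u = 0 by rewrite subrr.
  by rewrite {1}uu' uu; ring.
have change (s t r s' t' r' : k) : t * r' - t' * r != 0 ->
    span1 (i s + i t * c + i r * d)
          ((i s + i t * c + i r * d) * (i s + i t * c + i r * d)).
  move=> det; apply: (@quadratic _ (i s' + i t' * c + i r' * d)).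
    exact: free1_change.
  move=> [x [y [z eE]]]; apply: ecd.
  exists (x + y * s + z * s'), (y * t + z * t'), (y * r + z * r').
  by rewrite eE; ring.
have half (x : k) : x = 2%:R * (2%:R^-1 * x) :> k by rewrite mulrA divff // mul1r.
have square (s t r s' t' r' : k) : t * r' - t' * r != 0 -> exists rho gamma,
    (i s + i t * c + i r * d - i rho) * (i s + i t * c + i r * d - i rho) = i gamma.
  move=> det; have [x [y uu]] := change s t r s' t' r' det.
  set u := _ + _ + _ in uu *.
  exists (2%:R^-1 * y), (x + 2%:R^-1 * y * (2%:R^-1 * y)).
  have -> : (u - i (2%:R^-1 * y)) * (u - i (2%:R^-1 * y)) =
    u * u - i (2%:R * (2%:R^-1 * y)) * u + i (2%:R^-1 * y * (2%:R^-1 * y)) by ring.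
  by rewrite uu -half; ring.
have [|rc [gc cc]] := square 0 1 0 0 0 1.
  by rewrite mulr1 mul0r subr0 oner_neq0.
have [|rd [gd dd]] := square 0 0 1 0 1 0.
  by rewrite mulr0 mulr1 sub0r oppr_eq0 oner_neq0.
pose c' := i (- rc) + i 1 * c + i 0 * d; pose d' := i (- rd) + i 0 * c + i 1 * d.
have {}cc : c' * c' = i gc by rewrite -cc /c'; ring.
have {}dd : d' * d' = i gd by rewrite -dd /d'; ring.
have f' : free1 c' d'.
  by apply: free1_change => //; rewrite mulr1 mulr0 subr0 oner_neq0.
have [_ [s [t [r cd]]] _] := closed _ _ f'.
have [x [y h]] : span1 (c' + d') ((c' + d') * (c' + d')).
  have -> : c' + d' = i (- rc - rd) + i 1 * c + i 1 * d by rewrite /c' /d'; ring.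
  by apply: (change _ _ _ (- rd) 0 1); rewrite mulr1 mul0r subr0 oner_neq0.
have [x' [y' h']] : span1 (c' - d') ((c' - d') * (c' - d')).
  have -> : c' - d' = i (- rc + rd) + i 1 * c + i (-1) * d by rewrite /c' /d'; ring.
  by apply: (change _ _ _ (- rd) 0 1); rewrite mulr1 mul0r subr0 oner_neq0.
have [_ yt yr] : [/\ gc + gd + 2%:R * s - x = 0, 2%:R * t - y = 0
    & 2%:R * r - y = 0].
  apply: f'; have <- : (c' + d') * (c' + d') - (i x + i y * (c' + d')) = 0.
    by rewrite h subrr.
  have -> : (c' + d') * (c' + d') = c' * c' + 2%:R * (c' * d') + d' * d' by ring.
  by rewrite cc cd dd; ring.
have [_ yt' yr'] : [/\ gc + gd - 2%:R * s - x' = 0, - 2%:R * t - y' = 0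
    & - 2%:R * r + y' = 0].
  apply: f'; have <- : (c' - d') * (c' - d') - (i x' + i y' * (c' - d')) = 0.
    by rewrite h' subrr.
  have -> : (c' - d') * (c' - d') = c' * c' - 2%:R * (c' * d') + d' * d' by ring.
  by rewrite cc cd dd; ring.
have tr : t = r.
  apply: (mulfI two_neq0); apply/eqP; rewrite -subr_eq0.
  have -> : 2%:R * t - 2%:R * r = (2%:R * t - y) - (2%:R * r - y) by ring.
  by rewrite yt yr subrr.
have t0 : t = 0.
  apply: (mulfI two_neq0); apply: (mulfI two_neq0).
  have -> : 2%:R * (2%:R * t) = - (- 2%:R * t - y') - (- 2%:R * t + y') by ring.
  by rewrite yt' {1}tr yr'; ring.
rewrite -tr t0 in cd.
have {}cd : c' * d' = i s by rewrite cd; ring.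
have [_ s0 gc0] : [/\ 0 = 0 :> k, s = 0 & - gc = 0].
  apply: f'; have -> : i 0 + i s * c' + i (- gc) * d' =
    c' * (i s) - i gc * d' by ring.
  by rewrite -cd -cc; ring.
have [_ gd0 _] : [/\ 0 = 0 :> k, gd = 0 & - s = 0].
  apply: f'; have -> : i 0 + i gd * c' + i (- s) * d' =
    c' * (i gd) - i s * d' by ring.
  by rewrite -cd -dd; ring.
move/eqP: gc0; rewrite oppr_eq0 => /eqP gc0.
apply: (moduli_of_square_zero f').
- by rewrite cc gc0 rmorph0.
- by rewrite cd s0 rmorph0.
- by rewrite dd gd0 rmorph0.
Qed.

End ModuliInDimensionFour.

(** * Graded modules attached to filtrations *)

Section FilteredModules.
Variables (k : fieldType) (R : comAlgType k) (G : nat -> set R).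
Hypothesis SG : standard_graded G.
Variables (A : comAlgType k) (pi : {lrmorphism R -> A}) (x : R) (N : nat).
Hypotheses (Gx : G 1 x) (x_reg : forall v, x * v = 0 -> v = 0) (pix : pi x = 1).
Hypothesis pi_inj : forall i r, G i r -> pi r = 0 -> r = 0.
Hypothesis pi_surj : forall n a, (N <= n)%N -> exists2 r, G n r & pi r = a.

Section FixedRank.
Variable n : nat.

(** An exhaustive filtration of [A^n] by subspaces, compatible with that of
    [A] by the images of the graded pieces of [R]. The lowest level is nonzero,
    which fixes the shift of the graded module attached to it. *)
Record filtration := Filtration {
  level :> nat -> set 'rV[A]_n;
  level_bound : nat;
  levelD : forall l u v, level l u -> level l v -> level l (u + v);
  levelZ : forall l c u, level l u -> level l (c%:A *: u);
  level_succ : forall l r u, G 1 r -> level l u -> level l.+1 (pi r *: u);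
  level_full : forall l u, (level_bound <= l)%N -> level l u;
  level_neq0 : exists2 u, level 0 u & u != 0
}.

Implicit Types (L : filtration).

Lemma level0 L l : L l 0.
Proof.
have [u Lu _] := level_neq0 L; have L1 : L l (0 *: u).
  elim: l => [|l IHl]; first by rewrite -[0](scale0r (1 : A)); exact: levelZ.
  by have := level_succ Gx IHl; rewrite pix scale1r.
by rewrite scale0r in L1.
Qed.

Lemma levelM L i l r u : G i r -> L l u -> L (i + l)%N (pi r *: u).
Proof.
elim: i r l u => [|i IHi] r l u.
  by move=> /(graded0P SG)[c ->]; rewrite linearZ /= rmorph1; exact: levelZ.
rewrite (graded_succ SG) => -[s [sG ->]] Lu.
rewrite rmorph_sum /= scaler_suml big_seq.
apply: (big_ind (L (i.+1 + l)%N)) => [|?? |p /sG[Gp1 Gp2]].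
- exact: level0.
- exact: levelD.
- by rewrite rmorphM /= -scalerA; apply: level_succ => //; exact: IHi.
Qed.

Definition homog_row j (w : 'rV[R]_n) := forall c, G j (w 0 c).
Definition component_row j (v : 'rV[R]_n) : 'rV[R]_n := map_mx (component SG j) v.
Definition pi_row (v : 'rV[R]_n) : 'rV[A]_n := map_mx pi v.

Lemma homog_component_row j v : homog_row j (component_row j v).
Proof. by move=> c; rewrite mxE; exact: componentG. Qed.

Lemma component_rowD j v w :
  component_row j (v + w) = component_row j v + component_row j w.
Proof. by apply/rowP => c; rewrite !mxE componentD. Qed.

Lemma component_row0 j : component_row j 0 = 0.
Proof. by apply/rowP => c; rewrite !mxE component0. Qed.

Lemma component_row_homog i j w : homog_row j w ->
  component_row i w = if i == j then w else 0.
Proof.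
move=> hw; apply/rowP => c; rewrite mxE (component_homog SG _ (hw c)).
by case: eqP; rewrite ?mxE.
Qed.

Lemma component_rowZ j a v : component_row j (a *: v) =
  \sum_(i < j.+1) component SG i a *: component_row (j - i) v.
Proof.
apply/rowP => c; rewrite summxE !mxE /component rmorphM /= coefM.
by apply: eq_bigr => i _; rewrite !mxE.
Qed.

Lemma homog_rowZ i j a w : G i a -> homog_row j w -> homog_row (i + j)%N (a *: w).
Proof. by move=> Ga hw c; rewrite mxE; exact: gradedM. Qed.

Lemma component_rowZ_homog i j a v : G i a -> component_row j (a *: v) =
  if (i <= j)%N then a *: component_row (j - i) v else 0.
Proof.
move=> Ga; apply/rowP => c; rewrite !mxE (component_mull SG _ _ Ga).
by case: ifP; rewrite !mxE.
Qed.

Lemma pi_row_linear a v w : pi_row (a *: v + w) = pi a *: pi_row v + pi_row w.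
Proof. by apply/rowP => c; rewrite !mxE rmorphD rmorphM. Qed.

Lemma pi_rowZ a v : pi_row (a *: v) = pi a *: pi_row v.
Proof. by apply/rowP => c; rewrite !mxE rmorphM. Qed.

Lemma pi_row_inj j w : homog_row j w -> pi_row w = 0 -> w = 0.
Proof.
move=> hw /rowP w0; apply/rowP => c; rewrite mxE; apply: (pi_inj (hw c)).
by have := w0 c; rewrite !mxE.
Qed.

Lemma pi_row_surj j u : (N <= j)%N -> exists2 w, homog_row j w & pi_row w = u.
Proof.
move=> le_Nj.
have /choice[f fP] : forall c, exists r, G j r /\ pi r = u 0 c.
  by move=> c; have [r Gr ru] := pi_surj (u 0 c) le_Nj; exists r.
exists (\row_c f c).
  by move=> c; rewrite mxE; case: (fP c).
by apply/rowP => c; rewrite !mxE; case: (fP c).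
Qed.

Definition in_level L j (w : 'rV[R]_n) : Prop :=
  if (j < N)%N then w = 0 else L (j - N)%N (pi_row w).

Lemma in_level0 L j : in_level L j 0.
Proof.
rewrite /in_level; case: ifP => // _.
have -> : pi_row 0 = 0 by apply/rowP => c; rewrite !mxE rmorph0.
exact: level0.
Qed.

Lemma in_levelD L j v w : in_level L j v -> in_level L j w -> in_level L j (v + w).
Proof.
rewrite /in_level; case: ifP => [_ -> ->|_]; first by rewrite addr0.
by have := pi_row_linear 1 v w; rewrite !scale1r rmorph1 scale1r => ->;
  exact: levelD.
Qed.

Lemma in_levelM L i j a w :
  G i a -> in_level L j w -> in_level L (i + j)%N (a *: w).
Proof.
move=> Ga; rewrite {1}/in_level; case: ltnP => [_ ->|le_Nj Lw].
  by rewrite scaler0; exact: in_level0.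
rewrite /in_level ltnNge (leq_trans le_Nj (leq_addl _ _)) /=.
by rewrite pi_rowZ -addnBA //; exact: levelM.
Qed.

Definition filtered_pred L : {pred 'rV[R]_n} :=
  fun v => `[< forall j, in_level L j (component_row j v) >].

Lemma filtered_predP L v :
  reflect (forall j, in_level L j (component_row j v)) (v \in filtered_pred L).
Proof. exact: asboolP. Qed.

Lemma filtered_pred_closed L : submod_closed (filtered_pred L).
Proof.
split.
  by apply/filtered_predP => j; rewrite component_row0; exact: in_level0.
move=> a v w /filtered_predP Lv /filtered_predP Lw; apply/filtered_predP => j.
rewrite component_rowD; apply: in_levelD => //.
rewrite component_rowZ; apply: (big_ind (in_level L j)) => [|??|i _].
- exact: in_level0.
- exact: in_levelD.
- rewrite -{1}(subnKC (leq_ord i)); apply: in_levelM => //.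
  exact: componentG.
Qed.

HB.instance Definition _ L :=
  GRing.isSubmodClosed.Build R 'rV[R]_n (filtered_pred L) (filtered_pred_closed L).

(** The graded [R]-submodule of [R^n] attached to a filtration of [A^n]: its
    piece of degree [N + l] consists of the lifts of the elements of level
    [l]. *)
Record filtered L := Filtered {
  filtered_val :> 'rV[R]_n;
  _ : filtered_val \in filtered_pred L
}.

HB.instance Definition _ L := [isSub for @filtered_val L].
HB.instance Definition _ L := [Choice of filtered L by <:].
HB.instance Definition _ L := [SubChoice_isSubLmodule of filtered L by <:].

Lemma filtered_val_sum L (T : Type) (s : seq T) (P : pred T) (f : T -> filtered L) :
  filtered_val (\sum_(i <- s | P i) f i) = \sum_(i <- s | P i) filtered_val (f i).
Proof. exact: (raddf_sum val). Qed.

Lemma filteredP L (v : filtered L) j : in_level L j (component_row j (val v)).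
Proof. by case: v => v /= /filtered_predP. Qed.

Lemma filtered_homogP L j w : homog_row j w -> in_level L j w ->
  w \in filtered_pred L.
Proof.
move=> hw Lw; apply/filtered_predP => i; rewrite (component_row_homog _ hw).
by case: eqP => [->//|_]; exact: in_level0.
Qed.

Definition filtered_piece L (j : int) : set (filtered L) :=
  if j is Posz j then [set v | homog_row j (val v)] else [set 0].

Lemma component_row_filtered L j (v : filtered L) :
  component_row j (val v) \in filtered_pred L.
Proof.
by apply: filtered_homogP (homog_component_row _ _) _; exact: filteredP.
Qed.

Definition filtered_component L (j : int) (v : filtered L) : filtered L :=
  if j is Posz j then Filtered (component_row_filtered j v) else 0.

Lemma filtered_componentD L j : {morph @filtered_component L j : u v / u + v}.
Proof.
case: j => j u v; last by rewrite addr0.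
by apply: val_inj; rewrite [in RHS]raddfD /= component_rowD.
Qed.

Lemma filtered_component0 L j : @filtered_component L j 0 = 0.
Proof.
by case: j => j //; apply: val_inj; rewrite [RHS]raddf0 /= component_row0.
Qed.

Lemma filtered_component_homog L i j (v : filtered L) : filtered_piece j v ->
  filtered_component i v = if i == j then v else 0.
Proof.
case: j => j; last first.
  by move=> ->; rewrite filtered_component0; case: ifP.
move=> hv; case: i => i; last by [].
by apply: val_inj; rewrite /= (component_row_homog _ hv) eqz_nat; case: eqP.
Qed.

Lemma filtered_component_piece L j (v : filtered L) :
  filtered_piece j (filtered_component j v).
Proof. by case: j => j //; exact: homog_component_row. Qed.

Lemma filtered_sum_components L (v : filtered L) : exists m,
  v = \sum_(i <- [seq Posz i | i <- iota 0 m]) filtered_component i v.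
Proof.
have /choice[f fP] : forall c, exists m, forall m', (m <= m')%N ->
    val v 0 c = \sum_(i < m') component SG i (val v 0 c).
  by move=> c; exact: sum_components.
exists (\max_c f c); apply: val_inj; rewrite /= filtered_val_sum big_map.
rewrite -[iota _ _]/(iota 0 _) -[X in iota 0 X]subn0 -/(index_iota _ _) big_mkord.
apply/rowP => c; rewrite summxE {1}(fP c (\max_c f c)) ?leq_bigmax //.
by apply: eq_bigr => i _; rewrite mxE.
Qed.

Lemma filtered_grading L : is_grading (@filtered_piece L).
Proof.
split.
- case=> j /=; last by split=> // _ _ -> ->; rewrite subr0.
  split=> [c|u v hu hv c]; first by rewrite /= mxE; exact: graded0.
  by rewrite /= !mxE; exact: gradedB.
- move=> v; have [m mv] := filtered_sum_components v.
  exists [seq Posz i | i <- iota 0 m], (fun i => filtered_component i v).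
  split=> //; last by move=> i; exact: filtered_component_piece.
  by rewrite map_inj_uniq ?iota_uniq // => i j [].
- move=> s f us fP s0 i is_.
  have := congr1 (@filtered_component L i) s0.
  rewrite filtered_component0.
  rewrite (big_morph _ (@filtered_componentD L i) (@filtered_component0 L i)).
  rewrite (bigD1_seq i) //= (filtered_component_homog _ (fP i)) eqxx big1 ?addr0 //.
  move=> j ji; rewrite (filtered_component_homog _ (fP j)).
  by rewrite eq_sym (negPf ji).
Qed.

Lemma filtered_scale L i j a (v : filtered L) : G i a -> filtered_piece j v ->
  filtered_piece (i%:Z + j) (a *: v).
Proof.
move=> Ga; case: j => j hv.
  by move=> c; rewrite /=; exact: homog_rowZ.
rewrite hv scaler0; case: (_ + _) => // l c.
by rewrite raddf0 mxE; exact: graded0.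
Qed.

Definition filtered_module L : gradedModule G :=
  GradedModule (@filtered_grading L) (@filtered_scale L).

Lemma filtered_lift L l u : L l u ->
  exists2 v : filtered L, filtered_piece (Posz (N + l)) v & pi_row (val v) = u.
Proof.
move=> Lu; have [w hw wu] := pi_row_surj u (leq_addr l N).
have Lw : w \in filtered_pred L.
  apply: (filtered_homogP hw); rewrite /in_level ltnNge leq_addr /= addKn.
  by rewrite wu.
by exists (Filtered Lw).
Qed.

Lemma level_pi_row L l (v : filtered L) :
  filtered_piece (Posz (N + l)) v -> L l (pi_row (val v)).
Proof.
move=> hv; have := filteredP v (N + l)%N.
by rewrite (component_row_homog _ hv) eqxx /in_level ltnNge leq_addr /= addKn.
Qed.

Lemma filtered_piece_lt L j (v : filtered L) : (j < N)%N ->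
  filtered_piece (Posz j) v -> v = 0.
Proof.
move=> lt_jN hv; apply: val_inj; have := filteredP v j.
by rewrite (component_row_homog _ hv) eqxx /in_level lt_jN.
Qed.

Lemma graded_div j r : (N <= j)%N -> G j.+1 r -> exists2 s, G j s & r = x * s.
Proof.
move=> le_Nj Gr; have [s Gs sr] := pi_surj (pi r) le_Nj; exists s => //.
apply/eqP; rewrite -subr_eq0; apply/eqP/(@pi_inj j.+1).
  by apply: (gradedB SG) => //; rewrite -add1n; exact: gradedM.
by rewrite rmorphB rmorphM /= sr pix mul1r subrr.
Qed.

Lemma filtered_fg L : finitely_generated (filtered L).
Proof.
apply: (@sub_row_vectors_fg R (filtered L) n (val : {linear filtered L -> _})).
  by case: SG.
exact: val_inj.
Qed.

(** The parameter [x] is regular, and a homogeneous element of maximal degree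
    outside [x M] is a socle element of [M / x M]. *)
Lemma filtered_depth L :
  depth (irrelevant_ideal G) (filtered L) 1.
Proof.
have reg (v : filtered L) : x *: v = 0 -> v = 0.
  move=> /(congr1 val) /= /rowP xv; apply: val_inj; apply/rowP => c.
  by have := xv c; rewrite !mxE => /x_reg.
pose xM := [set v : filtered L | exists w : filtered L, v = x *: w].
have xMD u v : xM u -> xM v -> xM (u + v).
  by move=> [a ->] [b ->]; exists (a + b); rewrite scalerDr.
pose socle j := `[< exists v : filtered L, filtered_piece (Posz j) v /\ ~ xM v >].
have socleN : socle N.
  have [u Lu u0] := level_neq0 L; have [v hv vu] := filtered_lift Lu.
  rewrite addn0 in hv; apply/asboolP; exists v; split=> // -[w vw].
  case/eqP: u0; rewrite -vu.
  suff -> : val v = 0 by apply/rowP => c; rewrite !mxE rmorph0.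
  have := component_row_homog N hv; rewrite eqxx => <-.
  rewrite vw linearZ /= (component_rowZ_homog _ _ Gx); case: ifP => // N0.
  have := filteredP w (N - 1)%N.
  by rewrite /in_level subn1 prednK // leqnn => ->; rewrite scaler0.
have socle_le j : socle j -> (j <= N + level_bound L)%N.
  move=> /asboolP[v [hv vx]]; rewrite leqNgt; apply/negP => lt_Nj; apply: vx.
  have /choice[f fP] : forall c, exists s, G j.-1 s /\ val v 0 c = x * s.
    move=> c; have [||s Gs vs] := @graded_div j.-1 (val v 0 c).
    - by rewrite -ltnS (ltn_predK lt_Nj) (leq_trans _ lt_Nj) // ltnS leq_addr.
    - by rewrite (ltn_predK lt_Nj); exact: hv.
    - by exists s.
  have hw : homog_row j.-1 (\row_c f c) by move=> c; rewrite mxE; case: (fP c).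
  have Lw : \row_c f c \in filtered_pred L.
    apply: (filtered_homogP hw); have le_j : (N + level_bound L <= j.-1)%N.
      by rewrite -ltnS (ltn_predK lt_Nj).
    rewrite /in_level ltnNge (leq_trans (leq_addr _ _) le_j) /=.
    by apply: level_full; rewrite leq_subRL // (leq_trans (leq_addr _ _) le_j).
  exists (Filtered Lw); apply: val_inj; apply/rowP => c.
  by rewrite /= !mxE; case: (fP c).
have [j /asboolP[z [hz zx]] jmax] := ex_maxnP (ex_intro _ N socleN) socle_le.
apply: (depth_one (x := x) (z := z)) => //.
  exact: irrelevant_homog SG 0%N _ Gx.
move=> r /(irrelevantP SG) r0; have [i ri] := sum_components SG r.
rewrite (ri i.+1 (leqnSn i)) big_ord_recl r0 add0r scaler_suml.
apply: (big_ind xM) => [|??|a _]; [by exists 0; rewrite scaler0|exact: xMD|].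
apply: contrapT => ax; suff : (bump 0 a + j <= j)%N.
  by rewrite -{2}[j]add0n leq_add2r.
apply: jmax; apply/asboolP; eexists; split; last exact: ax.
exact: (filtered_scale (componentG SG _ r) hz).
Qed.

Lemma filtered_mcm L : krull_dim R 1 ->
  maximal_cohen_macaulay (filtered_module L).
Proof.
move=> R1; split; first exact: filtered_fg.
by exists 1%N; split=> //; exact: filtered_depth.
Qed.

Lemma filtered_homog_inj L j (v : filtered L) : filtered_piece j v ->
  pi_row (val v) = 0 -> v = 0.
Proof.
case: j => // j hv v0; apply: val_inj; exact: pi_row_inj hv v0.
Qed.

(** Setting [x = 1] turns every filtered module into [A^n], so that every
    [R]-linear map between filtered modules is induced by an endomorphism of
    [A^n]. *)
Lemma filtered_linear_matrix L L' (phi : {linear filtered L -> filtered L'}) :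
  exists P : 'M[A]_n, forall v, pi_row (val (phi v)) = pi_row (val v) *m P.
Proof.
pose K := (N + level_bound L)%N.
have GxK : G K (x ^+ K) by rewrite -[X in G X]mul1n; exact: gradedX.
have xe c : x ^+ K *: delta_mx 0 c \in filtered_pred L.
  apply: (@filtered_homogP L K) => [d|].
    rewrite !mxE; case: (_ && _); rewrite ?mulr1 ?mulr0 //; exact: graded0.
  by rewrite /in_level ltnNge leq_addr /= addKn; exact: level_full.
exists (\matrix_c pi_row (val (phi (Filtered (xe c))))) => v.
have -> : pi_row (val (phi v)) = pi_row (val (phi (x ^+ K *: v))).
  by rewrite linearZ /= pi_rowZ rmorphXn /= pix expr1n scale1r.
have -> : x ^+ K *: v = \sum_c val v 0 c *: Filtered (xe c).
  apply: val_inj; rewrite raddf_sum /= [X in _ *: X = _]row_sum_delta.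
  rewrite scaler_sumr; apply: eq_bigr => c _.
  by rewrite !scalerA mulrC.
rewrite linear_sum mulmx_sum_row raddf_sum /=.
have pi_row_sum (f : 'I_n -> 'rV[R]_n) :
    pi_row (\sum_c f c) = \sum_c pi_row (f c).
  apply/rowP => d; rewrite mxE !summxE rmorph_sum.
  by apply: eq_bigr => c _; rewrite mxE.
rewrite pi_row_sum; apply: eq_bigr => c _.
by rewrite linearZ /= pi_rowZ mxE rowK.
Qed.

Lemma graded_submodule_component L (S : set (filtered_module L)) j u :
  graded_submodule S -> S u -> S (filtered_component j u).
Proof.
move=> [S0 SD _ Sgr] /Sgr[s [f [_ fS ->]]].
rewrite (big_morph _ (@filtered_componentD L j) (@filtered_component0 L j)).
apply: (big_ind S) => // i _; rewrite (filtered_component_homog _ (fS i).1).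
by case: eqP => // _; exact: (fS i).2.
Qed.

(** The projection onto a graded direct summand is homogeneous of degree zero,
    so it is given by an idempotent matrix that respects the levels. *)
Lemma filtered_indecomposable L :
  (forall P : 'M[A]_n, (forall l u, L l u -> L l (u *m P)) -> P *m P = P ->
     P = 0 \/ P = 1%:M) ->
  indecomposable (filtered_module L).
Proof.
move=> idem; split.
  have [u Lu u0] := level_neq0 L; have [v _ vu] := filtered_lift Lu.
  exists v; apply: contra_neq u0 => v0; rewrite -vu v0.
  by apply/rowP => c; rewrite !mxE rmorph0.
move=> S T Sgr Tgr ST STI.
have [S0 SD SZ _] := Sgr; have [T0 TD TZ _] := Tgr.
have /choice[p pP] : forall v : filtered L, exists a, S a /\ T (v - a).
  by move=> v; have [a [b [Sa Tb ->]]] := ST v; exists a; rewrite addrC addKr.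
have p_unique v a : S a -> T (v - a) -> p v = a.
  move=> Sa Ta; apply/eqP; rewrite -subr_eq0; apply/eqP.
  have : (S `&` T) (p v - a); last by rewrite STI.
  have [Sp Tp] := pP v; split.
    by rewrite -scaleN1r; apply: SD => //; exact: SZ.
  have -> : p v - a = (v - a) + -1 *: (v - p v).
    by rewrite scaleN1r opprB [RHS]addrC -addrA (addrA (- v)) addNr add0r.
  by apply: TD => //; exact: TZ.
have p_lin : linear p.
  move=> a u v; have [Su Tu] := pP u; have [Sv Tv] := pP v; apply: p_unique.
    by apply: SD => //; exact: SZ.
  by rewrite opprD addrACA -scalerBr; apply: TD => //; exact: TZ.
pose pL : {linear filtered L -> filtered L} :=
  HB.pack p (GRing.isLinear.Build R (filtered L) (filtered L) *:%R p p_lin).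
have p_comp j v : p (filtered_component j v) = filtered_component j (p v).
  have [Sv Tv] := pP v; apply: p_unique; first exact: graded_submodule_component.
  rewrite -[v in X in T (X - _)](subrK (p v)) filtered_componentD addrK.
  exact: graded_submodule_component.
have p_piece j v : filtered_piece j v -> filtered_piece j (p v).
  move=> hv; have := filtered_component_homog j hv; rewrite eqxx => <-.
  by rewrite p_comp; exact: filtered_component_piece.
have p_idem v : p (p v) = p v.
  by apply: p_unique; [case: (pP v)|rewrite subrr].
have [P PE] := filtered_linear_matrix pL.
have PL l u : L l u -> L l (u *m P).
  move=> Lu; have [v hv <-] := filtered_lift Lu; rewrite -PE.
  exact/level_pi_row/p_piece.
have P_idem : P *m P = P.
  apply/row_matrixP => i; rewrite !rowE mulmxA.
  have [v _ <-] := filtered_lift (@level_full L _ (delta_mx 0 i) (leqnn _)).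
  by rewrite -!PE /= p_idem.
have p_homog (q : filtered L -> filtered L) : {morph q : u v / u + v} -> q 0 = 0 ->
    (forall j v, filtered_piece j v -> q v = 0) -> forall v, q v = 0.
  move=> qD q0 qh v; have [m ->] := filtered_sum_components v.
  rewrite (big_morph _ qD q0) big1 // => i _.
  exact: qh (filtered_component_piece i v).
have pD := raddfD pL; have p0 := raddf0 pL; rewrite /= in pD p0.
have [P0|P1] := idem P PL P_idem; [left|right]; apply/seteqP; split.
- move=> u Su; rewrite /=; have <- : p u = u by apply: p_unique; rewrite ?subrr.
  apply: p_homog => // j v hv.
  apply: (filtered_homog_inj (p_piece j v hv)).
  by have := PE v; rewrite /= P0 mulmx0.
- by move=> _ ->.
- move=> u Tu; have pu : p u = 0 by apply: p_unique; rewrite ?subr0.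
  suff : u - p u = 0 by rewrite pu subr0.
  apply: (p_homog (fun u => u - p u)) => [a b||j v hv].
  + by rewrite pD opprD addrACA.
  + by rewrite p0 subr0.
  + have hpv := p_piece j v hv; apply: (@filtered_homog_inj L j).
      by case: (filtered_grading L) => /(_ j)[_ piece] _ _; exact: piece.
    have -> : pi_row (val (v - p v)) = pi_row (val v) - pi_row (val (p v)).
      by apply/rowP => c; rewrite !mxE rmorphB.
    by have := PE v; rewrite /= P1 mulmx1 => ->; rewrite subrr.
- by move=> _ ->.
Qed.

Lemma filtered_piece_ge L (j : int) (v : filtered L) :
  filtered_piece j v -> v != 0 -> (N%:Z <= j)%R.
Proof.
case: j => j hv v0; last by rewrite hv eqxx in v0.
rewrite lez_nat leqNgt; apply/negP => /filtered_piece_lt/(_ hv) e.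
by rewrite e eqxx in v0.
Qed.

(** Both modules start in degree [N], so the shift vanishes and the matrix of an
    isomorphism respects the levels. *)
Lemma filtered_iso_matrix L L' :
  isomorphic_up_to_shift (filtered_module L) (filtered_module L') ->
  exists P Q : 'M[A]_n, P *m Q = 1%:M /\ forall l u, L l u -> L' l (u *m P).
Proof.
move=> [s [phi [phib phiP]]]; have [psi phiK psiK] := phib.
have psi_lin : linear psi.
  by move=> a u v; apply: (can_inj phiK); rewrite psiK linearP !psiK.
pose psiL : {linear filtered L' -> filtered L} :=
  HB.pack psi (GRing.isLinear.Build R (filtered L') (filtered L) *:%R psi psi_lin).
have s0 : s = 0.
  have low M : exists2 v : filtered M, filtered_piece (Posz N) v & v != 0.
    have [u Lu u0] := level_neq0 M; have [v hv vu] := filtered_lift Lu.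
    rewrite addn0 in hv; exists v => //; apply: contra_neq u0 => v0.
    by rewrite -vu v0; apply/rowP => c; rewrite !mxE rmorph0.
  apply/eqP; rewrite Order.POrderTheory.eq_le; apply/andP; split.
    have [v hv v0] := low L'.
    have /filtered_piece_ge : filtered_piece (N%:Z - s) (psi v).
      by apply/phiP; rewrite subrK psiK.
    rewrite Num.Theory.lerDl Num.Theory.oppr_ge0; apply.
    by apply: contra_neq v0 => e; rewrite -[v]psiK e linear0.
  have [v hv v0] := low L.
  have /phiP/filtered_piece_ge := hv; rewrite Num.Theory.lerDl; apply.
  by apply: contra_neq v0 => e; rewrite -[v]phiK e; exact: (linear0 psiL).
rewrite s0 in phiP.
have [P PE] := filtered_linear_matrix phi.
have [Q QE] := filtered_linear_matrix psiL.
exists P, Q; split.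
  apply/row_matrixP => i; rewrite !rowE mulmxA mulmx1.
  have [v _ <-] := filtered_lift (@level_full L _ (delta_mx 0 i) (leqnn _)).
  by rewrite -PE -QE /= phiK.
move=> l u Lu; have [v hv <-] := filtered_lift Lu; rewrite -PE.
by apply: level_pi_row; have /phiP := hv; rewrite addr0.
Qed.

End FixedRank.

(** Otherwise the field of parameters would be a countable union of countable
    classes and of the countable set of exceptions. *)
Lemma countable_type_family (M : k -> gradedModule G) (T : set k) :
  ~ countable [set: k] -> graded_countable_CM_type G -> countable (~` T) ->
  (forall t, T t -> maximal_cohen_macaulay (M t) /\ indecomposable (M t)) ->
  ~ (forall s, T s ->
       countable [set t | T t /\ isomorphic_up_to_shift (M t) (M s)]).
Proof.
move=> uk [_ _ [F FP]] cT MT cclass; apply: uk.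
rewrite -(setUv T); apply: countable_setU => //.
have sub : T `<=` \bigcup_(j in [set: nat])
    [set t | T t /\ isomorphic_up_to_shift (M t) (F j)].
  by move=> t Tt; have [mcm ind] := MT t Tt; have [j Mj] := FP _ mcm ind; exists j.
apply: (sub_countable_set sub); apply: bigcup_countable => // j _.
have [[s [Ts sj]]|no] :=
  pselect (exists s, T s /\ isomorphic_up_to_shift (M s) (F j)).
  apply: sub_countable_set (cclass s Ts) => t [Tt tj]; split=> //.
  exact: iso_shift_trans tj (iso_shift_sym sj).
apply: (@sub_countable_set _ _ set0) => [t [Tt tj]|]; last exact: countable0.
by case: no; exists t.
Qed.

Local Notation i := (in_alg A).

Section Lines.
Variable a : A.

Definition line_level (l : nat) : set 'rV[A]_1 :=
  if l is 0 then [set u | span1 a (u 0 0)] else [set: 'rV[A]_1].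

Lemma line_levelD l u v : line_level l u -> line_level l v -> line_level l (u + v).
Proof.
case: l => //= -[s [t e]] [s' [t' e']].
by exists (s + s'), (t + t'); rewrite mxE e e'; ring.
Qed.

Lemma line_levelZ l c u : line_level l u -> line_level l (c%:A *: u).
Proof.
case: l => //= -[s [t e]]; exists (c * s), (c * t).
by rewrite mxE e -[c%:A]/(i c); ring.
Qed.

Lemma line_level_neq0 : exists2 u, line_level 0 u & u != 0.
Proof.
exists 1%:M; first by rewrite /= mxE eqxx; exact: span1_1.
by apply/eqP => /matrixP/(_ 0 0)/eqP; rewrite !mxE oner_eq0.
Qed.

Lemma line_level_full l u : (1 <= l)%N -> line_level l u.
Proof. by case: l. Qed.

Definition line_filtration : filtration 1 :=
  @Filtration 1 line_level 1 line_levelD line_levelZ (fun _ _ _ _ _ => I)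
    line_level_full line_level_neq0.

End Lines.

Lemma row1_mulmx (u : 'rV[A]_1) (P : 'M[A]_1) : (u *m P) 0 0 = u 0 0 * P 0 0.
Proof. by rewrite mxE big_ord1. Qed.

(** Planes in [A], placed below the full algebra, give a family of ideals of
    [R]. *)
Lemma no_uncountable_moduli : ~ countable [set: k] -> krull_dim R 1 ->
  graded_countable_CM_type G -> ~ uncountable_moduli A.
Proof.
move=> uk R1 cCM [a [T [cT indec classes]]].
pose M t := filtered_module (line_filtration (a t)).
apply: (@countable_type_family M T) => // [t Tt|s Ts].
  split; first exact: filtered_mcm.
  apply: filtered_indecomposable => P PL PP.
  have [||P0|P1] := indec t Tt (P 0 0).
  - by rewrite -row1_mulmx PP.
  - move=> u Uu; have := PL 0%N u%:M; rewrite /= row1_mulmx mxE eqxx.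
    exact.
  - by left; apply/matrixP => c d; rewrite !ord1 P0 mxE.
  - by right; apply/matrixP => c d; rewrite !ord1 P1 mxE eqxx.
apply: sub_countable_set (classes s Ts) => t.
move=> [Tt /filtered_iso_matrix[P [Q [PQ PL]]]].
split=> //; exists (P 0 0), (Q 0 0); split.
  by rewrite -row1_mulmx PQ mxE eqxx.
move=> u Uu; have := PL 0%N u%:M; rewrite /= row1_mulmx mxE eqxx.
exact.
Qed.

End FilteredModules.

(** * The triple root *)

Section TripleRoot.
Variables (k : fieldType) (R : comAlgType k) (G : nat -> set R).
Hypothesis SG : standard_graded G.
Variables (A : comAlgType k) (pi : {lrmorphism R -> A}) (x : R) (N : nat).
Hypotheses (Gx : G 1 x) (x_reg : forall v, x * v = 0 -> v = 0) (pix : pi x = 1).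
Hypothesis pi_inj : forall i r, G i r -> pi r = 0 -> r = 0.
Hypothesis pi_surj : forall n a, (N <= n)%N -> exists2 r, G n r & pi r = a.
Local Notation i := (in_alg A).
Variable a : A.
Hypotheses (a3 : a * (a * a) = 0) (free_a : free1 a (a * a)).
Hypothesis span_a : forall u, span2 a (a * a) u.
Hypothesis linear_a : forall r, G 1 r -> span1 a (pi r).

Let coord_exists u : exists w : k * k * k,
  u = i w.1.1 + i w.1.2 * a + i w.2 * (a * a).
Proof. by have [s [t [r ->]]] := span_a u; exists (s, t, r). Qed.

Let coord u := sval (cid (coord_exists u)).
Definition coord0 u := (coord u).1.1.
Definition coord1 u := (coord u).1.2.
Definition coord2 u := (coord u).2.

Lemma coordE u : u = i (coord0 u) + i (coord1 u) * a + i (coord2 u) * (a * a).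
Proof. exact: (svalP (cid (coord_exists u))). Qed.

Lemma coord_unique u s t r : u = i s + i t * a + i r * (a * a) ->
  [/\ coord0 u = s, coord1 u = t & coord2 u = r].
Proof.
move=> uE; have [] := @free_a (coord0 u - s) (coord1 u - t) (coord2 u - r).
  have : u - u = 0 by rewrite subrr.
  by rewrite {1}[u]coordE {4}uE => <-; ring.
by move=> /subr0_eq-> /subr0_eq-> /subr0_eq->.
Qed.

Lemma coordD u v : [/\ coord0 (u + v) = coord0 u + coord0 v,
  coord1 (u + v) = coord1 u + coord1 v & coord2 (u + v) = coord2 u + coord2 v].
Proof. by apply: coord_unique; rewrite {1}[u]coordE {1}[v]coordE; ring. Qed.

Lemma coordM u v : [/\ coord0 (u * v) = coord0 u * coord0 v,
  coord1 (u * v) = coord0 u * coord1 v + coord1 u * coord0 v &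
  coord2 (u * v) = coord0 u * coord2 v + coord1 u * coord1 v + coord2 u * coord0 v].
Proof.
apply: coord_unique; rewrite {1}[u]coordE {1}[v]coordE.
move: (coord0 u) (coord1 u) (coord2 u) (coord0 v) (coord1 v) (coord2 v).
move=> s t r s' t' r'.
have -> : (i s + i t * a + i r * (a * a)) * (i s' + i t' * a + i r' * (a * a)) =
  i (s * s') + i (s * t' + t * s') * a + i (s * r' + t * t' + r * s') * (a * a) +
  (i (t * r' + r * t') + i (r * r') * a) * (a * (a * a)) by ring.
by rewrite a3; ring.
Qed.

Lemma coord_scalar s : [/\ coord0 (i s) = s, coord1 (i s) = 0 & coord2 (i s) = 0].
Proof. by apply: coord_unique; ring. Qed.

Lemma coord_a : [/\ coord0 a = 0, coord1 a = 1 & coord2 a = 0].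
Proof. by apply: coord_unique; ring. Qed.

Lemma coord_sum0 (T : Type) (r : seq T) (f : T -> A) :
  coord0 (\sum_(j <- r) f j) = \sum_(j <- r) coord0 (f j).
Proof.
apply: big_morph => [u v|]; first by case: (coordD u v).
by have [] := coord_scalar 0; rewrite rmorph0.
Qed.


Let o0 : 'I_3 := @Ordinal 3 0 isT.
Let o1 : 'I_3 := @Ordinal 3 1 isT.
Let o2 : 'I_3 := @Ordinal 3 2 isT.

Definition flag_coord (l : nat) (y : 'I_3 -> k) : Prop :=
  match l with
  | 0 => y o1 = 0 /\ y o2 = 0
  | 1 => y o2 = 0
  | _ => True
  end.

Definition flag_opposite (l : nat) (y : 'I_3 -> k) : Prop :=
  match l with
  | 0 => [/\ y o0 = 0, y o1 = 0 & y o2 = 0]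
  | 1 => y o0 = 0 /\ y o1 = 0
  | 2 => y o0 = 0
  | _ => True
  end.

Definition flag_moving (t : k) (l : nat) (y : 'I_3 -> k) : Prop :=
  match l with
  | 0 | 1 => [/\ y o0 = 0, y o1 = 0 & y o2 = 0]
  | 2 => y o0 = y o1 /\ y o1 = y o2
  | 3 => y o2 - y o0 = t * (y o1 - y o0)
  | _ => True
  end.

(** Three flags in [k^3], placed on the coefficients of [a^2], [a] and [1] with
    increasing delays so that multiplication by [a] respects the levels. *)
Definition flag_level t (l : nat) : set 'rV[A]_3 := [set u |
  [/\ flag_coord l (fun c => coord2 (u 0 c)),
      flag_opposite l (fun c => coord1 (u 0 c))
    & flag_moving t l (fun c => coord0 (u 0 c))]].

Lemma flag_coordD l y z : flag_coord l y -> flag_coord l z ->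
  flag_coord l (fun c => y c + z c).
Proof.
case: l => [|[|l]] //=; first by move=> [-> ->] [-> ->]; rewrite addr0.
by move=> -> ->; rewrite addr0.
Qed.

Lemma flag_coordZ l s y : flag_coord l y -> flag_coord l (fun c => s * y c).
Proof.
by case: l => [|[|l]] //=; [move=> [-> ->]|move=> ->]; rewrite mulr0.
Qed.

Lemma flag_coord_succ l y : flag_coord l y -> flag_coord l.+1 y.
Proof. by case: l => [|[|l]] //= []. Qed.

Lemma flag_oppositeD l y z : flag_opposite l y -> flag_opposite l z ->
  flag_opposite l (fun c => y c + z c).
Proof.
case: l => [|[|[|l]]] //=.
- by move=> [-> -> ->] [-> -> ->]; rewrite addr0.
- by move=> [-> ->] [-> ->]; rewrite addr0.
- by move=> -> ->; rewrite addr0.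
Qed.

Lemma flag_oppositeZ l s y :
  flag_opposite l y -> flag_opposite l (fun c => s * y c).
Proof.
case: l => [|[|[|l]]] //=.
- by move=> [-> -> ->]; rewrite mulr0.
- by move=> [-> ->]; rewrite mulr0.
- by move=> ->; rewrite mulr0.
Qed.

Lemma flag_opposite_succ l y : flag_opposite l y -> flag_opposite l.+1 y.
Proof. by case: l => [|[|[|l]]] //= []. Qed.

Lemma flag_opposite_coord l y : flag_opposite l y -> flag_coord l.+1 y.
Proof. by case: l => [|[|[|l]]] //= []. Qed.

Lemma flag_movingD t l y z : flag_moving t l y -> flag_moving t l z ->
  flag_moving t l (fun c => y c + z c).
Proof.
case: l => [|[|[|[|l]]]] //=.
- by move=> [-> -> ->] [-> -> ->]; rewrite addr0.
- by move=> [-> -> ->] [-> -> ->]; rewrite addr0.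
- by move=> [-> ->] [-> ->].
- by move=> e f; rewrite opprD addrACA e f; ring.
Qed.

Lemma flag_movingZ t l s y :
  flag_moving t l y -> flag_moving t l (fun c => s * y c).
Proof.
case: l => [|[|[|[|l]]]] //=.
- by move=> [-> -> ->]; rewrite mulr0.
- by move=> [-> -> ->]; rewrite mulr0.
- by move=> [-> ->].
- by rewrite -!mulrBr mulrCA => ->.
Qed.

Lemma flag_moving_succ t l y : flag_moving t l y -> flag_moving t l.+1 y.
Proof.
case: l => [|[|[|[|l]]]] //=.
- by move=> [-> -> ->].
- by move=> [-> ->]; rewrite !subrr mulr0.
Qed.

Lemma flag_moving_opposite t l y : flag_moving t l y -> flag_opposite l.+1 y.
Proof. by case: l => [|[|[|l]]] //= []. Qed.

Lemma flag_levelD t l u v : flag_level t l u -> flag_level t l v ->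
  flag_level t l (u + v).
Proof.
move=> [u2 u1 u0] [v2 v1 v0]; rewrite /flag_level /=; split.
- have -> : (fun c => coord2 ((u + v) 0 c)) =
      (fun c => coord2 (u 0 c) + coord2 (v 0 c)).
    by apply/funext => c; rewrite mxE; case: (coordD (u 0 c) (v 0 c)).
  exact: flag_coordD.
- have -> : (fun c => coord1 ((u + v) 0 c)) =
      (fun c => coord1 (u 0 c) + coord1 (v 0 c)).
    by apply/funext => c; rewrite mxE; case: (coordD (u 0 c) (v 0 c)).
  exact: flag_oppositeD.
- have -> : (fun c => coord0 ((u + v) 0 c)) =
      (fun c => coord0 (u 0 c) + coord0 (v 0 c)).
    by apply/funext => c; rewrite mxE; case: (coordD (u 0 c) (v 0 c)).
  exact: flag_movingD.
Qed.

Lemma flag_levelZ t l s u : flag_level t l u -> flag_level t l (s%:A *: u).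
Proof.
have [s0 s1 s2] := coord_scalar s; rewrite in_algE in s0 s1 s2.
move=> [u2 u1 u0]; rewrite /flag_level /=; split.
- have -> : (fun c => coord2 ((s%:A *: u) 0 c)) = (fun c => s * coord2 (u 0 c)).
    apply/funext => c; rewrite mxE; case: (coordM s%:A (u 0 c)) => _ _ ->.
    by rewrite s0 s1 s2 !mul0r !addr0.
  exact: flag_coordZ.
- have -> : (fun c => coord1 ((s%:A *: u) 0 c)) = (fun c => s * coord1 (u 0 c)).
    apply/funext => c; rewrite mxE; case: (coordM s%:A (u 0 c)) => _ -> _.
    by rewrite s0 s1 !mul0r !addr0.
  exact: flag_oppositeZ.
- have -> : (fun c => coord0 ((s%:A *: u) 0 c)) = (fun c => s * coord0 (u 0 c)).
    apply/funext => c; rewrite mxE; case: (coordM s%:A (u 0 c)) => -> _ _.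
    by rewrite s0.
  exact: flag_movingZ.
Qed.

Lemma flag_level_mono t l u : flag_level t l u -> flag_level t l.+1 u.
Proof.
move=> [u2 u1 u0]; split; [exact: flag_coord_succ|exact: flag_opposite_succ|].
exact: flag_moving_succ.
Qed.

Lemma flag_level_a t l u : flag_level t l u -> flag_level t l.+1 (a *: u).
Proof.
have [a_0 a_1 a_2] := coord_a.
move=> [u2 u1 u0]; rewrite /flag_level; split.
- have -> : (fun c => coord2 ((a *: u) 0 c)) = (fun c => coord1 (u 0 c)).
    apply/funext => c; rewrite mxE; case: (coordM a (u 0 c)) => _ _ ->.
    by rewrite a_0 a_1 a_2 !mul0r mul1r addr0 add0r.
  exact: flag_opposite_coord.
- have -> : (fun c => coord1 ((a *: u) 0 c)) = (fun c => coord0 (u 0 c)).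
    apply/funext => c; rewrite mxE; case: (coordM a (u 0 c)) => _ -> _.
    by rewrite a_0 a_1 mul0r mul1r add0r.
  exact: flag_moving_opposite u0.
- have -> : (fun c => coord0 ((a *: u) 0 c)) = (fun=> 0).
    by apply/funext => c; rewrite mxE; case: (coordM a (u 0 c)) => -> _ _;
      rewrite a_0 mul0r.
  by case: (l) => [|[|[|m]]] //=; rewrite subrr mulr0.
Qed.

Lemma flag_level_succ t l r u : G 1 r -> flag_level t l u ->
  flag_level t l.+1 (pi r *: u).
Proof.
move=> /linear_a[s [s' ->]] Lu; rewrite scalerDl -scalerA.
apply: flag_levelD; first exact/flag_levelZ/flag_level_mono.
exact/flag_levelZ/flag_level_a.
Qed.

Lemma flag_level_full t l u : (4 <= l)%N -> flag_level t l u.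
Proof. by case: l => [|[|[|[|l]]]]. Qed.

Definition basis_row c : 'rV[A]_3 := delta_mx 0 c.

Lemma scaled_basis_row b c d : (b *: basis_row c) 0 d = if d == c then b else 0.
Proof. by rewrite !mxE eqxx /=; case: eqP; rewrite ?mulr1 ?mulr0. Qed.

Lemma coord_0 : [/\ coord0 0 = 0, coord1 0 = 0 & coord2 0 = 0].
Proof. by have := coord_scalar 0; rewrite rmorph0. Qed.

Lemma coord_aa : [/\ coord0 (a * a) = 0, coord1 (a * a) = 0 & coord2 (a * a) = 1].
Proof. by apply: coord_unique; ring. Qed.

Lemma flag_level_neq0 t : exists2 u, flag_level t 0 u & u != 0.
Proof.
have [z0 z1 z2] := coord_0; have [q0 q1 q2] := coord_aa.
exists ((a * a) *: basis_row o0).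
  by rewrite /flag_level /=; split; rewrite ?scaled_basis_row /=; split;
    rewrite ?scaled_basis_row.
apply/eqP => /rowP/(_ o0); rewrite scaled_basis_row eqxx mxE => e.
by move: q2; rewrite e z2 => /esym/eqP; rewrite oner_eq0.
Qed.

Definition flag_filtration t : filtration G pi 3 :=
  Filtration (@flag_levelD t) (@flag_levelZ t) (@flag_level_succ t)
    (@flag_level_full t) (flag_level_neq0 t).

(** Modulo [a], a matrix respecting the levels preserves two opposite flags and
    a line in general position: it is scalar. It must then also match the planes
    of the third flags. *)
Lemma flag_matrix t t' (P : 'M[A]_3) :
  (forall l u, flag_level t l u -> flag_level t' l (u *m P)) ->
  exists p, (forall c d, coord0 (P c d) = if c == d then p else 0) /\
    t * p = t' * p.
Proof.
move=> PL; have [z0 z1 z2] := coord_0; have [q0 q1 q2] := coord_aa.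
have [a_0 a_1 a_2] := coord_a.
have imE b c d : ((b *: basis_row c) *m P) 0 d = b * P c d.
  by rewrite -scalemxAl mxE -rowE mxE.
have c2aa u : coord2 (a * a * u) = coord0 u.
  by case: (coordM (a * a) u) => _ _ ->; rewrite q0 q1 q2 !mul0r mul1r !add0r.
have c1a u : coord1 (a * u) = coord0 u.
  by case: (coordM a u) => _ -> _; rewrite a_0 a_1 mul0r mul1r add0r.
pose p c d := coord0 (P c d).
(* Each test row is placed at the level where its subspace first appears. *)
have [p01 p02] : p o0 o1 = 0 /\ p o0 o2 = 0.
  have [|[] + + _ _] := PL 0%N ((a * a) *: basis_row o0).
    by rewrite /flag_level /=; split; split; rewrite scaled_basis_row.
  by rewrite !imE !c2aa.
have p12 : p o1 o2 = 0.
  have [|+ _ _] := PL 1%N ((a * a) *: basis_row o1).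
    by rewrite /flag_level /=; split; rewrite ?scaled_basis_row //; split;
      rewrite scaled_basis_row.
  by rewrite /= imE c2aa.
have [p20 p21] : p o2 o0 = 0 /\ p o2 o1 = 0.
  have [|_ [] + + _] := PL 1%N (a *: basis_row o2).
    by rewrite /flag_level /=; split; rewrite ?scaled_basis_row //; split;
      rewrite scaled_basis_row.
  by rewrite !imE !c1a.
have p10 : p o1 o0 = 0.
  have [|_ + _] := PL 2%N (a *: basis_row o1).
    by rewrite /flag_level /=; split; rewrite // !scaled_basis_row /= ?z0 ?z1 ?a_0.
  by rewrite /= imE c1a.
have [one0 one1 _] : [/\ coord0 1 = 1, coord1 1 = 0 & coord2 1 = 0].
  by have := coord_scalar 1; rewrite rmorph1.
have [p00 p11] : p o0 o0 = p o1 o1 /\ p o1 o1 = p o2 o2.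
  have S d : coord0 ((const_mx 1 *m P) 0 d) = p o0 d + p o1 d + p o2 d.
    rewrite mxE coord_sum0 !big_ord_recl big_ord0 /= !mxE !mul1r addr0 addrA.
    by congr (p _ d + p _ d + p _ d); exact: val_inj.
  have [|_ _] := PL 2%N (const_mx 1).
    by rewrite /flag_level /=; split; rewrite ?mxE.
  by rewrite /= !S p01 p02 p10 p12 p20 p21 !addr0 !add0r.
exists (p o1 o1); split=> [c d|].
  have : c \in [:: o0; o1; o2] by case: c => [[|[|[|]]]].
  have : d \in [:: o0; o1; o2] by case: d => [[|[|[|]]]].
  by rewrite !inE => /or3P[]/eqP-> /or3P[]/eqP->.
have im d : coord0 (((basis_row o1 + i t *: basis_row o2) *m P) 0 d) =
    p o1 d + t * p o2 d.
  rewrite mulmxDl mxE imE -[basis_row o1]scale1r imE mul1r.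
  have [-> _ _] := coordD (P o1 d) (i t * P o2 d).
  by have [-> _ _] := coordM (i t) (P o2 d); have [-> _ _] := coord_scalar t.
have entry d : coord0 ((basis_row o1 + i t *: basis_row o2) 0 d) =
    (d == o1)%:R + t * (d == o2)%:R.
  rewrite mxE scaled_basis_row -[basis_row o1]scale1r scaled_basis_row.
  case: eqP => [->|_] /=; first by rewrite addr0 one0 mulr0 addr0.
  rewrite add0r; case: eqP => _; last by rewrite z0 mulr0 addr0.
  by have [-> _ _] := coord_scalar t; rewrite mulr1 add0r.
have [|_ _] := PL 3%N (basis_row o1 + i t *: basis_row o2).
  by rewrite /flag_level /=; split=> //; rewrite !entry /=; ring.
rewrite /= !im p10 p12 p20 p21 -p11 !mulr0 !addr0 add0r !subr0.
by [].
Qed.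

(** Such a [P] is divisible by [a], and [a^3 = 0]. *)
Lemma flag_idempotent (P : 'M[A]_3) :
  (forall c d, coord0 (P c d) = 0) -> P *m P = P -> P = 0.
Proof.
move=> P0 PP; pose P' : 'M[A]_3 :=
  \matrix_(c, d) (i (coord1 (P c d)) + i (coord2 (P c d)) * a).
have PE : P = a *: P'.
  apply/matrixP => c d; rewrite !mxE {1}[P c d]coordE P0; ring.
have P3 : P = (P *m P) *m P by rewrite !PP.
rewrite P3 PE -!scalemxAl -!scalemxAr -!scalemxAl !scalerA a3 scale0r.
by [].
Qed.

(** Endomorphisms are scalar modulo the nilpotent [a], so idempotents are trivial
    and the parameter of the third flag is an invariant. *)
Lemma triple_root_uncountable : ~ countable [set: k] -> krull_dim R 1 ->
  graded_countable_CM_type G -> False.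
Proof.
move=> uk R1 cCM.
pose M t := filtered_module SG N Gx pix (flag_filtration t).
apply: (@countable_type_family _ _ _ M [set: k]) => //.
- by rewrite setCT; exact: countable0.
- move=> t _; split; first exact: (filtered_mcm SG Gx x_reg pix pi_inj pi_surj).
  apply: (filtered_indecomposable SG Gx pix pi_inj pi_surj) => P PL PP.
  have [p [pE _]] := flag_matrix PL.
  have pp : p * p = p.
    have := congr1 (fun M : 'M[A]_3 => coord0 (M o0 o0)) PP.
    rewrite mxE coord_sum0 pE eqxx (bigD1 o0) //= big1 => [|c c0].
      by case: (coordM (P o0 o0) (P o0 o0)) => -> _ _; rewrite pE eqxx addr0.
    case: (coordM (P o0 c) (P c o0)) => -> _ _.
    by rewrite pE eq_sym (negPf c0) mul0r.
  move/eqP: pp; rewrite -subr_eq0 -{3}[p]mulr1 -mulrBr mulf_eq0 subr_eq0.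
  case/orP => /eqP p01; [left|right].
    by apply: flag_idempotent => // c d; rewrite pE p01 if_same.
  apply/esym/eqP; rewrite -subr_eq0; apply/eqP/flag_idempotent.
    move=> c d; rewrite !mxE.
    have <- : coord0 (i (c == d)%:R + i (-1) * P c d) =
        coord0 ((c == d)%:R - P c d).
      by congr coord0; rewrite rmorphN rmorph1 mulN1r rmorph_nat.
    have [-> _ _] := coordD (i (c == d)%:R) (i (-1) * P c d).
    have [-> _ _] := coordM (i (-1)) (P c d).
    have [-> _ _] := coord_scalar (-1); have [-> _ _] := coord_scalar (c == d)%:R.
    by rewrite pE p01 mulN1r; case: (c == d); rewrite subrr.
  by rewrite mulmxBl mul1mx mulmxBr mulmx1 PP subrr subr0.
- move=> t' _; apply: (@sub_countable_set _ _ [set t']); last exact: countable1.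
  move=> t [_ /(filtered_iso_matrix pi_surj)[P [Q [PQ PL]]]].
  have [p [pE tp]] := flag_matrix PL; rewrite /=.
  have p0 : p != 0.
    apply/eqP => p0; have := congr1 (fun M : 'M[A]_3 => coord0 (M o0 o0)) PQ.
    rewrite mxE coord_sum0 big1 => [|c _].
      rewrite mxE eqxx; have [+ _ _] := coord_scalar 1; rewrite rmorph1 => ->.
      by move/esym/eqP; rewrite oner_eq0.
    case: (coordM (P o0 c) (Q c o0)) => -> _ _.
    by rewrite pE p0 if_same mul0r.
  exact: (mulIf p0).
Qed.

End TripleRoot.

(** * Hypersurface rings *)

Lemma horner_alg_sum (k : fieldType) (S : comAlgType k) (X : S) (p : {poly k}) m :
  (size p <= m)%N -> horner_alg X p = \sum_(j < m) p`_j *: X ^+ j.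
Proof.
move=> le_pm; rewrite -{1}[p]coefK poly_def linear_sum /=.
rewrite (big_ord_widen_cond m xpredT (fun j => horner_alg X (p`_j *: 'X^j))) //.
rewrite big_mkcond; apply: eq_bigr => j _ /=.
case: ltnP => [_|le_pj].
  by rewrite linearZ /= rmorphXn /= horner_algX mulr_algl.
by rewrite nth_default ?scale0r.
Qed.

Section GradedIsomorphisms.
Variables (k : fieldType) (S R Q : comAlgType k).
Variables (H : nat -> set S) (G : nat -> set R) (K : nat -> set Q).
Variables (psi : {lrmorphism S -> R}) (rho : {lrmorphism S -> Q}).

(** The isomorphism sends [psi g] to [rho g]. *)
Lemma graded_isomorphic_of_kernels :
  (forall r, exists g, psi g = r) -> (forall z, exists g, rho g = z) ->
  (forall g, psi g = 0 <-> rho g = 0) ->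
  (forall i r, G i r <-> exists2 g, H i g & psi g = r) ->
  (forall i z, K i z <-> exists2 g, H i g & rho g = z) ->
  graded_isomorphic G K.
Proof.
move=> psi_surj rho_surj ker GE KE.
have /choice[lift liftK] : forall r, exists g, psi g = r by [].
have ker2 g g' : psi g = psi g' <-> rho g = rho g'.
  split=> e; apply/eqP; rewrite -subr_eq0 -rmorphB; apply/eqP.
    by apply/(ker (g - g')); rewrite rmorphB /= e subrr.
  by apply/(ker (g - g')); rewrite rmorphB /= e subrr.
pose phi r := rho (lift r).
have phiE g : phi (psi g) = rho g by apply/ker2; rewrite liftK.
have phi_zmod : zmod_morphism phi.
  by move=> r s; rewrite -[r]liftK -[s]liftK -rmorphB !phiE rmorphB.
have phi_monoid : monoid_morphism phi.
  split; first by rewrite -(rmorph1 psi) phiE rmorph1.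
  by move=> r s; rewrite -[r]liftK -[s]liftK -rmorphM !phiE rmorphM.
have phi_scal : scalable phi.
  by move=> c r; rewrite -[r]liftK -linearZ !phiE linearZ.
pose phiL : {lrmorphism R -> Q} := HB.pack phi
  (GRing.isZmodMorphism.Build R Q phi phi_zmod)
  (GRing.isMonoidMorphism.Build R Q phi phi_monoid)
  (GRing.isScalable.Build k R Q *:%R phi phi_scal).
exists phiL; split.
  have /choice[lift' lift'K] : forall z, exists g, rho g = z by [].
  exists (fun z => psi (lift' z)) => [r|z] /=; last by rewrite phiE lift'K.
  by rewrite -{2}[r]liftK; apply/ker2; rewrite lift'K.
move=> i r; rewrite GE KE; split=> [[g Hg <-]|[g Hg gr]]; exists g => //.
by rewrite -[r]liftK; apply/ker2; rewrite gr.
Qed.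

End GradedIsomorphisms.

Section NormalForms.
Variables (k : fieldType) (R : comAlgType k) (G : nat -> set R).
Hypothesis SG : standard_graded G.
Variables (A : comAlgType k) (pi : {lrmorphism R -> A}) (x y : R) (a : A).
Hypotheses (Gx : G 1 x) (pix : pi x = 1) (Gy : G 1 y) (piy : pi y = a).
Hypothesis linear_xy : forall r, G 1 r -> exists s t : k, r = s *: x + t *: y.
Variable e : nat.
Hypothesis e_gt0 : (0 < e)%N.
Hypothesis free_powers : forall c : nat -> k,
  \sum_(j < e) c j *: a ^+ j = 0 -> forall j, (j < e)%N -> c j = 0.

Variables (S : comAlgType k) (H : nat -> set S) (X Y F : S).
Variable psi : {lrmorphism S -> R}.
Hypothesis generators : forall U : set S, U 1 ->
  (forall u v, U u -> U v -> U (u + v)) -> (forall u v, U u -> U v -> U (u * v)) ->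
  (forall c u, U u -> U (c *: u)) -> U X -> U Y -> U = [set: S].
Hypotheses (H1 : H 0 1) (HX : H 1 X) (HY : H 1 Y).
Hypothesis H0 : forall i, H i 0.
Hypothesis HD : forall i u v, H i u -> H i v -> H i (u + v).
Hypothesis HZ : forall i c u, H i u -> H i (c *: u).
Hypothesis HM : forall i j u v, H i u -> H j v -> H (i + j)%N (u * v).
Hypothesis psiG : forall i u, H i u -> G i (psi u).
Hypotheses (psiX : psi X = x) (psiY : psi Y = y) (psiF : psi F = 0).
Hypothesis relation : exists (c : nat -> k) (q : S),
  Y ^+ e - \sum_(j < e) c j *: (Y ^+ j * X ^+ (e - j)) = q * F.

Lemma normal_graded i r : G i r <-> exists2 u, H i u & psi u = r.
Proof.
split=> [|[u Hu <-]]; last exact: psiG.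
elim: i r => [|i IHi] r.
  move=> /(graded0P SG)[c ->]; exists (c *: 1); first exact: HZ.
  by rewrite linearZ /= rmorph1.
rewrite (graded_succ SG) => -[s [+ ->]].
elim: s => [|p s IHs] sG; first by exists 0; rewrite ?big_nil ?rmorph0.
have [u Hu us] := IHs (fun q qs => sG q (@mem_behead _ (p :: s) q qs)).
have [/linear_xy[c [d p1]] /IHi[v Hv vp]] := sG p (mem_head _ _).
exists ((c *: X + d *: Y) * v + u).
  by apply: HD => //; rewrite -add1n; apply: HM => //; apply: HD; exact: HZ.
by rewrite big_cons rmorphD rmorphM rmorphD /= !linearZ /= psiX psiY us vp p1.
Qed.

Lemma normal_surj r : exists u, psi u = r.
Proof.
have [n nr] := sum_components SG r.
have /choice[f fP] : forall j, exists u, psi u = component SG j r.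
  by move=> j; have /normal_graded[u _ <-] := componentG SG j r; exists u.
exists (\sum_(j < n) f j); rewrite [RHS](nr n) // rmorph_sum.
by apply: eq_bigr => j _; exact: fP.
Qed.

Definition normal_form (u : nat -> {poly k}) : S :=
  \sum_(j < e) horner_alg X (u j) * Y ^+ j.

(** The elements with a normal form modulo [F] are stable under multiplication by
    [X], and by [Y] thanks to the relation expressing [Y^e]. *)
Lemma normal_form_exists g : exists u q, g - normal_form u = q * F.
Proof.
pose T := [set g : S | exists u q, g - normal_form u = q * F].
have nfD u v : normal_form (fun j => u j + v j) = normal_form u + normal_form v.
  by rewrite -big_split; apply: eq_bigr => j _; rewrite rmorphD mulrDl.
have nfZ c u : normal_form (fun j => c *: u j) = c *: normal_form u.
  by rewrite scaler_sumr; apply: eq_bigr => j _; rewrite linearZ /= mulr_algl scalerAl.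
have TD g1 g2 : T g1 -> T g2 -> T (g1 + g2).
  move=> [u [q uq]] [v [r vr]]; exists (fun j => u j + v j), (q + r).
  by rewrite nfD mulrDl -uq -vr opprD addrACA.
have TZ c g1 : T g1 -> T (c *: g1).
  move=> [u [q uq]]; exists (fun j => c *: u j), (c *: q).
  by rewrite nfZ -scalerBr uq scalerAl.
have TX g1 : T g1 -> T (g1 * X).
  move=> [u [q uq]]; exists (fun j => u j * 'X), (q * X).
  have -> : normal_form (fun j => u j * 'X) = normal_form u * X.
    rewrite mulr_suml; apply: eq_bigr => j _.
    by rewrite rmorphM /= horner_algX mulrAC.
  by rewrite -mulrBl uq mulrAC.
have TY g1 : T g1 -> T (g1 * Y).
  have [c [q0 rel]] := relation; move=> [u [q uq]].
  exists (fun j => (if j is j'.+1 then u j' else 0) +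
            c j *: (u e.-1 * 'X^(e - j))), (q * Y + horner_alg X (u e.-1) * q0).
  have -> : normal_form (fun j => (if j is j'.+1 then u j' else 0) +
            c j *: (u e.-1 * 'X^(e - j))) =
      normal_form u * Y - horner_alg X (u e.-1) * (q0 * F).
    rewrite nfD -rel mulrBr opprB addrCA [RHS]addrC; congr (_ + _); last first.
      rewrite mulr_sumr; apply: eq_bigr => j _.
      rewrite linearZ /= rmorphM rmorphXn /= horner_algX mulr_algl -scalerAl.
      by rewrite -scalerAr -mulrA [_ * Y ^+ j]mulrC.
    rewrite /normal_form; case: (e) e_gt0 => // e' _.
    rewrite big_ord_recl [in RHS]big_ord_recr /= rmorph0 mul0r add0r mulrDl.
    rewrite -mulrA -exprSr addrK mulr_suml.
    by apply: eq_bigr => j _; rewrite -mulrA -exprSr.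
  have -> : g1 = normal_form u + q * F by rewrite -uq addrC subrK.
  by ring.
suff TT : T = [set: S] by have : T g by rewrite TT.
pose U := [set h : S | forall g1, T g1 -> T (g1 * h)].
have T1 : T 1.
  exists (fun j => if j is 0 then 1 else 0), 0.
  rewrite /normal_form -(prednK e_gt0) big_ord_recl /= rmorph1 mul1r big1.
    by rewrite expr0 addr0 subrr mul0r.
  by move=> j _; rewrite rmorph0 mul0r.
have UT : U = [set: S].
  apply: generators => //.
  - by move=> g1; rewrite mulr1.
  - by move=> u v Uu Uv g1 Tg; rewrite mulrDr; apply: TD; [exact: Uu|exact: Uv].
  - by move=> u v Uu Uv g1 Tg; rewrite mulrA; exact/Uv/Uu.
  - by move=> c u Uu g1 Tg; rewrite -scalerAr; apply: TZ; exact: Uu.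
apply/seteqP; split=> // h _; have : U h by rewrite UT.
by move=> /(_ 1 T1); rewrite mul1r.
Qed.

(** After setting [x = 1], the image of a normal form involves in each degree
    every power [a^j] with [j < e] at most once, and these powers are linearly
    independent. *)
Lemma normal_form_inj u : psi (normal_form u) = 0 -> normal_form u = 0.
Proof.
pose theta r : {poly A} := map_poly pi (component_poly SG r).
have thetaM : {morph theta : r s / r * s} by move=> r s; rewrite /theta !rmorphM.
have theta_sum (T : Type) (s : seq T) (f : T -> R) :
    theta (\sum_(j <- s) f j) = \sum_(j <- s) theta (f j).
  by rewrite /theta !rmorph_sum.
have thetaX r n : G 1 r -> theta (r ^+ n) = (pi r ^+ n) *: 'X^n.
  move=> Gr; rewrite /theta (component_poly_homog SG (gradedX SG n Gr)).
  by rewrite mul1n linearZ /= map_polyXn rmorphXn.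
have theta_horner p : theta (horner_alg x p) = map_poly (in_alg A) p.
  rewrite (horner_alg_sum _ (leqnn _)) theta_sum -[in RHS](coefK p) poly_def.
  rewrite rmorph_sum; apply: eq_bigr => j _.
  rewrite -mulr_algl thetaM (thetaX _ _ Gx) pix expr1n scale1r.
  rewrite /theta (component_poly_homog SG (i := 0)) ?expr0; last first.
    by apply/(graded0P SG); exists p`_j.
  rewrite /= !map_polyZ map_polyXn rmorph1 -scalerAl mul1r.
  by congr (_ *: _); exact: (rmorph_alg pi).
move=> h; have {}h : \sum_(j < e) map_poly (in_alg A) (u j) * (a ^+ j *: 'X^j) = 0.
  rewrite -[RHS](_ : theta 0 = 0); last by rewrite /theta !rmorph0.
  rewrite -h /normal_form rmorph_sum theta_sum; apply: eq_bigr => j _.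
  rewrite rmorphM /= thetaM rmorphXn /= psiY (thetaX _ _ Gy) piy.
  congr (_ * _); rewrite -theta_horner; congr theta.
  rewrite !(horner_alg_sum _ (leqnn (size (u j)))) linear_sum.
  by apply: eq_bigr => l _; rewrite linearZ /= rmorphXn /= psiX.
rewrite /normal_form big1 // => j _; suff -> : u j = 0 by rewrite rmorph0 mul0r.
apply/polyP => l; rewrite coef0.
have := @free_powers
  (fun j' => if (j' <= l + j)%N then (u j')`_(l + j - j') else 0).
move=> /(_ _ j (ltn_ord j)); rewrite leq_addl addnK; apply.
have /polyP/(_ (l + j)%N) := h; rewrite coef0 coef_sum => hl.
rewrite -[RHS]hl.
apply: eq_bigr => j' _; rewrite -scalerAr coefZ coefMXn ltnNge.
case: leqP => _ /=; last by rewrite scale0r mulr0.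
by rewrite coef_map /= mulr_algr.
Qed.

(** Modulo [F] every element of [S] is a combination of the [Y^j] with [j < e]
    over [k[X]], and [psi] is injective on these combinations. *)
Lemma normal_kernel g : psi g = 0 <-> principal_ideal F g.
Proof.
split=> [g0|[q _ <-]]; last by rewrite rmorphM /= psiF mulr0.
have [u [q uq]] := normal_form_exists g.
exists q => //; rewrite -uq normal_form_inj ?subr0 //.
have -> : normal_form u = g - q * F by rewrite -uq subKr.
by rewrite rmorphB rmorphM /= g0 psiF mulr0 subrr.
Qed.

End NormalForms.

Section PolynomialEvaluation.
Variables (k : fieldType) (R : comAlgType k) (n : nat) (h : 'I_n -> R).

Definition mpoly_eval : {mpoly k[n]} -> R := mmap (in_alg R) h.

Lemma mpoly_eval_zmod_morphism : zmod_morphism mpoly_eval.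
Proof. exact: mmapB. Qed.

Lemma mpoly_eval_monoid_morphism : monoid_morphism mpoly_eval.
Proof. by split; [exact: (rmorph1 (mmap _ _))|exact: (rmorphM (mmap _ _))]. Qed.

Lemma mpoly_eval_scalable : scalable mpoly_eval.
Proof. by move=> c p; rewrite /mpoly_eval mmapZ mulr_algl. Qed.

HB.instance Definition _ :=
  GRing.isZmodMorphism.Build {mpoly k[n]} R mpoly_eval mpoly_eval_zmod_morphism.
HB.instance Definition _ :=
  GRing.isMonoidMorphism.Build {mpoly k[n]} R mpoly_eval mpoly_eval_monoid_morphism.
HB.instance Definition _ :=
  GRing.isScalable.Build k {mpoly k[n]} R *:%R mpoly_eval mpoly_eval_scalable.

Lemma mpoly_evalX i : mpoly_eval 'X_i = h i.
Proof. by rewrite /mpoly_eval mmapX mmap1U. Qed.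

Lemma mpoly_eval_graded (G : nat -> set R) (SG : standard_graded G) i p :
  (forall j, G 1 (h j)) -> mpoly_grading i p -> G i (mpoly_eval p).
Proof.
move=> Gh /dhomogP hp; rewrite [p]mpolyE linear_sum big_seq.
apply: (graded_sum SG) => m /hp/= mi; rewrite linearZ; apply: (gradedZ SG).
have <- : (\sum_j m j)%N = i by rewrite -mdegE.
rewrite /= /mpoly_eval mmapX /mmap1.
elim/big_ind2: _ => [|u a v b|j _]; [exact: graded1|exact: gradedM|].
by rewrite -[X in G X]mul1n; exact: gradedX.
Qed.

End PolynomialEvaluation.

Lemma mpoly_generated (k : fieldType) n (U : set {mpoly k[n]}) : U 1 ->
  (forall u v, U u -> U v -> U (u + v)) -> (forall u v, U u -> U v -> U (u * v)) ->
  (forall c u, U u -> U (c *: u)) -> (forall i, U 'X_i) -> U = [set: {mpoly k[n]}].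
Proof.
move=> U1 UD UM UZ UX; apply/seteqP; split=> // p _.
rewrite [p]mpolyE; apply: (big_ind U) => // [|m _].
  by rewrite -(scale0r 1); exact: UZ.
apply: UZ; rewrite mpolyXE_id; apply: (big_ind U) => // i _.
by elim: (m i) => [|l IHl]; rewrite ?expr0 // exprS; exact: UM.
Qed.

Section MpolyGrading.
Variables (k : fieldType) (n : nat).
Local Notation H := (@mpoly_grading k n).

Lemma mpoly_grading1 : H 0 1.
Proof. by rewrite /mpoly_grading /= dhomog1. Qed.

Lemma mpoly_gradingX i : H 1 'X_i.
Proof. by rewrite /mpoly_grading /= dhomogX /= mdeg1. Qed.

Lemma mpoly_grading0 i : H i 0.
Proof. exact: dhomog0. Qed.

Lemma mpoly_gradingD i p q : H i p -> H i q -> H i (p + q).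
Proof. exact: rpredD. Qed.

Lemma mpoly_gradingZ i c p : H i p -> H i (c *: p).
Proof. exact: rpredZ. Qed.

Lemma mpoly_gradingM i j p q : H i p -> H j q -> H (i + j)%N (p * q).
Proof. exact: dhomogM. Qed.

End MpolyGrading.

Lemma scale_in_alg (k : fieldType) (S : comAlgType k) c (u : S) :
  c *: u = in_alg S c * u.
Proof. by rewrite mulr_algl. Qed.

Lemma sum_ord2 (V : nmodType) (f : nat -> V) : \sum_(j < 2) f j = f 0 + f 1.
Proof. by rewrite !big_ord_recr big_ord0 /= add0r. Qed.

Lemma sum_ord3 (V : nmodType) (f : nat -> V) :
  \sum_(j < 3) f j = f 0 + f 1 + f 2.
Proof. by rewrite !big_ord_recr big_ord0 /= add0r. Qed.

Section Hypersurfaces.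
Variables (k : fieldType) (R : comAlgType k) (G : nat -> set R).
Hypothesis SG : standard_graded G.
Variables (A : comAlgType k) (pi : {lrmorphism R -> A}) (x y : R) (a : A).
Hypotheses (Gx : G 1 x) (pix : pi x = 1) (Gy : G 1 y) (piy : pi y = a).
Hypothesis pi_inj : forall i r, G i r -> pi r = 0 -> r = 0.
Hypothesis linear_xy : forall r, G 1 r -> exists s t : k, r = s *: x + t *: y.
Local Notation S := {mpoly k[2]}.
Local Notation iS := (in_alg S).
Local Notation iR := (in_alg R).
Local Notation iA := (in_alg A).
Local Notation X0 := (var_x k).
Local Notation X1 := (var_y k).

Definition two_vars (p q : R) (j : 'I_2) : R := if j == ord0 then p else q.

Lemma eval_x p q : mpoly_eval (two_vars p q) X0 = p.
Proof. exact: mpoly_evalX. Qed.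

Lemma eval_y p q : mpoly_eval (two_vars p q) X1 = q.
Proof. exact: mpoly_evalX. Qed.

Lemma eval_scalar p q c : mpoly_eval (two_vars p q) (iS c) = iR c.
Proof. exact: (rmorph_alg (mpoly_eval (two_vars p q))). Qed.

Definition eval_rules := (eval_x, eval_y, eval_scalar).

(** The linear forms [X] and [Y] in the two variables are those that evaluate to
    [x] and [y]; the equation [F] need only be a divisor of the homogenized
    minimal polynomial of [a], written in [X] and [Y]. *)
Lemma hypersurface_of_relation e p q (F X Y : S) (s0 s1 t0 t1 a0 b0 a1 b1 : k) :
  (0 < e)%N ->
  (forall c : nat -> k, \sum_(j < e) c j *: a ^+ j = 0 ->
     forall j, (j < e)%N -> c j = 0) ->
  G 1 p -> G 1 q ->
  X = iS s0 * X0 + iS s1 * X1 -> Y = iS t0 * X0 + iS t1 * X1 ->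
  X0 = iS a0 * X + iS b0 * Y -> X1 = iS a1 * X + iS b1 * Y ->
  x = iR s0 * p + iR s1 * q -> y = iR t0 * p + iR t1 * q ->
  mpoly_eval (two_vars p q) F = 0 ->
  (exists (c : nat -> k) (g : S),
     Y ^+ e - \sum_(j < e) c j *: (Y ^+ j * X ^+ (e - j)) = g * F) ->
  isomorphic_to_hypersurface G F.
Proof.
move=> e0 free Gp Gq XE YE X0E X1E xE yE F0 rel.
pose psi : {lrmorphism S -> R} := mpoly_eval (two_vars p q).
have psiX : psi X = x.
  by rewrite XE xE /psi /= !rmorphD !rmorphM /= !eval_rules.
have psiY : psi Y = y.
  by rewrite YE yE /psi /= !rmorphD !rmorphM /= !eval_rules.
have HL s t : mpoly_grading 1 (iS s * X0 + iS t * X1).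
  by rewrite !mulr_algl; apply: mpoly_gradingD; apply: mpoly_gradingZ;
    exact: mpoly_gradingX.
have gens (U : set S) : U 1 ->
    (forall u v, U u -> U v -> U (u + v)) -> (forall u v, U u -> U v -> U (u * v)) ->
    (forall c u, U u -> U (c *: u)) -> U X -> U Y -> U = [set: S].
  move=> U1 UD UM UZ UX UY; have UL s t : U (iS s * X + iS t * Y).
    by rewrite !mulr_algl; apply: UD; exact: UZ.
  apply: mpoly_generated => // j.
  have [->|j1] : j = ord0 \/ j = ord_max.
    by case: j => [[|[|]]] // ?; [left|right]; exact: val_inj.
    by rewrite -/(var_x k) X0E.
  by rewrite j1 -/(var_y k) X1E.
have psiG j u : mpoly_grading j u -> G j (psi u).
  by apply: mpoly_eval_graded => // l; rewrite /two_vars; case: ifP.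
have HX : mpoly_grading 1 X by rewrite XE.
have HY : mpoly_grading 1 Y by rewrite YE.
have ker := normal_kernel SG Gx pix Gy piy e0 free gens psiX psiY F0 rel.
have H1 := mpoly_grading1 k 2; have H0 := @mpoly_grading0 k 2.
have HD := @mpoly_gradingD k 2; have HZ := @mpoly_gradingZ k 2.
have HM := @mpoly_gradingM k 2.
have img := normal_graded SG linear_xy H1 HX HY H0 HD HZ HM psiG psiX psiY.
have surj := normal_surj SG linear_xy H1 HX HY H0 HD HZ HM psiG psiX psiY.
have hf : ~ principal_ideal F 1.
  by move=> /ker; rewrite rmorph1 => /eqP; rewrite oner_eq0.
exists hf; apply: (graded_isomorphic_of_kernels (psi := psi)
  (rho := principal_proj hf) (H := @mpoly_grading k 2)) => //.
- exact: principal_proj_surj.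
- by move=> g; rewrite ker principal_proj_eq0.
Qed.


Lemma graded_mul_eq0 i j r s : G i r -> G j s -> pi r * pi s = 0 -> r * s = 0.
Proof.
by move=> Gr Gs rs; apply: (@pi_inj (i + j)); [exact: gradedM|rewrite rmorphM].
Qed.

Lemma linear_factorG r : G 1 (y - iR r * x).
Proof.
by apply: (gradedB SG) => //; rewrite mulr_algl; exact: gradedZ.
Qed.

Lemma pi_linear_factor r : pi (y - iR r * x) = a - iA r.
Proof.
by rewrite rmorphB rmorphM /= pix piy mulr1 [pi _](rmorph_alg pi).
Qed.

Definition quadratic_coef (r1 r2 : k) (j : nat) : k :=
  if j is 0 then - (r1 * r2) else r1 + r2.

Lemma quadratic_relation (r1 r2 : k) (X Y : S) :
  Y ^+ 2 - \sum_(j < 2) quadratic_coef r1 r2 j *: (Y ^+ j * X ^+ (2 - j)) =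
  (Y - iS r1 * X) * (Y - iS r2 * X).
Proof.
rewrite (sum_ord2 (fun j => quadratic_coef r1 r2 j *: (Y ^+ j * X ^+ (2 - j)))).
by rewrite /quadratic_coef !(scale_in_alg _ (_ * _)) !(subSS, subn0); ring.
Qed.

Definition cubic_coef (r1 r2 r3 : k) (j : nat) : k :=
  match j with
  | 0 => r1 * r2 * r3
  | 1 => - (r1 * r2 + r1 * r3 + r2 * r3)
  | _ => r1 + r2 + r3
  end.

Lemma cubic_relation (r1 r2 r3 : k) (X Y : S) :
  Y ^+ 3 - \sum_(j < 3) cubic_coef r1 r2 r3 j *: (Y ^+ j * X ^+ (3 - j)) =
  (Y - iS r1 * X) * ((Y - iS r2 * X) * (Y - iS r3 * X)).
Proof.
rewrite (sum_ord3 (fun j => cubic_coef r1 r2 r3 j *: (Y ^+ j * X ^+ (3 - j)))).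
by rewrite /cubic_coef !(scale_in_alg _ (_ * _)) !(subSS, subn0); ring.
Qed.

Lemma free_powers2 : (forall s t, iA s + iA t * a = 0 -> s = 0 /\ t = 0) ->
  forall c : nat -> k, \sum_(j < 2) c j *: a ^+ j = 0 ->
  forall j, (j < 2)%N -> c j = 0.
Proof.
move=> free c; rewrite (sum_ord2 (fun j => c j *: a ^+ j)).
rewrite !(scale_in_alg _ (a ^+ _)) => h.
have [|c0 c1] := free (c 0%N) (c 1%N); first by rewrite -h; ring.
by case=> [|[|]].
Qed.

Lemma free_powers3 : free1 a (a * a) ->
  forall c : nat -> k, \sum_(j < 3) c j *: a ^+ j = 0 ->
  forall j, (j < 3)%N -> c j = 0.
Proof.
move=> free c; rewrite (sum_ord3 (fun j => c j *: a ^+ j)).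
rewrite !(scale_in_alg _ (a ^+ _)) => h.
have [|c0 c1 c2] := free (c 0%N) (c 1%N) (c 2%N); first by rewrite -h; ring.
by case=> [|[|[|]]].
Qed.

(** Coordinates in which two of the linear factors become the variables. *)
Lemma hypersurface_two_factors e r1 r2 (F : S) : (0 < e)%N ->
  (forall c : nat -> k, \sum_(j < e) c j *: a ^+ j = 0 ->
     forall j, (j < e)%N -> c j = 0) ->
  r1 != r2 ->
  mpoly_eval (two_vars (y - iR r1 * x) (y - iR r2 * x)) F = 0 ->
  (forall X Y : S, Y - iS r1 * X = X0 -> Y - iS r2 * X = X1 ->
    exists (c : nat -> k) (g : S),
      Y ^+ e - \sum_(j < e) c j *: (Y ^+ j * X ^+ (e - j)) = g * F) ->
  isomorphic_to_hypersurface G F.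
Proof.
move=> e0 free r12 F0 rel; pose d := (r2 - r1)^-1.
have dr : d * (r2 - r1) = 1 by rewrite mulVf // subr_eq0 eq_sym.
pose X := iS d * X0 + iS (- d) * X1.
pose Y := iS (d * r2) * X0 + iS (- (d * r1)) * X1.
have X0E : X0 = iS (- r1) * X + iS 1 * Y.
  transitivity (iS (d * (r2 - r1)) * X0); first by rewrite dr rmorph1 mul1r.
  by rewrite /X /Y; ring.
have X1E : X1 = iS (- r2) * X + iS 1 * Y.
  transitivity (iS (d * (r2 - r1)) * X1); first by rewrite dr rmorph1 mul1r.
  by rewrite /X /Y; ring.
apply: (hypersurface_of_relation e0 free (linear_factorG r1) (linear_factorG r2)
  (erefl X) (erefl Y) X0E X1E) => //.
- transitivity (iR (d * (r2 - r1)) * x); first by rewrite dr rmorph1 mul1r.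
  by ring.
- transitivity (iR (d * (r2 - r1)) * y); first by rewrite dr rmorph1 mul1r.
  by ring.
- by apply: rel; [rewrite [RHS]X0E|rewrite [RHS]X1E]; ring.
Qed.

Lemma hypersurface_quadric r1 r2 :
  (forall s t, iA s + iA t * a = 0 -> s = 0 /\ t = 0) ->
  (a - iA r1) * (a - iA r2) = 0 ->
  isomorphic_to_hypersurface G (X0 * X1) \/ isomorphic_to_hypersurface G (X1 ^+ 2).
Proof.
move=> free roots; have free2 := free_powers2 free.
have Rroots : (y - iR r1 * x) * (y - iR r2 * x) = 0.
  apply: (graded_mul_eq0 (linear_factorG _) (linear_factorG _)).
  by rewrite !pi_linear_factor.
have [r12|r12] := eqVneq r1 r2; [right|left].
  apply: (@hypersurface_of_relation 2 x (y - iR r1 * x) _ X0 (iS r1 * X0 + iS 1 * X1)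
    1 0 r1 1 1 0 (- r1) 1) => //; try ring.
  - exact: linear_factorG.
  - by rewrite rmorphXn /= !eval_rules expr2 {2}r12.
  - by exists (quadratic_coef r1 r1), 1; rewrite quadratic_relation; ring.
apply: (@hypersurface_two_factors 2 r1 r2) => //.
  by rewrite rmorphM /= !eval_rules.
move=> X Y XE YE; exists (quadratic_coef r1 r2), 1.
by rewrite quadratic_relation XE YE mul1r.
Qed.

Lemma hypersurface_cubic_double r1 r2 : free1 a (a * a) -> r1 != r2 ->
  (a - iA r1) * ((a - iA r2) * (a - iA r2)) = 0 ->
  isomorphic_to_hypersurface G (X0 * X1 ^+ 2).
Proof.
move=> free r12 roots.
apply: (@hypersurface_two_factors 3 r1 r2) => //; first exact: free_powers3.
  rewrite rmorphM rmorphXn /= !eval_rules expr2.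
  apply: (graded_mul_eq0 (linear_factorG _)
    (gradedM SG (linear_factorG _) (linear_factorG _))).
  by rewrite rmorphM /= !pi_linear_factor.
move=> X Y XE YE; exists (cubic_coef r1 r2 r2), 1.
by rewrite cubic_relation XE YE mul1r expr2.
Qed.

(** The first two factors are scaled by [r3 - r2] and [r1 - r3], so that their sum
    is [r1 - r2] times the third. *)
Lemma hypersurface_cubic_distinct r1 r2 r3 : free1 a (a * a) ->
  r1 != r2 -> r1 != r3 -> r2 != r3 ->
  (a - iA r1) * ((a - iA r2) * (a - iA r3)) = 0 ->
  isomorphic_to_hypersurface G (X0 * X1 * (X0 + X1)).
Proof.
move=> free r12 r13 r23 roots.
have evF p q : mpoly_eval (two_vars p q) (X0 * X1 * (X0 + X1)) = p * q * (p + q).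
  by rewrite !rmorphM rmorphD /= !eval_rules.
pose u := r3 - r2; pose v := r1 - r3.
have u0 : u * u^-1 = 1 by rewrite divff // subr_eq0 eq_sym.
have v0 : v * v^-1 = 1 by rewrite divff // subr_eq0.
pose d := (r2 - r1)^-1; have dr : d * (r2 - r1) = 1.
  by rewrite mulVf // subr_eq0 eq_sym.
pose X := iS (d * u^-1) * X0 + iS (- (d * v^-1)) * X1.
pose Y := iS (d * r2 * u^-1) * X0 + iS (- (d * r1 * v^-1)) * X1.
have X0E : X0 = iS (- (u * r1)) * X + iS u * Y.
  transitivity (iS (d * (r2 - r1) * (u * u^-1)) * X0).
    by rewrite dr u0 mulr1 rmorph1 mul1r.
  by rewrite /X /Y; ring.
have X1E : X1 = iS (- (v * r2)) * X + iS v * Y.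
  transitivity (iS (d * (r2 - r1) * (v * v^-1)) * X1).
    by rewrite dr v0 mulr1 rmorph1 mul1r.
  by rewrite /X /Y; ring.
have GP w r : G 1 (iR w * (y - iR r * x)).
  by rewrite mulr_algl; apply: (gradedZ SG); exact: linear_factorG.
apply: (@hypersurface_of_relation 3 (iR u * (y - iR r1 * x)) (iR v * (y - iR r2 * x))
  _ X Y _ _ _ _ _ _ _ _ isT (free_powers3 free) (GP _ _) (GP _ _)
  (erefl X) (erefl Y) X0E X1E).
- transitivity (iR (d * (u * u^-1)) * (y - iR r1 * x)
      - iR (d * (v * v^-1)) * (y - iR r2 * x)); last by ring.
  rewrite u0 v0 mulr1; transitivity (iR (d * (r2 - r1)) * x); last by ring.
  by rewrite dr rmorph1 mul1r.
- transitivity (iR (d * r2 * (u * u^-1)) * (y - iR r1 * x)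
      - iR (d * r1 * (v * v^-1)) * (y - iR r2 * x)); last by ring.
  rewrite u0 v0 !mulr1; transitivity (iR (d * (r2 - r1)) * y); last by ring.
  by rewrite dr rmorph1 mul1r.
- rewrite evF; have -> : iR u * (y - iR r1 * x) * (iR v * (y - iR r2 * x)) *
      (iR u * (y - iR r1 * x) + iR v * (y - iR r2 * x)) =
      iR (u * v * (r1 - r2)) *
      ((y - iR r1 * x) * ((y - iR r2 * x) * (y - iR r3 * x))).
    by rewrite /u /v; ring.
  rewrite (graded_mul_eq0 (linear_factorG _)
    (gradedM SG (linear_factorG _) (linear_factorG _))) ?mulr0 //.
  by rewrite rmorphM /= !pi_linear_factor.
- have w0 : (u * v * (r1 - r2))^-1 * (u * v * (r1 - r2)) = 1.
    by rewrite mulVf // !mulf_neq0 // subr_eq0 // eq_sym.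
  exists (cubic_coef r1 r2 r3), (iS (u * v * (r1 - r2))^-1).
  have -> : X0 * X1 * (X0 + X1) = iS (u * v * (r1 - r2)) *
      ((Y - iS r1 * X) * ((Y - iS r2 * X) * (Y - iS r3 * X))).
    rewrite [in LHS]X0E [in LHS]X1E; move: (X) (Y) => X' Y'.
    by rewrite /u /v; ring.
  by rewrite cubic_relation [RHS]mulrA -(rmorphM iS) w0 rmorph1 mul1r.
Qed.

End Hypersurfaces.

(** * The line *)

Section LinearCoordinateRing.
Variables (k : fieldType) (R : comAlgType k) (G : nat -> set R).
Hypothesis SG : standard_graded G.
Variables (A : comAlgType k) (pi : {lrmorphism R -> A}) (x : R).
Hypotheses (Gx : G 1 x) (pix : pi x = 1).
Hypothesis linear_x : forall r, G 1 r -> exists s : k, r = s *: x.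

(** The normal forms of the hypersurface case with [e = 1] and [Y = F = 0]. *)
Lemma isomorphic_to_line : graded_isomorphic G (@mpoly_grading k 1).
Proof.
pose S := {mpoly k[1]}.
pose psi : {lrmorphism S -> R} := mpoly_eval (fun=> x).
have linear_x0 r : G 1 r -> exists s t : k, r = s *: x + t *: 0.
  by move=> /linear_x[s ->]; exists s, 0; rewrite scaler0 addr0.
have free : forall c : nat -> k, \sum_(j < 1) c j *: (0 : A) ^+ j = 0 ->
    forall j, (j < 1)%N -> c j = 0.
  move=> c; rewrite big_ord1 expr0 => /eqP; rewrite scaler_eq0 oner_eq0 orbF.
  by move=> /eqP c0 [].
have gens (U : set S) : U 1 ->
    (forall u v, U u -> U v -> U (u + v)) -> (forall u v, U u -> U v -> U (u * v)) ->
    (forall c u, U u -> U (c *: u)) -> U 'X_ord0 -> U 0 -> U = [set: S].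
  by move=> U1 UD UM UZ UX _; apply: mpoly_generated => // i; rewrite ord1.
have psiX : psi 'X_ord0 = x by exact: mpoly_evalX.
have psi0 : psi 0 = 0 by rewrite rmorph0.
have psiG j u : mpoly_grading j u -> G j (psi u).
  by apply: mpoly_eval_graded.
have rel : exists (c : nat -> k) (q : S),
    (0 : S) ^+ 1 - \sum_(j < 1) c j *: (0 ^+ j * 'X_ord0 ^+ (1 - j)) = q * 0.
  by exists (fun=> 0), 0; rewrite big_ord1 scale0r subr0 expr1 mulr0.
have ker := normal_kernel SG Gx pix (graded0 SG 1) (rmorph0 pi) (ltn0Sn 0) free gens
  psiX psi0 psi0 rel.
have H1 := mpoly_grading1 k 1; have H0 := @mpoly_grading0 k 1.
have HD := @mpoly_gradingD k 1; have HZ := @mpoly_gradingZ k 1.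
have HM := @mpoly_gradingM k 1; have HX := @mpoly_gradingX k 1 ord0.
have img := normal_graded SG linear_x0 H1 HX (H0 1%N) H0 HD HZ HM psiG psiX psi0.
have surj := normal_surj SG linear_x0 H1 HX (H0 1%N) H0 HD HZ HM psiG psiX psi0.
apply: (graded_isomorphic_of_kernels (psi := psi) (rho := idfun)
  (H := @mpoly_grading k 1)) => //.
- by move=> z; exists z.
- move=> g; rewrite ker; split=> [[q _ <-]|/= ->]; first by rewrite /= mulr0.
  by exists 0; rewrite ?mulr0.
- by move=> i z; split=> [Hz|[g Hg <-]//]; exists z.
Qed.

End LinearCoordinateRing.

(** * Minimal multiplicity *)

Section QuotientDimension.
Variables (k : fieldType) (V : lmodType k).
Implicit Types U W Z : set V.

Lemma quot_dim_trans U W Z n m :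
  (forall u v, W u -> W v -> W (u - v)) -> (forall c u, W u -> W (c *: u)) ->
  W 0 -> W `<=` U -> Z `<=` W ->
  quot_dim U W n -> quot_dim W Z m -> quot_dim U Z (n + m).
Proof.
move=> WB WZ W0 WU ZW [v [Uv vspan vfree]] [w [Ww wspan wfree]].
have WD u u' : W u -> W u' -> W (u + u').
  by move=> Wu Wu'; rewrite -[u']opprK -(sub0r u'); apply: (WB) => //; exact: WB.
have Wsum (c : 'I_m -> k) : W (\sum_j c j *: w j).
  by apply: (big_ind W) => // j _; exact: WZ.
pose f (T : Type) (a : 'I_n -> T) (b : 'I_m -> T) (i : 'I_(n + m)) : T :=
  match split i with inl j => a j | inr j => b j end.
have fl T (a : 'I_n -> T) b j : f T a b (lshift m j) = a j.
  by rewrite /f (unsplitK (inl j)).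
have fr T (a : 'I_n -> T) b j : f T a b (rshift n j) = b j.
  by rewrite /f (unsplitK (inr j)).
have sumE (c : 'I_(n + m) -> k) : \sum_i c i *: f V v w i =
    \sum_j c (lshift m j) *: v j + \sum_j c (rshift n j) *: w j.
  rewrite big_split_ord; congr (_ + _); apply: eq_bigr => j _.
    by rewrite fl.
  by rewrite fr.
exists (f V v w); split.
- by move=> i; rewrite /f; case: split => j //; exact: WU.
- move=> u /vspan[c /wspan[d Zd]]; exists (f k c d); rewrite sumE opprD addrA.
  congr (Z (_ - _ - _)): Zd; apply: eq_bigr => j _.
    by rewrite fl.
  by rewrite fr.
- move=> c; rewrite sumE => Zc.
  have c1 : forall j, c (lshift m j) = 0.
    apply: vfree; rewrite -[X in W X](addrK (\sum_j c (rshift n j) *: w j)).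
    by apply: WB => //; exact: ZW.
  have c2 : forall j, c (rshift n j) = 0.
    apply: (wfree (fun j => c (rshift n j))).
    rewrite big1 ?add0r in Zc => // j _; by rewrite c1 scale0r.
  by move=> i; case: (splitP i) => j ij;
    [rewrite -(c1 j)|rewrite -(c2 j)]; congr c; exact: val_inj.
Qed.

End QuotientDimension.

Section MinimalMultiplicity.
Variables (k : fieldType) (R : comAlgType k) (G : nat -> set R).
Hypothesis SG : standard_graded G.
Hypothesis R1 : krull_dim R 1.
Local Notation m := (irrelevant_ideal G).

Definition order_ge n : set R :=
  [set r | forall i, (i < n)%N -> component SG i r = 0].

Lemma order_geB n r s : order_ge n r -> order_ge n s -> order_ge n (r - s).
Proof. by move=> rn sn i lt_in; rewrite componentB rn // sn // subr0. Qed.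

Lemma order_geZ n c r : order_ge n r -> order_ge n (c *: r).
Proof. by move=> rn i lt_in; rewrite componentZ rn // scaler0. Qed.

Lemma order_ge0 n : order_ge n 0.
Proof. by move=> i _; rewrite component0. Qed.

Lemma order_ge_homog n i r : (n <= i)%N -> G i r -> order_ge n r.
Proof.
move=> le_ni Gr j lt_jn; rewrite (component_homog SG _ Gr).
by rewrite ltn_eqF // (leq_trans lt_jn).
Qed.

Lemma ideal_mul_sum (I J : set R) (s : seq nat) (f : nat -> R) :
  (forall i, i \in s -> ideal_mul I J (f i)) ->
  ideal_mul I J (\sum_(i <- s) f i).
Proof.
elim: s => [|i s IHs] IJ; first by exists [::]; rewrite !big_nil.
have [t [tP tE]] := IJ i (mem_head _ _).
have [|u [uP uE]] := IHs; first by move=> j js; apply: IJ; rewrite inE js orbT.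
exists (t ++ u); rewrite big_cons big_cat tE uE; split=> // p.
by rewrite mem_cat => /orP[/tP|/uP].
Qed.

(** Products of [n] linear forms span [R_n], so the powers of the irrelevant ideal
    are the steps of the degree filtration. *)
Lemma irrelevant_exp n : ideal_exp m n = order_ge n.
Proof.
elim: n => [|n IHn]; first by apply/seteqP; split.
rewrite /ideal_exp iterS -/(ideal_exp m n) IHn; apply/seteqP; split=> r.
  move=> [s [sP ->]] i lt_in; rewrite component_sum big_seq big1 // => p /sP.
  move=> [/(irrelevantP SG) p1 p2]; rewrite /component rmorphM /= coefM.
  apply: big1 => -[j /= lt_ji] _; case: j lt_ji => [|j] lt_ji.
    by rewrite -/(component SG 0 _) p1 mul0r.
  rewrite -/(component SG (i - j.+1) _) p2 ?mulr0 //.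
  rewrite ltnS in lt_ji; rewrite ltnS in lt_in; apply: leq_trans lt_in.
  by rewrite ltn_subrL //= (leq_ltn_trans _ lt_ji).
move=> rn; have [M rM] := sum_components SG r.
rewrite (rM M (leqnn M)) -(big_mkord xpredT (fun i => component SG i r)).
apply: ideal_mul_sum => i _; have [lt_in|le_ni] := ltnP i n.+1.
  by rewrite rn //; exists [::]; rewrite big_nil.
have := componentG SG i r; rewrite -(prednK (leq_trans (ltn0Sn n) le_ni)).
rewrite (graded_succ SG) => -[s [sP sE]]; exists s; split=> // p /sP[Gp1 Gp2].
split; first exact: irrelevant_homog SG 0%N _ Gp1.
by apply: order_ge_homog Gp2; rewrite -ltnS prednK // (leq_trans (ltn0Sn n) le_ni).
Qed.

Lemma quot_dim_order_ge0 : quot_dim [set: R] (order_ge 1) 1.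
Proof.
exists (fun=> 1); split=> // [r _|c].
  have /(graded0P SG)[c cE] := componentG SG 0 r; exists (fun=> c).
  rewrite big_ord1 => -[|//] _; rewrite componentB cE.
  by rewrite componentZ (component_homog SG _ (graded1 SG)) subrr.
rewrite big_ord1 => /(_ 0%N isT); rewrite componentZ.
rewrite (component_homog SG _ (graded1 SG)) /= => /eqP.
by rewrite scaler_eq0 oner_eq0 orbF => /eqP c0 i; rewrite ord1.
Qed.

Lemma quot_dim_order_ge n (b : nat -> 'I_n -> R) :
  (forall i j, G i.+1 (b i j)) ->
  (forall i r, G i.+1 r -> exists c : 'I_n -> k, r = \sum_j c j *: b i j) ->
  (forall i (c : 'I_n -> k), \sum_j c j *: b i j = 0 -> forall j, c j = 0) ->
  (forall i, quot_dim (order_ge i.+1) (order_ge i.+2) n) /\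
  (forall i, quot_dim [set: R] (order_ge i.+1) (1 + i * n)).
Proof.
move=> Gb span free.
have step i : quot_dim (order_ge i.+1) (order_ge i.+2) n.
  have Gsum (c : 'I_n -> k) : G i.+1 (\sum_j c j *: b i j).
    by apply: (graded_sum SG) => j _; exact: gradedZ.
  exists (b i); split.
  - by move=> j; apply: order_ge_homog (Gb i j).
  - move=> r ri; have [c cE] := span i _ (componentG SG i.+1 r); exists c => j.
    rewrite ltnS leq_eqVlt componentB (component_homog SG _ (Gsum c)).
    by move=> /orP[/eqP->|lt_ji]; rewrite ?eqxx ?cE ?subrr // ri // ltn_eqF // subr0.
  - move=> c /(_ i.+1 (leqnn _)); rewrite (component_homog SG _ (Gsum c)) eqxx.
    exact: free.
split=> //; elim=> [|i IHi]; first by rewrite mul0n; exact: quot_dim_order_ge0.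
rewrite mulSnr addnA; apply: quot_dim_trans IHi (step i) => //.
- exact: order_geB.
- exact: order_geZ.
- exact: order_ge0.
- by move=> r ri j lt_ji; apply: ri; rewrite ltnS ltnW.
Qed.

Variables (A : comAlgType k) (pi : {lrmorphism R -> A}) (x y z : R).
Hypotheses (Gx : G 1 x) (x_reg : forall v, x * v = 0 -> v = 0) (pix : pi x = 1).
Hypothesis pi_inj : forall i r, G i r -> pi r = 0 -> r = 0.
Hypotheses (Gy : G 1 y) (Gz : G 1 z).
Hypothesis free_yz : free1 (pi y) (pi z).
Hypothesis span_yz : forall u, span2 (pi y) (pi z) u.

Lemma piece_span i r : G i.+1 r ->
  exists s t u : k, r = x ^+ i * (s *: x + t *: y + u *: z).
Proof.
move=> Gr; have [s [t [u e]]] := span_yz (pi r); exists s, t, u.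
have GL : G 1 (s *: x + t *: y + u *: z).
  by apply: (gradedD SG); [apply: (gradedD SG)|]; exact: gradedZ.
apply/eqP; rewrite -subr_eq0; apply/eqP/(@pi_inj i.+1).
  apply: (gradedB SG) => //; rewrite -addn1; apply: (gradedM SG) => //.
  by rewrite -[X in G X]mul1n; exact: gradedX.
rewrite rmorphB rmorphM rmorphXn /= pix expr1n mul1r !rmorphD /= !linearZ /= pix e.
by rewrite !mulr_algl subrr.
Qed.

(** All pieces of positive degree have dimension three, so [R / m^(n+1)] has
    length [3 n + 1] and the multiplicity is three. *)
Lemma minimal_multiplicity_of_span : cohen_macaulay G ->
  minimal_multiplicity G /\ h_vector G [:: 1%N; 2%N].
Proof.
move=> CM; pose b i (j : 'I_3) := x ^+ i * [:: x; y; z]`_j.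
have sumb i (c : 'I_3 -> k) : \sum_j c j *: b i j =
    x ^+ i * (c (inord 0) *: x + c (inord 1) *: y + c (inord 2) *: z).
  rewrite !big_ord_recr big_ord0 /= add0r !mulrDr !scalerAr /b /=.
  by congr (_ * (c _ *: _) + _ * (c _ *: _) + _ * (c _ *: _)); apply: val_inj;
    rewrite /= inordK.
have [|||step total] := @quot_dim_order_ge 3 b.
- move=> i j; rewrite -addn1; apply: (gradedM SG).
    by rewrite -[X in G X]mul1n; exact: gradedX.
  by case: j => [[|[|[|]]]].
- move=> i r /piece_span[s [t [u ->]]].
  exists (fun j => [:: s; t; u]`_j); rewrite sumb.
  by rewrite !inordK.
- move=> i c; rewrite sumb => h.
  have [|c0 c1 c2] := @free_yz (c (inord 0)) (c (inord 1)) (c (inord 2)).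
    have := congr1 pi h; rewrite rmorph0 rmorphM rmorphXn /= pix expr1n mul1r.
    by rewrite !rmorphD /= !linearZ /= pix !mulr_algl.
  by move=> j; rewrite -(inord_val j); case: j => [[|[|[|]]]].
split.
  split=> //; exists 3%N, 3%N, 1%N; split=> //.
    have c3 : size (3%:R%:P : {poly rat}) = 1%N by rewrite size_polyC.
    have c3X : size (3%:R%:P * 'X : {poly rat}) = 2%N.
      by rewrite size_mulX ?c3 // -size_poly_eq0 c3.
    exists 1%N, (3%:R%:P * 'X + 1%:P); split=> //.
    - by rewrite size_polyDl c3X // size_polyC.
    - by rewrite lead_coefDl ?c3X ?size_polyC // lead_coefMX lead_coefC mulr1.
    - exists 0%N => n _; exists (1 + n * 3)%N.
        by rewrite irrelevant_exp.
      by rewrite !hornerE natrD natrM mulrC addrC.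
  rewrite irrelevant_exp; have -> : m = order_ge 1.
    apply/seteqP; split=> r.
      by move=> /(irrelevantP SG) r0 [].
    by move=> r1; apply/(irrelevantP SG); exact: r1.
  exact: step.
exists 1%N, [:: x]; split.
  split=> //; first by move=> w; rewrite inE => /eqP->.
  split.
    case=> // _ v /seq_span0 /x_reg ->; exact/seq_span0.
  move=> e; have : [set: R^o] 1 by []. rewrite -e => /seq_span1[w].
  move=> /(congr1 (component SG 0)); rewrite (component_homog SG _ (graded1 SG)).
  rewrite (component_mull SG _ _ Gx) /= => /eqP.
  by rewrite oner_eq0.
split=> //; case=> [|[|i]] /=.
- exists (fun=> 1); split=> [_|r /(graded0P SG)[c ->]|c].
  + exact: graded1.
  + exists (fun=> c); rewrite big_ord1 subrr; split; first exact: graded0.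
    by apply/seq_span1; exists 0; rewrite scaler0.
  + rewrite big_ord1 => -[_ /seq_span1[w]] /(congr1 (component SG 0)).
    rewrite componentZ (component_homog SG _ (graded1 SG)).
    rewrite (component_mull SG _ _ Gx) /= => /eqP.
    by rewrite scaler_eq0 oner_eq0 orbF => /eqP c0 j; rewrite ord1.
- pose v (j : 'I_2) := if j == ord0 then y else z.
  have sumv (c : 'I_2 -> k) : \sum_j c j *: v j = c ord0 *: y + c ord_max *: z.
    rewrite !big_ord_recr big_ord0 /= add0r; congr (_ *: _ + _ *: _); congr c;
    exact: val_inj.
  exists v; split=> [j|r Gr|c].
  + by rewrite /v; case: ifP.
  + have [s [t [u rE]]] := piece_span Gr.
    exists (fun j => if j == ord0 then t else u); rewrite sumv /=.
    have -> : r - (t *: y + u *: z) = s *: x.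
      by rewrite rE mul1r -(addrA (s *: x)) addrK.
    split; first exact: gradedZ.
    by apply/seq_span1; exists (s *: 1); rewrite -[RHS]scalerAr mulr1.
  + rewrite sumv => -[_ /seq_span1[w e]].
    have /(graded0P SG)[s ws] := componentG SG 0 w.
    have GL : G 1 (c ord0 *: y + c ord_max *: z).
      by apply: (gradedD SG); exact: gradedZ.
    have [|_ c0 c1] := @free_yz (- s) (c ord0) (c ord_max).
      have := congr1 (component SG 1) e; rewrite (component_homog SG _ GL) eqxx.
      rewrite (component_mull SG _ _ Gx) /= ws => /(congr1 pi).
      rewrite rmorphM rmorphD /= !linearZ /= pix rmorph1 mul1r => h.
      by rewrite !mulr_algl -addrA h scaleNr addNr.
    move=> j; have [->|->] // : j = ord0 \/ j = ord_max.
    by case: j => [[|[|]]] // ?; [left|right]; exact: val_inj.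
- rewrite nth_nil; exists (fun=> 0); split=> [[]//|r Gr|c _ []//].
  exists (fun=> 0); rewrite big_ord0 subr0; split=> //.
  have [s [t [u ->]]] := piece_span Gr.
  by rewrite exprS -mulrA; apply/seq_span1; eexists.
Qed.

End MinimalMultiplicity.

(** * The classification *)

Lemma uncountable_avoids (k : eqType) : ~ countable [set: k] ->
  forall s : seq k, exists t, t \notin s.
Proof.
move=> uk s; apply: contrapT => /forallNP no; apply: uk.
apply: (@sub_countable_set _ _ [set` s]).
  by move=> t _; apply/negPn/negP => /no.
exact/finite_set_countable/finite_seq.
Qed.

Section Roots.
Variables (k : closedFieldType) (A : comAlgType k) (a : A).
Local Notation i := (in_alg A).

Lemma quadratic_roots : span1 a (a * a) ->
  exists r1 r2, (a - i r1) * (a - i r2) = 0.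
Proof.
move=> [s [t aa]].
have [r rE] := solve_monicpoly (fun j => if j is 0 then s else t) (ltn0Sn 1).
rewrite (sum_ord2 (fun j => (if j is 0 then s else t) * r ^+ j)) in rE.
exists r, (t - r).
have -> : (a - i r) * (a - i (t - r)) = a * a - (i s + i t * a) -
  i (r ^+ 2 - (s * r ^+ 0 + t * r ^+ 1)) by ring.
by rewrite aa rE !subrr rmorph0 subr0.
Qed.

Lemma cubic_roots : span2 a (a * a) (a * (a * a)) ->
  exists r1 r2 r3, (a - i r1) * ((a - i r2) * (a - i r3)) = 0.
Proof.
move=> [s [t [u aaa]]]; pose c j := match j with 0 => s | 1 => t | _ => u end.
have [r rE] := solve_monicpoly c (ltn0Sn 2).
rewrite (sum_ord3 (fun j => c j * r ^+ j)) /c in rE.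
(* the roots of the quotient of the cubic by its linear factor *)
have [q qE] := solve_monicpoly
  (fun j => if j is 0 then t + u * r - r ^+ 2 else u - r) (ltn0Sn 1).
rewrite (sum_ord2
  (fun j => (if j is 0 then t + u * r - r ^+ 2 else u - r) * q ^+ j)) in qE.
exists r, q, (u - r - q).
have -> : (a - i r) * ((a - i q) * (a - i (u - r - q))) =
    a * (a * a) - (i s + i t * a + i u * (a * a)) -
    (a - i r) * i (q ^+ 2 - ((t + u * r - r ^+ 2) * q ^+ 0 + (u - r) * q ^+ 1)) -
    i (r ^+ 3 - (s * r ^+ 0 + t * r ^+ 1 + u * r ^+ 2)) by ring.
by rewrite aaa rE qE !subrr rmorph0 mulr0 !subr0.
Qed.

End Roots.

Theorem corollary3p5 (k : closedFieldType) (k_uncountable : ~ countable [set: k])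
    (k_char0 : [pchar k] =i pred0)
    (R : comAlgType k) (G : nat -> set R)
    (R_standard : standard_graded G) (R_CM : cohen_macaulay G)
    (R_dim1 : krull_dim R 1)
    (R_countable : graded_countable_CM_type G) :
  let x := var_x k in
  let y := var_y k in
  (minimal_multiplicity G /\ h_vector G [:: 1%N; 2%N])
  \/ graded_isomorphic G (@mpoly_grading k 1)
  \/ isomorphic_to_hypersurface G (x * y)
  \/ isomorphic_to_hypersurface G (x * y * (x + y))
  \/ isomorphic_to_hypersurface G (x * y ^+ 2)
  \/ isomorphic_to_hypersurface G (y ^+ 2).
Proof.
move=> X Y; have SG := R_standard.
have two_neq0 : 2%:R != 0 :> k.
  by have := k_char0 2; rewrite !inE /= => /negbT.
have depth1 : depth (irrelevant_ideal G) R^o 1.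
  by have [d [Rd dd]] := R_CM; rewrite (krull_dim_unique Rd R_dim1) in dd.
have [x Gx x_reg] :=
  linear_nonzerodivisor SG (uncountable_avoids k_uncountable) depth1.
have [A [pi [N [pix pi_inj pi_surj]]]] := dehomogenization SG Gx x_reg R_dim1.
have dim3 (c d e : A) : free1 c d -> span2 c d e.
  move=> fcd; apply: contrapT => ecd.
  apply: (no_uncountable_moduli SG Gx x_reg pix pi_inj pi_surj k_uncountable
    R_dim1 R_countable).
  exact: moduli_of_dim_gt3 two_neq0 _ _ _ fcd ecd.
have lift_linear r w : G 1 r -> G 1 w -> pi r = pi w -> r = w.
  move=> Gr Gw e; apply/eqP; rewrite -subr_eq0; apply/eqP/(@pi_inj 1).
    exact: gradedB.
  by rewrite rmorphB /= e subrr.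
have [scalar|] := pselect (forall r, G 1 r -> exists s, pi r = in_alg A s).
  right; left; apply: (isomorphic_to_line SG Gx pix) => r Gr.
  have [s rs] := scalar r Gr; exists s; apply: lift_linear => //.
    exact: gradedZ.
  by rewrite linearZ /= pix.
move=> /existsNP[y /not_implyP[Gy ny]]; set a := pi y in ny.
have free_a s t : in_alg A s + in_alg A t * a = 0 -> s = 0 /\ t = 0.
  move=> h; have [t0|t0] := eqVneq t 0.
    split=> //; apply: (@in_alg_inj _ A); rewrite rmorph0 -h t0.
    by rewrite rmorph0 mul0r addr0.
  case: ny; exists (- t^-1 * s); apply/eqP; rewrite -subr_eq0; apply/eqP.
  transitivity (in_alg A t^-1 * (in_alg A s + in_alg A t * a)); last first.
    by rewrite h mulr0.
  rewrite mulrDr mulrA -!(rmorphM (in_alg A)) mulVf // rmorph1; ring.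
have free_ext d : ~ span1 a d -> free1 a d.
  move=> nd s t u h; have [u0|u0] := eqVneq u 0.
    by have [|-> ->] := free_a s t; [rewrite -h u0; ring|].
  case: nd; exists (- u^-1 * s), (- u^-1 * t).
  apply/eqP; rewrite -subr_eq0; apply/eqP.
  transitivity (in_alg A u^-1 * (in_alg A s + in_alg A t * a + in_alg A u * d)).
    rewrite [RHS]mulrDr (mulrA _ (in_alg A u)) -(rmorphM (in_alg A) _ u) mulVf //.
    by rewrite rmorph1; ring.
  by rewrite h mulr0.
have [planar|] := pselect (forall r, G 1 r -> span1 a (pi r)); last first.
  move=> /existsNP[z /not_implyP[Gz nz]]; left.
  have fyz := free_ext _ nz.
  exact: (minimal_multiplicity_of_span SG R_dim1 Gx x_reg pix pi_inj Gy Gz fyz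
    (fun u => dim3 _ _ u fyz) R_CM).
right; right.
have linear_xy w r : G 1 w -> G 1 r -> span1 (pi w) (pi r) ->
    exists s t : k, r = s *: x + t *: w.
  move=> Gw Gr [s [t rE]]; exists s, t; apply: lift_linear => //.
    by apply: (gradedD SG); exact: gradedZ.
  by rewrite rE rmorphD /= !linearZ /= pix !mulr_algl.
have linear_y r (Gr : G 1 r) := linear_xy y r Gy Gr (planar r Gr).
have [aa|naa] := pselect (span1 a (a * a)).
  have [r1 [r2 roots]] := quadratic_roots aa.
  have [h|h] :=
    hypersurface_quadric SG Gx pix Gy (erefl a) pi_inj linear_y free_a roots.
    by left.
  by do 3!right.
have faa := free_ext _ naa.
have [r1 [r2 [r3 roots]]] := cubic_roots (dim3 _ _ (a * (a * a)) faa).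
have double r s : r != s ->
    (a - in_alg A r) * ((a - in_alg A s) * (a - in_alg A s)) = 0 ->
    isomorphic_to_hypersurface G (X * Y ^+ 2).
  move=> rs h.
  exact: (hypersurface_cubic_double SG Gx pix Gy (erefl a) pi_inj linear_y faa rs h).
have [r12|r12] := eqVneq r1 r2; have [r13|r13] := eqVneq r1 r3.
- (* A triple root: the shifted generator [b] satisfies [b^3 = 0]. *)
  exfalso; pose b := a - in_alg A r1.
  have fb : free1 b (b * b).
    move=> s t u h.
    have [|s0 t0 u0] := @faa (s - t * r1 + u * r1 ^+ 2) (t - 2%:R * u * r1) u.
      by rewrite -h /b; ring.
    move: s0 t0; rewrite u0 mulr0 !mul0r subr0 addr0 => + t0.
    by rewrite t0 mul0r subr0.
  have b3 : b * (b * b) = 0 by rewrite -roots -r12 -r13.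
  have linear_b r : G 1 r -> span1 b (pi r).
    move=> /planar[s [t ->]]; exists (s + t * r1), t; rewrite /b; ring.
  exact: (triple_root_uncountable SG Gx x_reg pix pi_inj pi_surj b3 fb
    (fun u => dim3 _ _ u fb) linear_b k_uncountable R_dim1 R_countable).
- right; right; left; apply: (double r3 r1); first by rewrite eq_sym.
  by rewrite -roots -r12; ring.
- right; right; left; apply: (double r2 r1); first by rewrite eq_sym.
  by rewrite -roots -r13; ring.
- have [r23|r23] := eqVneq r2 r3.
    right; right; left; apply: (double r1 r2) => //.
    by rewrite -roots -r23.
  right; left.
  exact: (hypersurface_cubic_distinct SG Gx pix Gy (erefl a) pi_inj linear_y faa
    r12 r13 r23 roots).
Qed.
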